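(* For every $n\geq 0$, the mapping $\Phi$ is a bijection between excursions of size $n$ and bridgeless 2-near-cubic marked-depth-maps of size $n$.
   Context: Words are on $\{a,b,c\}$; $|w|_\alpha$ counts occurrences of $\alpha$. An excursion is a word $w$ with every prefix $w'$ satisfying $|w'|_a+|w'|_b\leq 2|w'|_c$ and $|w|_a+|w|_b=2|w|_c$; an excursion of length $3n$ has size $n$. Maps: a planar map is a connected planar graph (loops, multiple edges allowed) embedded in the sphere up to orientation-preserving homeomorphism; edges consist of two half-edges. A rooted map has a distinguished half-edge (root); its edge is the root-edge and its endpoint the root-vertex. A map is 2-near-cubic if the root-vertex has degree 2 and all other vertices degree 3; a 2-near-cubic map has size $n$ if it has $3n+1$ edges. Bridgeless: no edge whose deletion disconnects the map. Given a spanning tree $T$, its edges are internal, others external; $u$ is an ancestor of $v$ if $u$ lies on the $T$-path from root-vertex to $v$; comparable = one is ancestor of the other. A depth tree is a spanning tree such that every external edge joins comparable vertices and the root-edge is external. A marked-depth-map is a map with a distinguished depth tree and a marked external edge. Growing maps: a rooted map with some legs (half-edges not belonging to a complete edge), one of them the head, all legs in one face (head-face); the head's endpoint is the head-vertex; the root may be a leg. A tree-growing map has a distinguished spanning tree. The tour of the head-face follows its border counterclockwise from the head and orders the other legs, defining the first and last legs. Construction of $\Phi$: $M^0_\bullet$ is one vertex with two legs, the root and the head, tree = that vertex. $\varphi_a(M_T)$ (resp. $\varphi_b$) replaces the head by a complete edge $e$ from the head-vertex to a new vertex $v$ carrying the new head and one further leg immediately at the left (resp. right) of the new head; the tree becomes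 $T\cup\{e,v\}$. $\varphi_c(M_T)$ is defined when the first and last legs exist and have distinct comparable endpoints; naming them $s,t$ with endpoint of $s$ an ancestor of that of $t$, glue the head and $s$ into an edge and make $t$ the new head; $T$ unchanged. For $w=a_1\cdots a_m$, $\varphi_w=\varphi_{a_1}\circ\cdots\circ\varphi_{a_m}$ (letters read right to left). For an excursion $w$, $\varphi_w(M^0_\bullet)$ is well defined and has exactly one leg besides the head; $\Phi(w)$ is the map with spanning tree obtained by gluing the head and this leg into a marked edge. *)

(* Defs.v *)
From HB Require Import structures.
From mathcomp Require Import all_boot.

Set Implicit Arguments.
Unset Strict Implicit.
Unset Printing Implicit Defensive.

(** Words and excursions *)

Variant letter := La | Lb | Lc.

Definition ord_of_letter (l : letter) : 'I_3 :=
  match l with La => inord 0 | Lb => inord 1 | Lc => inord 2 end.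
Definition letter_of_ord (i : 'I_3) : letter :=
  match val i with 0 => La | 1 => Lb | _ => Lc end.
Lemma ord_of_letterK : cancel ord_of_letter letter_of_ord.
Proof. by case; rewrite /letter_of_ord /= inordK. Qed.
HB.instance Definition _ := Finite.copy letter (can_type ord_of_letterK).

Definition excursion (w : seq letter) : Prop :=
  (forall w', prefix w' w ->
     count_mem La w' + count_mem Lb w' <= 2 * count_mem Lc w') /\
  count_mem La w + count_mem Lb w = 2 * count_mem Lc w.

Definition excursion_of_size (n : nat) (w : seq letter) : Prop :=
  excursion w /\ size w = 3 * n.

(** Maps with a distinguished set of edges

   A map on an oriented surface is encoded by its half-edges, the rotation
   [ccw] sending a half-edge to the next one counterclockwise around its
   endpoint, and [opp] sending a half-edge to the other half of its edge.  A leg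
   is a half-edge fixed by [opp].  Vertices, edges and faces are sets of
   half-edges.  An orientation-preserving homeomorphism between two maps is a
   bijection of half-edges commuting with [ccw] and [opp].  The records carry
   data only; the axioms are in [planar_map] and [spanning_tree].  A set of edges
   such as [tree] is the set of their half-edges. *)

Record tree_map := TreeMap {
  hedge : finType;
  ccw : hedge -> hedge;
  opp : hedge -> hedge;
  root_he : hedge;
  tree : {set hedge} }.

Section TreeMap.
Variable M : tree_map.
Implicit Types (h : hedge M) (u v : {set hedge M}) (S : {set hedge M}).

Definition is_leg h : bool := opp h == h.

Definition vertex h : {set hedge M} := [set x | fconnect (@ccw M) h x].
Definition edge h : {set hedge M} := [set h; opp h].

(* Walking from the endpoint of [h] along its edge with the face on the right;
   a leg is walked around. *)
Definition face_next h : hedge M := ccw (opp h).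
Definition face h : {set hedge M} := [set x | fconnect face_next h x].

Definition root_vertex : {set hedge M} := vertex (root_he M).

Definition vadj S u v : bool :=
  [exists h in S, (u == vertex h) && (v == vertex (opp h))].

Definition connected_by S : Prop :=
  forall h h', connect (vadj S) (vertex h) (vertex h').

(* The last equation is Euler's formula, i.e. the surface is a sphere. *)
Definition planar_map : Prop :=
  [/\ injective (@ccw M), involutive (@opp M), forall h, ~~ is_leg h,
      connected_by [set: hedge M]
    & #|[set vertex h | h : hedge M]| + #|[set face h | h : hedge M]|
      = #|[set edge h | h : hedge M]| + 2].

Definition bridgeless : Prop := forall h, connected_by (~: edge h).

Definition near_cubic2 : Prop :=
  #|root_vertex| = 2 /\
  forall h, vertex h != root_vertex -> #|vertex h| = 3.

(* [c] lists the half-edges leaving the successive vertices of a simple cycle of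
   [tree]; distinctness of the edges excludes going back and forth along one
   edge. *)
Definition tree_cycle (c : seq (hedge M)) : bool :=
  [&& c != [::], all (mem (tree M)) c,
      cycle (fun h h' => vertex (opp h) == vertex h') c,
      uniq (map vertex c) & uniq (map edge c)].

Definition spanning_tree : Prop :=
  [/\ forall h, h \in tree M -> opp h \in tree M,
      connected_by (tree M)
    & forall c, ~~ tree_cycle c].

Definition tree_path u v (p : seq {set hedge M}) : bool :=
  [&& path (vadj (tree M)) u p, last u p == v & uniq (u :: p)].

(* The length bound is no restriction, since there are at most as many vertices
   as half-edges; it makes the predicate boolean. *)
Definition ancestor u v : bool :=
  [exists p : #|hedge M|.-bseq {set hedge M},
     tree_path root_vertex v p && (u \in root_vertex :: p)].

Definition tree_comparable u v : bool := ancestor u v || ancestor v u.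

Definition depth_tree : Prop :=
  [/\ spanning_tree,
      forall h, h \notin tree M -> tree_comparable (vertex h) (vertex (opp h))
    & root_he M \notin tree M].

End TreeMap.

(** Marked-depth-maps *)

Record marked_map := MarkedMap {
  marked_base :> tree_map;
  marked_edge : {set hedge marked_base} }.

Definition marked_depth_map (M : marked_map) : Prop :=
  [/\ planar_map M, depth_tree M
    & exists2 h : hedge M, h \notin tree M & marked_edge M = edge h].

Definition bridgeless_near_cubic_mdm (n : nat) (M : marked_map) : Prop :=
  [/\ marked_depth_map M, bridgeless M, near_cubic2 M
    & #|[set edge h | h : hedge M]| = 3 * n + 1].

Definition marked_iso (M N : marked_map) : Prop :=
  exists f : hedge M -> hedge N,
    [/\ bijective f,
        forall h, f (ccw h) = ccw (f h),
        forall h, f (opp h) = opp (f h),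
        f (root_he M) = root_he N
      & (forall h, (f h \in tree N) = (h \in tree M)) /\
        f @: marked_edge M = marked_edge N].

(** Tree-growing maps and the mapping Phi *)

Record growing_map := GrowingMap {
  growing_base :> tree_map;
  head_he : hedge growing_base }.

(* The legs other than the head, in the order of the tour of the head-face with
   that face on the right, i.e. counterclockwise around the map when the
   head-face is drawn as the infinite face. *)
Definition tour_legs (M : growing_map) : seq (hedge M) :=
  [seq h <- orbit (@face_next M) (head_he M) | is_leg h & h != head_he M].

Definition glue_opp (M : tree_map) (x y h : hedge M) : hedge M :=
  if h == x then y else if h == y then x else opp h.

Definition glue (M : tree_map) (x y : hedge M) : tree_map :=
  TreeMap (@ccw M) (glue_opp x y) (root_he M) (tree M).

(* [false] is the root and [true] the head. *)
Definition M0 : growing_map :=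
  @GrowingMap (TreeMap negb id false set0) true.

Variant new_hedge := NewTail | NewHead | NewLeg.

Definition ord_of_new (x : new_hedge) : 'I_3 :=
  match x with NewTail => inord 0 | NewHead => inord 1 | NewLeg => inord 2 end.
Definition new_of_ord (i : 'I_3) : new_hedge :=
  match val i with 0 => NewTail | 1 => NewHead | _ => NewLeg end.
Lemma ord_of_newK : cancel ord_of_new new_of_ord.
Proof. by case; rewrite /new_of_ord /= inordK. Qed.
HB.instance Definition _ := Finite.copy new_hedge (can_type ord_of_newK).

(* Counterclockwise order around the new vertex.  Facing outwards along the head,
   its left neighbour is its counterclockwise successor and its right neighbour
   its counterclockwise predecessor. *)
Definition ccw_leg_left (x : new_hedge) : new_hedge :=
  match x with NewHead => NewLeg | NewLeg => NewTail | NewTail => NewHead end.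
Definition ccw_leg_right (x : new_hedge) : new_hedge :=
  match x with NewHead => NewTail | NewTail => NewLeg | NewLeg => NewHead end.

Section Grow.
Variables (rho : new_hedge -> new_hedge) (M : growing_map).

Definition grow_ccw (h : hedge M + new_hedge) : hedge M + new_hedge :=
  match h with inl x => inl (ccw x) | inr x => inr (rho x) end.

Definition grow_opp (h : hedge M + new_hedge) : hedge M + new_hedge :=
  match h with
  | inl x => if x == head_he M then inr NewTail else inl (opp x)
  | inr NewTail => inl (head_he M)
  | inr x => inr x
  end.

Definition grow_tree : {set hedge M + new_hedge} :=
  [set inl x | x in tree M] :|: [set inl (head_he M); inr NewTail].

Definition grow : growing_map :=
  @GrowingMap (TreeMap grow_ccw grow_opp (inl (root_he M)) grow_tree)
    (inr NewHead).

End Grow.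

Definition phi_a : growing_map -> growing_map := grow ccw_leg_left.
Definition phi_b : growing_map -> growing_map := grow ccw_leg_right.

Definition phi_c (M : growing_map) : option growing_map :=
  let glue_to s t := Some (@GrowingMap (glue (head_he M) s) t) in
  match tour_legs M with
  | [::] => None
  | l :: ls =>
    let l' := last l ls in
    if vertex l == vertex l' then None
    else if ancestor (vertex l) (vertex l') then glue_to l l'
    else if ancestor (vertex l') (vertex l) then glue_to l' l
    else None
  end.

Definition phi_letter (l : letter) (M : growing_map) : option growing_map :=
  match l with
  | La => Some (phi_a M)
  | Lb => Some (phi_b M)
  | Lc => phi_c M
  end.

Definition phi_word (w : seq letter) (M : growing_map) : option growing_map :=
  foldr (fun l oM => obind (phi_letter l) oM) (Some M) w.

Definition close_head (M : growing_map) : option marked_map :=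
  match tour_legs M with
  | [:: l] => Some (@MarkedMap (glue (head_he M) l) [set head_he M; l])
  | _ => None
  end.

Definition Phi (w : seq letter) : option marked_map :=
  obind close_head (phi_word w M0).

(* Main.v *)
Require Import Defs.
From mathcomp Require Import all_boot fingroup perm zify.

Set Implicit Arguments.
Unset Strict Implicit.
Unset Printing Implicit Defensive.

(** A depth function turns a spanning tree into a rooted tree.  In every growing map
    reached from [M0] the non-head legs lie on the branch from the root to the head,
    at distinct vertices, and their depths along the tour first decrease and then
    increase; hence the first and last legs are comparable, the deeper of the two is a
    descendant of all the other legs, and gluing the head to the other one covers
    every tree edge that the head leaves behind.  This makes [Phi] well defined and
    its values bridgeless.

    For the inverse, a map whose head shares its vertex with another leg comes from
    [phi_a] or [phi_b].  Otherwise its head [t] comes from [phi_c], and the edge to cut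
    is the first one by which the tour of the head-face, walked from [t] on the side of
    its subtree, leaves the descendants of [t].  That edge is external: were it the
    edge from [t] to its parent, the two sides of the edge from [t] to its child would
    be in the same face although its removal does not disconnect the map, which
    Euler's inequality excludes on the sphere. *)

(** * Orbits and Euler's inequality *)

(** Planarity is carried along as a single numerical equation, [euler_count]: in a near-cubic map
    the number of half-edges fixes the number of vertices, so each step only has to account for
    faces and legs. The tree is carried as a depth function with axioms local to a half-edge or a
    vertex, because paths and cycles are awkward to follow through a change of [opp]. The invariant
    has two layers. [good] knows neither the word nor the order of the tour and passes through
    growing, gluing and cutting in both directions, as the inverse requires; [valid] adds the order
    of the legs, which is what makes [phi_c] applicable. Bridgelessness is anticipated in growing
    maps: a tree edge on the branch to the head may stay uncovered as long as a leg waits above it,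
    since gluing the head to that leg would cover it. Maps are compared up to isomorphism, so the
    word is recovered letter by letter from data that isomorphisms preserve. Closing forgets which
    half of the marked edge was the head; for positive size it is the half with the deeper end, and
    in size zero the only word is empty. *)

Definition norb (T : finType) (f : T -> T) :=
  #|[set [set y | fconnect f x y] | x : T]|.

Lemma fconnectP (T : finType) (f : T -> T) x y :
  reflect (exists i, y = iter i f x) (fconnect f x y).
Proof.
apply: (iffP idP) => [/iter_findex <-|[i ->]]; first by eexists.
exact: fconnect_iter.
Qed.

Lemma fconnect_setE (T : finType) (f : T -> T) x y : injective f ->
  ([set z | fconnect f x z] == [set z | fconnect f y z]) = fconnect f x y.
Proof.
move=> fi; apply/eqP/idP => [/setP/(_ y)|xy].
  by rewrite !inE connect0 => ->.
apply/setP => z; rewrite !inE; apply: same_connect xy z.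
by move=> a b; apply: fconnect_sym.
Qed.

Lemma eq_norb (T : finType) (f g : T -> T) : f =1 g -> norb f = norb g.
Proof.
move=> fg; rewrite /norb; congr #|pred_of_set _|; apply: eq_imset => x.
by apply/setP => y; rewrite !inE (eq_fconnect fg).
Qed.

Lemma norb_perm (T : finType) (f : T -> T) (fi : injective f) :
  norb f = #|porbits (perm fi)|.
Proof.
rewrite /norb /porbits; congr #|pred_of_set _|; apply: eq_imset => x.
apply/setP => y; rewrite inE.
have E i : iter i f x = (perm fi ^+ i)%g x.
  by rewrite permX; apply: eq_iter => z; rewrite permE.
by apply/fconnectP/porbitP => -[i ->]; exists i; rewrite E.
Qed.

(** A transposition splits the cycle that contains both points, or merges their two cycles. The
    doubled boolean puts the loss of a cycle on the left, so that no subtraction is truncated. *)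
Lemma norb_swap (T : finType) (f g : T -> T) x y :
  injective f -> (forall z, g z = f (tperm x y z)) ->
  norb g + (~~ fconnect f y x).*2 = norb f + (x != y).
Proof.
move=> fi gE; have gi : injective g.
  by move=> a b; rewrite !gE => /fi /perm_inj.
rewrite (norb_perm fi) (norb_perm gi) -porbits_mul_tperm.
congr (#|porbits _| + (~~ _).*2).
  by apply/permP => z; rewrite permM [perm gi _]permE gE [perm fi _]permE.
have E i : iter i f y = (perm fi ^+ i)%g y.
  by rewrite permX; apply: eq_iter => z; rewrite permE.
by apply/fconnectP/porbitP => -[i ->]; exists i; rewrite E.
Qed.

(** The maps [i] and [p] need not commute with [f] and [f']; it is enough that they follow cycles.
    So the cycles of [f'] may be those of [f] with points inserted. *)
Lemma norb_transfer (T T' : finType) (f : T -> T) (f' : T' -> T')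
    (i : T -> T') (p : T' -> T) :
  injective f -> injective f' ->
  (forall x, p (i x) = x) ->
  (forall x, fconnect f' (i x) (i (f x))) ->
  (forall z, fconnect f (p z) (p (f' z))) ->
  (forall z, fconnect f' (i (p z)) z) ->
  (forall x y, fconnect f' (i x) (i y) = fconnect f x y) /\ norb f' = norb f.
Proof.
move=> fi fi' pi ifx pfz ipz.
have E x y : fconnect f' (i x) (i y) = fconnect f x y.
  apply/idP/idP => /fconnectP[n].
    move=> iy; rewrite -(pi y) iy -{1}(pi x).
    elim: n {iy y} => [|n IH]; first exact: connect0.
    by apply: connect_trans IH _.
  move=> ->; elim: n => [|n IH]; first exact: connect0.
  exact: connect_trans IH (ifx _).
split=> //; rewrite /norb.
pose q (S : {set T}) : {set T'} := [set z | p z \in S].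
have qE x : [set z | fconnect f' (i x) z] = q [set y | fconnect f x y].
  apply/setP => z; rewrite !inE -E.
  apply/idP/idP => h; last exact: connect_trans h (ipz z).
  by apply: connect_trans h _; rewrite (fconnect_sym fi').
have -> : [set [set y | fconnect f' x y] | x : T']
   = q @: [set [set y | fconnect f x y] | x : T].
  apply/setP => S; apply/imsetP/imsetP => [[z _ ->]|[_ /imsetP[x _ ->] ->]].
    exists [set y | fconnect f (p z) y]; first exact: imset_f.
    by rewrite -qE; apply/eqP; rewrite fconnect_setE // (fconnect_sym fi').
  by exists (i x).
rewrite card_in_imset // => _ _ /imsetP[x _ ->] /imsetP[y _ ->].
by rewrite -!qE => /eqP; rewrite fconnect_setE // E => ?; apply/eqP; rewrite fconnect_setE.
Qed.

Lemma fconnect_homo (T : finType) (f : T -> T) (U : Type) (L : T -> U) x y :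
  (forall z, L (f z) = L z) -> fconnect f x y -> L y = L x.
Proof. by move=> Lf /fconnectP[n ->]; elim: n => //= n <-. Qed.

(* Induction on the number of edges: gluing two legs changes the number of faces by
   one, and decreases it if they carry different labels, which are then merged. *)
Lemma euler_label (T : finType) (c o : T -> T) : injective c -> involutive o ->
  exists L : T -> {set T}, [/\ forall x, L (c x) = L x, forall x, L (o x) = L x
   & 2 * norb (c \o o) + 2 * norb c <= #|[set x | o x != x]| + 4 * #|[set L x | x : T]|].
Proof.
move=> ci; have [k] := ubnP #|[set x | o x != x]|; elim: k o => // k IH o lek oi.
have [x xo|noleg] := pickP (fun x => o x != x); last first.
  have oid x : o x = x by apply/eqP/negbFE/noleg.
  exists (fun x => [set y | fconnect c x y]); split=> [x|x|].
  - by apply/eqP; rewrite fconnect_setE // fconnect_sym // fconnect1.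
  - by rewrite oid.
  (* Without edges every vertex is a component with a single face, and both sides are four times the
     number of vertices. The lemma is F + V <= E + 2 C, doubled because [o] moves 2 E half-edges. *)
  have -> : norb (c \o o) = norb c by apply: eq_norb => x /=; rewrite oid.
  rewrite /norb; lia.
(* [o'] is [o] with the edge of [x] cut into two legs. *)
pose y := o x; pose o' z := if (z == x) || (z == y) then z else o z.
have oyx : o y = x by rewrite /y oi.
have oE z : o z = o' (tperm x y z).
  rewrite /o'; case: tpermP => [->|->|/eqP/negbTE zx /eqP/negbTE zy].
  - by rewrite eqxx orbT.
  - by rewrite eqxx.
  - by rewrite zx zy.
have o'i : involutive o'.
  move=> z; rewrite {2}/o'; case: ifP => [|/norP[zx zy]]; first by rewrite /o' => ->.
  rewrite /o' oi; case: ifP => // /orP[/eqP e|/eqP e].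
    by move: zy; rewrite -[z]oi e /y eqxx.
  by move: zx; rewrite -[z]oi e oyx eqxx.
have cardE : #|[set z | o z != z]| = #|[set z | o' z != z]| + 2.
  rewrite (cardsD1 x) (cardsD1 y) !inE xo oyx [x == y]eq_sym -/y xo /= !add1n addn2; congr (#|pred_of_set _|.+2).
  apply/setP => z; rewrite !inE /o'; case: (z =P x) => [->|_] /=; first by rewrite eqxx andbF.
  by case: (z =P y) => [->|_] /=; rewrite ?eqxx.
have [|L [Lc Lo leL]] := IH o' _ o'i; first by move: lek; rewrite cardE; lia.
have fi : injective (c \o o') by move=> a b /= /ci /(can_inj o'i).
have xy : x != y by rewrite eq_sym.
have sw : norb (c \o o) + (~~ fconnect (c \o o') y x).*2 = norb (c \o o') + 1.
  by rewrite (norb_swap (y := y) (x := x) fi) ?xy // => z /=; rewrite oE.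
have [Lxy|Lxy] := eqVneq (L x) (L y).
  (* An edge inside a component creates at most one face, paid for by its two half-edges. *)
  exists L; split=> // [z|]; first by rewrite oE Lo; case: tpermP => [->|->|].
  by rewrite cardE; move: sw leL; case: (fconnect _ _ _) => /=; lia.
exists (fun z => if L z == L y then L x else L z); split=> [z|z|].
- by rewrite Lc.
- by rewrite oE Lo; case: tpermP => [->|->|//]; rewrite eqxx (negbTE Lxy).
have nf : ~~ fconnect (c \o o') y x.
  apply: contra Lxy => /(fconnect_homo (L := L)) ->//= z.
  by rewrite Lc Lo.
move: sw; rewrite nf cardE /= => sw.
set A := [set _ | _ in _]; set B := [set _ | _ in _] in leL.
suff: #|B| <= #|A| + 1.
  move: sw leL; move: (norb (c \o o)) (norb (c \o o')) (norb c) #|B| #|A| #|[set x | o' x != x]|; lia.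
suff /subset_leq_card : B \subset L y |: A by rewrite cardsU1; case: (_ \notin _); lia.
apply/subsetP => _ /imsetP[z _ ->]; rewrite !inE.
case: eqVneq => //= Lz; apply/imsetP; exists z => //.
by rewrite (negbTE Lz).
Qed.

Lemma norb_finv (T : finType) (f : T -> T) : injective f -> norb (finv f) = norb f.
Proof.
move=> fi; rewrite /norb; congr #|pred_of_set _|; apply: eq_imset => x.
by apply/setP => y; rewrite !inE same_fconnect_finv.
Qed.

(** The involution [o] conjugates [finv c \o o] to the inverse of [c \o o]. Reversing the
    orientation thus keeps the number of faces, which permits walking along a face backwards. *)
Lemma norb_finv_comp (T : finType) (c o : T -> T) :
  injective c -> involutive o -> norb (finv c \o o) = norb (c \o o).
Proof.
move=> ci oi.
have fi : injective (c \o o) by move=> a b /= /ci /(can_inj oi).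
have fi' : injective (finv c \o o) by move=> a b /= /(finv_inj ci) /(can_inj oi).
have [||||_ ->] // := @norb_transfer T T (c \o o) (finv c \o o) o o fi fi'.
- move=> x; rewrite (fconnect_sym fi') /=.
  by apply: connect1; apply/eqP; rewrite /= oi finv_f.
- move=> z /=; rewrite (fconnect_sym fi); apply: connect1; apply/eqP => /=.
  by rewrite oi f_finv.
- by move=> z; rewrite oi connect0.
Qed.

Lemma orbit_cycle (T : finType) (f : T -> T) x p :
  fcycle f (x :: p) -> uniq (x :: p) -> orbit f x = x :: p.
Proof.
by move=> fc up; rewrite (orbitE fc up) ?mem_head //= eqxx rot0.
Qed.

Lemma orbit_cons (T : finType) (f : T -> T) x : exists p, orbit f x = x :: p.
Proof. by rewrite /orbit -orderSpred /=; eexists. Qed.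

(** * Cycles under an exchange of two images *)

Section Swap.
Variables (T : finType) (f g : T -> T) (a b : T).
Hypotheses (fi : injective f) (ga : g a = f b) (gb : g b = f a).
Hypothesis gE : forall x, x != a -> x != b -> g x = f x.

Lemma fpath_swap x p : a \notin belast x p -> b \notin belast x p -> fpath g x p = fpath f x p.
Proof.
elim: p x => //= y p IH x; rewrite !inE => /norP[ax ap] /norP[bx bp].
by rewrite gE 1?eq_sym // IH.
Qed.

(** Read from left to right, this is the effect of gluing two legs of one face; from right to left,
    that of cutting an edge between two faces. *)
Lemma fcycle_cat_split p q : uniq (a :: p ++ b :: q) ->
  fcycle f (a :: p ++ b :: q) = fcycle g (a :: q) && fcycle g (b :: p).
Proof.
move=> /= /andP[ain]; rewrite cat_uniq /= => /and3P[up /norP[bp _] /andP[bq uq]].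
move: ain; rewrite mem_cat inE !negb_or => /and3P[ap ab aq].
have gp x : fpath g a (rcons q x) = fpath f b (rcons q x).
  case: q bq uq aq => [|y q] bq uq aq /=; first by rewrite ga.
  rewrite ga; congr andb; apply: fpath_swap; rewrite belast_rcons //.
have gq x : fpath g b (rcons p x) = fpath f a (rcons p x).
  case: p up ap bp => [|y p] up ap bp /=; first by rewrite gb.
  rewrite gb; congr andb; apply: fpath_swap; rewrite belast_rcons //.
by rewrite /= rcons_cat rcons_cons -cat_rcons cat_path gp gq last_rcons andbC.
Qed.
End Swap.

(** * Rooted spanning trees *)

Section Vertex.
Variable M : tree_map.
Hypothesis ci : injective (@ccw M).
Implicit Types x y : hedge M.

Lemma vertex_id x : x \in vertex x. Proof. by rewrite inE connect0. Qed.

Lemma mem_vertex x y : (y \in vertex x) = (vertex y == vertex x).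
Proof. by rewrite inE /vertex fconnect_setE // fconnect_sym. Qed.

Lemma vertex_ccw x : vertex (ccw x) = vertex x.
Proof. by apply/eqP; rewrite -mem_vertex inE fconnect1. Qed.

Lemma vertex_homo (U : Type) (L : hedge M -> U) :
  (forall x, L (ccw x) = L x) -> forall x y, vertex x = vertex y -> L x = L y.
Proof.
move=> Lc x y /eqP; rewrite -mem_vertex inE; exact: fconnect_homo.
Qed.

Lemma vertex_face x : vertex (face_next x) = vertex (opp x).
Proof. exact: vertex_ccw. Qed.

Hypothesis oi : involutive (@opp M).

Lemma face_inj : injective (@face_next M).
Proof. by move=> a b /ci /(can_inj oi). Qed.

Lemma vadj_sym (S : {set hedge M}) :
  (forall h, h \in S -> opp h \in S) -> connect_sym (vadj S).
Proof.
move=> So; apply: sym_connect_sym => u v; apply/existsP/existsP => -[h];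
by case/and3P => hS /eqP-> /eqP->; exists (opp h); rewrite So // oi !eqxx.
Qed.

Lemma edge_opp x : edge (opp x) = edge x.
Proof. by rewrite /edge oi setUC. Qed.

Lemma edge_compl_opp h : forall x, x \in ~: edge h -> opp x \in ~: edge h.
Proof.
move=> x; rewrite !inE => /norP[xh xo]; apply/norP; split.
  by apply: contra xo => /eqP<-; rewrite oi.
by apply: contra xh => /eqP/(can_inj oi)->.
Qed.
End Vertex.

Definition anc (M : tree_map) (x y : hedge M) := ancestor (vertex x) (vertex y).

Definition isup (M : tree_map) (dep : hedge M -> nat) u :=
  (u \in tree M) && (dep (opp u) < dep u).

(** Every axiom is local to a half-edge or a vertex, hence easy to check after a change of the map.
    By [rooted_spanning] and [spanning_rooted], such a depth exists exactly for spanning trees when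
    [ccw] is injective and [opp] involutive. *)
Record rooted (M : tree_map) (dep : hedge M -> nat) : Prop := Rooted {
  ccw_inj : injective (@ccw M);
  oppK : involutive (@opp M);
  dep_ccw : forall x, dep (ccw x) = dep x;
  dep_root : forall x, (dep x == 0) = (vertex x == root_vertex M);
  tree_opp : forall x, x \in tree M -> opp x \in tree M;
  tree_dep : forall x, x \in tree M ->
    dep x = (dep (opp x)).+1 \/ dep (opp x) = (dep x).+1;
  up_uniq : forall u u', isup dep u -> isup dep u' -> vertex u = vertex u' -> u = u';
  up_ex : forall x, 0 < dep x -> exists2 u, isup dep u & vertex u = vertex x }.

(** The external edge of [y] passes over the edge from the vertex of [x] to its parent: it joins a
    descendant to an ancestor, which the depths make a proper one. *)
Definition covered (M : tree_map) (dep : hedge M -> nat) x :=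
  exists y, [/\ y \notin tree M, anc x y, anc (opp y) x & dep (opp y) < dep x].

Definition ext_comparable (M : tree_map) :=
  forall x : hedge M, x \notin tree M -> anc x (opp x) || anc (opp x) x.

Lemma tree_path_ancestor (M : tree_map) (u v : {set hedge M}) p :
  tree_path (root_vertex M) v p -> u \in root_vertex M :: p -> ancestor u v.
Proof.
move=> tp up; have sp : size p <= #|hedge M|.
  case/and3P: tp => pth _ un.
  have sub : {subset root_vertex M :: p <= [seq vertex h | h <- enum (hedge M)]}.
    move: pth; rewrite /root_vertex; elim: (p) (root_he M) => [|w q IH] r /=.
      move=> _ z; rewrite !inE => /eqP->; apply: map_f; by rewrite mem_enum.
    case/andP => /existsP[h /and3P[_ _ /eqP->]] pth z; rewrite inE => /orP[/eqP->|].
      by apply: map_f; rewrite mem_enum.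
    exact: IH.
  by move/(uniq_leq_size un): sub; rewrite size_map -cardE => /ltnW.
by apply/existsP; exists (Bseq sp); rewrite tp.
Qed.

Lemma ancestorP (M : tree_map) (u v : {set hedge M}) :
  reflect (exists2 p, tree_path (root_vertex M) v p & u \in root_vertex M :: p)
          (ancestor u v).
Proof.
apply: (iffP idP) => [/existsP[p /andP[tp up]]|[p]]; first by exists p.
exact: tree_path_ancestor.
Qed.

Section Rooted.
Variables (M : tree_map) (dep : hedge M -> nat).
Hypothesis rM : rooted dep.
Implicit Types x y z u : hedge M.

Let ci := ccw_inj rM.
Let oi := oppK rM.

Lemma dep_vertex x y : vertex x = vertex y -> dep x = dep y.
Proof. exact: vertex_homo ci _ _ (dep_ccw rM) _ _. Qed.

Lemma isup_opp u : isup dep u -> isup dep (opp u) = false.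
Proof. by case/andP => _ h; rewrite /isup oi ltnNge (ltnW h) andbF. Qed.

Lemma isup_dep u : isup dep u -> dep u = (dep (opp u)).+1.
Proof. by case/andP => uT; case: (tree_dep rM uT) => [//|->]; lia. Qed.

Lemma tree_isup x : x \in tree M -> isup dep x \/ isup dep (opp x).
Proof.
move=> xT; rewrite /isup xT (tree_opp rM xT) oi /=.
by case: (tree_dep rM xT) => e; [left|right]; rewrite e.
Qed.

Lemma tree_noleg x : x \in tree M -> opp x != x.
Proof. by move=> xT; apply/eqP => e; case: (tree_dep rM xT); rewrite e; lia. Qed.

(** A simple path from the root-vertex never goes up: a step up leads to the parent, from which, by
    induction, the path has just come. *)
Lemma tree_path_inv e p : tree_path (root_vertex M) (vertex e) p ->
  (p = [::] /\ vertex e = root_vertex M) \/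
  exists u p', [/\ isup dep u, vertex u = vertex e, p = rcons p' (vertex e)
     & tree_path (root_vertex M) (vertex (opp u)) p'].
Proof.
elim/last_ind: p e => [|p v IH] e; first by case/and3P => _ /eqP re _; left.
rewrite /tree_path rcons_path last_rcons -rcons_cons rcons_uniq.
case/and3P => /andP[pth /existsP[h /and3P[hT /eqP lh /eqP vh]]] /eqP ve /andP[vp up].
right; have tp : tree_path (root_vertex M) (vertex h) p.
  by rewrite /tree_path pth lh eqxx.
have [hup|hup] := tree_isup hT; last first.
  by exists (opp h), p; rewrite oi -vh ve.
case: (IH _ tp) => [[p0 hr]|[u [p' [uu uh p'E]]]].
  by move/eqP: hr; rewrite -(dep_root rM) (isup_dep hup).
rewrite (up_uniq rM uu hup uh) => /and3P[_ /eqP lp' _].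
by case/negP: vp; rewrite vh -lp' p'E -rcons_cons mem_rcons inE mem_last orbT.
Qed.

Lemma tree_path_dep e p z : tree_path (root_vertex M) (vertex e) p ->
  vertex z \in root_vertex M :: p -> dep z <= dep e.
Proof.
have [n] := ubnP (size p); elim: n p e => // n IH p e np tp.
case: (tree_path_inv tp) => [[-> er]|[u [p' [uu ue pE tp']]]].
  by rewrite inE => /eqP zr; rewrite (dep_vertex (y := e)) // zr.
rewrite pE -rcons_cons mem_rcons inE => /orP[/eqP/dep_vertex->//|zp'].
rewrite -(dep_vertex ue) (isup_dep uu) leqW // (IH p') //.
by move: np; rewrite pE size_rcons.
Qed.

Lemma tree_path_up u p : isup dep u -> tree_path (root_vertex M) (vertex (opp u)) p ->
  tree_path (root_vertex M) (vertex u) (rcons p (vertex u)).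
Proof.
move=> uu tp; have := tree_path_dep (z := u) tp.
case/and3P: tp => pth /eqP lp up uE.
rewrite /tree_path rcons_path last_rcons -rcons_cons rcons_uniq pth up eqxx !andbT /=.
apply/andP; split.
  apply/existsP; exists (opp u); rewrite oi lp !eqxx !andbT.
  by case/andP: uu => /(tree_opp rM).
by apply/negP => /uE; rewrite (isup_dep uu) ltnn.
Qed.

Lemma dep_ind (P : hedge M -> Prop) :
  (forall x, vertex x = root_vertex M -> P x) ->
  (forall x u, isup dep u -> vertex u = vertex x -> P (opp u) -> P x) ->
  forall x, P x.
Proof.
move=> P0 PS x; have [n] := ubnP (dep x); elim: n x => // n IH x nx.
case: (posnP (dep x)) => [/eqP|xp]; first by rewrite (dep_root rM) => /eqP /P0.
have [u uu ux] := up_ex rM xp; apply: (PS x u) => //; apply: IH.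
by move: nx; rewrite -(dep_vertex ux) (isup_dep uu).
Qed.

Lemma tree_path_ex x : exists p, tree_path (root_vertex M) (vertex x) p.
Proof.
elim/dep_ind: x => [x ->|x u uu <- [p tp]].
  by exists [::]; rewrite /tree_path /= eqxx.
by eexists; apply: tree_path_up tp.
Qed.

Lemma anc_refl x : anc x x.
Proof.
have [p tp] := tree_path_ex x; apply/ancestorP; exists p => //.
by case/and3P: tp => _ /eqP <- _; apply: mem_last.
Qed.

Lemma anc_eq x y : vertex x = vertex y -> anc x y.
Proof. by rewrite /anc => <-; apply: anc_refl. Qed.

Lemma anc_rootv x y : vertex y = root_vertex M -> anc x y = (vertex x == vertex y).
Proof.
move=> yr; apply/idP/eqP; last exact: anc_eq.
case/ancestorP => p /tree_path_inv[[->]|[u [p' [uu uy _ _]]]].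
  by rewrite yr inE => _ /eqP.
by move/eqP: yr; rewrite -(dep_root rM) -(dep_vertex uy) (isup_dep uu).
Qed.

Lemma anc_up x u : isup dep u -> anc x u = (vertex x == vertex u) || anc x (opp u).
Proof.
move=> uu; apply/idP/orP => [/ancestorP[p /tree_path_inv[[_ /eqP]|]]|].
- by rewrite -(dep_root rM) (isup_dep uu).
- move=> [u' [p' [uu' uy -> tp]]]; rewrite -rcons_cons mem_rcons inE => /orP[->|xp].
    by left.
  by right; apply/ancestorP; exists p' => //; rewrite -(up_uniq rM uu' uu uy).
case=> [/eqP/anc_eq //|/ancestorP[p tp xp]].
apply/ancestorP; exists (rcons p (vertex u)); first exact: tree_path_up.
by rewrite -rcons_cons mem_rcons inE xp orbT.
Qed.

Lemma anc_vertexl x y z : vertex x = vertex y -> anc x z = anc y z.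
Proof. by rewrite /anc => ->. Qed.
Lemma anc_vertexr x y z : vertex x = vertex y -> anc z x = anc z y.
Proof. by rewrite /anc => ->. Qed.

Lemma anc_trans y x z : anc x y -> anc y z -> anc x z.
Proof.
move=> xy; elim/dep_ind: z => [z zr|z u uu uz IH].
  by rewrite (anc_rootv _ zr) => /eqP yz; rewrite -(anc_vertexr _ yz).
rewrite -!(anc_vertexr _ uz) !(anc_up _ uu) => /orP[/eqP yu|/IH->]; last by rewrite orbT.
by move: xy; rewrite (anc_vertexr _ yu) (anc_up _ uu).
Qed.

Lemma anc_dep x y : anc x y -> dep x <= dep y.
Proof. by case/ancestorP => p tp; apply: tree_path_dep tp. Qed.

Lemma anc_dep_eq x y : anc x y -> dep y <= dep x -> vertex x = vertex y.
Proof.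
elim/dep_ind: y => [y yr|y u uu uy _].
  by rewrite (anc_rootv _ yr) => /eqP.
rewrite -(anc_vertexr _ uy) (anc_up _ uu) => /orP[/eqP->//|/anc_dep].
by rewrite -(dep_vertex uy) (isup_dep uu); lia.
Qed.

Lemma anc_total x y z : anc x z -> anc y z -> anc x y \/ anc y x.
Proof.
elim/dep_ind: z => [z zr|z u uu uz IH].
  rewrite !(anc_rootv _ zr) => /eqP xr /eqP yr.
  by left; apply: anc_eq; rewrite xr yr.
rewrite -!(anc_vertexr _ uz) !(anc_up _ uu) => /orP[/eqP xu|xu] /orP[/eqP yu|yu].
- by left; apply: anc_eq; rewrite xu yu.
- by right; rewrite (anc_vertexr _ xu) (anc_up _ uu) yu orbT.
- by left; rewrite (anc_vertexr _ yu) (anc_up _ uu) xu orbT.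
- exact: IH.
Qed.

Lemma anc_total_dep x y z : anc x z -> anc y z -> dep x <= dep y -> anc x y.
Proof.
move=> xz yz le; case: (anc_total xz yz) => // yx.
by apply: anc_eq; rewrite (anc_dep_eq yx).
Qed.

Lemma anc_child x y : anc x y -> vertex x != vertex y ->
  exists z, [/\ isup dep z, vertex (opp z) = vertex x & anc z y].
Proof.
elim/dep_ind: y => [y yr|y u uu uy IH].
  by rewrite (anc_rootv _ yr) => ->.
rewrite -(anc_vertexr _ uy) (anc_up _ uu) -uy => /orP[->//|xu] _.
have [e|ne] := eqVneq (vertex x) (vertex (opp u)); last first.
  case: (IH xu ne) => z [zu zx zy]; exists z; split=> //.
  by rewrite -(anc_vertexr _ uy) (anc_up _ uu) zy orbT.
by exists u; rewrite e; split=> //; apply: anc_eq.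
Qed.

(** Connectedness in the form that [euler_label] calls for, where components are given by labels. *)
Lemma tree_label (U : Type) (Q : hedge M -> U) :
  (forall x, Q (ccw x) = Q x) -> (forall z, z \in tree M -> Q (opp z) = Q z) ->
  forall x, Q x = Q (root_he M).
Proof.
move=> Qc QT; have Qv := vertex_homo ci Qc; elim/dep_ind => [x /Qv->//|x u uu /Qv<- <-].
by rewrite QT //; case/andP: uu.
Qed.

(* A labelling that propagates along all tree edges but one still propagates
   everywhere, through the external edge covering the missing one. *)
Lemma tree_label_cut (U : Type) (Q : hedge M -> U) u y :
  (forall x, Q (ccw x) = Q x) -> isup dep u ->
  (forall z, z \in tree M -> z != u -> z != opp u -> Q (opp z) = Q z) ->
  anc u y -> dep (opp y) < dep u -> Q (opp y) = Q y ->
  forall x, Q x = Q (root_he M).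
Proof.
move=> Qc uu QT uy yu Qy; have Qv := vertex_homo ci Qc.
have up w : isup dep w -> vertex w <> vertex u -> Q (opp w) = Q w.
  move=> wu ne; apply: QT; first by case/andP: wu.
    by apply/eqP => e; case: ne; rewrite e.
  by apply/eqP => e; move: wu; rewrite e isup_opp.
have out x : ~~ anc u x -> Q x = Q (root_he M).
  elim/dep_ind: x => [x /Qv->//|x w wu wx IH].
  rewrite -(anc_vertexr _ wx) (anc_up _ wu) => /norP[/eqP ne /IH <-].
  by rewrite -(Qv _ _ wx) up // => e; case: ne.
have inn x : anc u x -> Q x = Q u.
  elim/dep_ind: x => [x xr|x w wu wx IH].
    rewrite (anc_rootv _ xr) => /eqP ux.
    by apply: Qv; rewrite ux.
  rewrite -(anc_vertexr _ wx) (anc_up _ wu) => /orP[/eqP ux|aw].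
    by apply: Qv; rewrite ux wx.
  have [/Qv e|ne] := eqVneq (vertex w) (vertex u); first by rewrite -(Qv _ _ wx).
  by rewrite -(Qv _ _ wx) -(IH aw) up //; apply/eqP.
move=> x; case ux: (anc u x); last by apply: out; rewrite ux.
rewrite inn // -(inn y) // -Qy; apply: out.
by apply/negP => /anc_dep; lia.
Qed.

End Rooted.

Lemma connected_by_tree (M : tree_map) (dep : hedge M -> nat) (S : {set hedge M}) :
  rooted dep -> tree M \subset S -> (forall x, x \in S -> opp x \in S) ->
  connected_by S.
Proof.
move=> rM TS So; have sy := vadj_sym (oppK rM) So.
have Q x : connect (vadj S) (root_vertex M) (vertex x).
  elim/(dep_ind rM): x => [x ->|x u uu <- IH]; first exact: connect0.
  apply: connect_trans IH _; rewrite sy; apply: connect1.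
  apply/existsP; exists u; rewrite !eqxx !andbT (subsetP TS) //.
  by case/andP: uu.
by move=> x y; apply: connect_trans (Q y); rewrite sy.
Qed.

(** At a deepest vertex of a cycle both edges of the cycle go up, so [up_uniq] identifies them.
    Distinctness of the edges then leaves a single half-edge, which would be its own opposite. *)
Lemma rooted_spanning (M : tree_map) (dep : hedge M -> nat) :
  rooted dep -> spanning_tree M.
Proof.
move=> rM; split; [exact: tree_opp rM | exact: connected_by_tree rM _ (tree_opp rM) |].
move=> c; apply/negP => /and5P[c0 cT cc uv ue].
have [x0 x0c] : exists x, x \in c by case: (c) c0 => // x s _; exists x; rewrite mem_head.
case: (arg_maxnP (P := mem c) dep x0c) => x /= xc xmax.
have := prev_cycle cc xc; set w := prev c x => /eqP wx.
have wc : w \in c by rewrite mem_prev.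
have /eqP xn := next_cycle cc xc.
have xT : x \in tree M := allP cT _ xc.
have wT : w \in tree M := allP cT _ wc.
have up1 : isup dep x.
  have := xmax _ (etrans (mem_next c x) xc); rewrite -(dep_vertex rM xn) => h.
  by rewrite /isup xT; case: (tree_dep rM xT) h => ->; lia.
have up2 : isup dep (opp w).
  have := xmax _ wc; rewrite -(dep_vertex rM wx) => h.
  by rewrite /isup (tree_opp rM wT) (oppK rM); case: (tree_dep rM wT) h => ->; lia.
have e := up_uniq rM up2 up1 wx.
have xw : edge x = edge w by rewrite -e edge_opp //; apply: oppK rM.
have : x = w.
  have idx := map_uniq ue; apply/eqP.
  have := nth_uniq (edge x) _ _ ue; rewrite size_map => /(_ (index x c) (index w c)).
  rewrite !index_mem !(nth_map x) ?index_mem // !nth_index // xw eqxx => /(_ xc wc) /esym/eqP.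
  by move/(congr1 (nth x c)); rewrite !nth_index // => ->.
by move=> xew; move: (tree_noleg rM wT); rewrite e xew eqxx.
Qed.

(** * From spanning trees to depth functions *)

Section Spanning.
Variable M : tree_map.
Hypotheses (ci : injective (@ccw M)) (oi : involutive (@opp M)).
Hypothesis stM : spanning_tree M.
Implicit Types x y z h : hedge M.

Let To : forall h, h \in tree M -> opp h \in tree M. Proof. by case: stM. Qed.

Lemma vadj_path_edges (S : {set hedge M}) a p : path (vadj S) a p ->
  exists c : seq (hedge M), [/\ all (mem S) c, map (@vertex M) c = belast a p
    & map (fun h => vertex (opp h)) c = p].
Proof.
elim: p a => [|b p IH] a /=; first by exists [::].
case/andP => /existsP[h /and3P[hS /eqP-> /eqP bE]] /IH[c [cS cb cp]].
by exists (h :: c); rewrite /= hS cS cb cp -bE.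
Qed.

(** A walk around the edge, shortened to a simple path, would close up with [x] to a simple cycle of
    the tree. *)
Lemma tree_bridge x : x \in tree M ->
  ~~ connect (vadj (tree M :\: edge x)) (vertex (opp x)) (vertex x).
Proof.
move=> xT; apply/negP => /connectP[p0 pth0 lst0].
case/shortenP: pth0 lst0 => p pth up _ lst.
have [c [cS cv co]] := vadj_path_edges pth.
have {}cS z : z \in c -> z \in tree M :\: edge x by move/(allP cS).
case: stM => _ _ /(_ (x :: c)) /negP; apply.
have sc : size c = size p by rewrite -co size_map.
have vE i : i < size c -> vertex (nth x c i) = nth (vertex x) (vertex (opp x) :: p) i.
  move=> ic; rewrite -(nth_map _ (vertex x)) // cv (lastI (vertex (opp x))) nth_rcons size_belast.
  by rewrite -sc ic.
have oE i : i < size c ->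
    vertex (opp (nth x c i)) = nth (vertex x) (vertex (opp x) :: p) i.+1.
  by move=> ic; rewrite -(nth_map x (vertex x) (fun h => vertex (opp h))) // co.
rewrite /tree_cycle /= xT /=; apply/and4P; split.
- by apply/allP => z /cS; rewrite inE => /andP[].
- apply/(pathP x) => i; rewrite size_rcons => ic.
  case: i ic => [_|i ic].
    rewrite /= nth_rcons; case: (posnP (size c)) => c0.
      by rewrite c0 eqxx lst; move: c0; rewrite sc; case: (p).
    by rewrite vE.
  rewrite /= !nth_rcons; have -> : i < size c by lia.
  rewrite oE; last lia.
  case: ltnP => h; first by rewrite vE.
  have -> : i.+1 = size c by lia.
  by rewrite eqxx {1}sc -last_nth -lst.
- by rewrite cv -rcons_uniq lst -lastI.
apply/andP; split.
  apply/mapP => -[y yc ye]; move/cS: yc; rewrite inE ye.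
  by rewrite !inE eqxx.
apply/(uniqP (edge x)) => i j; rewrite !inE size_map => ic jc.
rewrite !(nth_map x) // => e.
have inj k l : k <= size c -> l <= size c ->
    nth (vertex x) (vertex (opp x) :: p) k = nth (vertex x) (vertex (opp x) :: p) l -> k = l.
  by move=> kc lc /eqP; rewrite nth_uniq //= ?ltnS -?sc // => /eqP.
have : nth x c i \in edge (nth x c j) by rewrite -e !inE eqxx.
rewrite !inE => /orP[/eqP h|/eqP h].
  by apply: inj; [exact: ltnW | exact: ltnW | rewrite -!vE // h].
(* Two opposite halves of one edge would make each position the successor of the other. *)
have h1 : i = j.+1 by apply: inj; [exact: ltnW | exact: jc | rewrite -vE // -oE // h].
have h2 : j = i.+1 by apply: inj; [exact: ltnW | exact: ic | rewrite -vE // -oE // h oi].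
by lia.
Qed.

Fixpoint reach n (v : {set hedge M}) : bool :=
  if n is m.+1 then [exists u, reach m u && vadj (tree M) u v] else v == root_vertex M.

Lemma reach_ex x : exists n, reach n (vertex x).
Proof.
case: stM => _ h _; case/connectP: (h (root_he M) x) => p + ->.
elim/last_ind: p => [_|p v IH]; first by exists 0 => /=.
rewrite rcons_path last_rcons => /andP[/IH[n rn] av].
by exists n.+1; apply/existsP; exists (last (vertex (root_he M)) p); apply/andP.
Qed.

Definition tdist x := ex_minn (reach_ex x).

Lemma tdist_le n x : reach n (vertex x) -> tdist x <= n.
Proof. by rewrite /tdist; case: ex_minnP => m _ h /h. Qed.

Lemma tdist_reach x : reach (tdist x) (vertex x).
Proof. by rewrite /tdist; case: ex_minnP. Qed.

Lemma tdist_vertex x y : vertex x = vertex y -> tdist x = tdist y.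
Proof.
move=> e; apply/eqP; rewrite eqn_leq; apply/andP; split; apply: tdist_le.
  by rewrite e tdist_reach.
by rewrite -e tdist_reach.
Qed.

Lemma tdist_tree z : z \in tree M -> tdist (opp z) <= (tdist z).+1.
Proof.
move=> zT; apply: tdist_le; apply/existsP; exists (vertex z).
apply/andP; split; first exact: tdist_reach.
by apply/existsP; exists z; rewrite zT !eqxx.
Qed.

Lemma tdist_up x : 0 < tdist x -> exists2 u, isup tdist u & vertex u = vertex x.
Proof.
move=> x0; have := tdist_reach x; case E: (tdist x) x0 => [//|n] _.
case/existsP => v /andP[rv /existsP[z /and3P[zT /eqP vz /eqP xz]]].
exists (opp z) => //; rewrite /isup To // oi.
rewrite vz in rv; have := tdist_le rv; rewrite -(tdist_vertex xz) E; lia.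
Qed.

(** A shortest path to the root-vertex follows upward half-edges of depth at most that of [h]. *)
Lemma tdist_connect (x h : hedge M) :
  (forall z, isup tdist z -> tdist z <= tdist h -> z \notin edge x) ->
  connect (vadj (tree M :\: edge x)) (vertex h) (root_vertex M).
Proof.
have [n] := ubnP (tdist h); elim: n h => // n IH h nh zh.
case: (posnP (tdist h)) => [h0|/tdist_up[u uu uh]].
  by apply: eq_connect0; have := tdist_reach h; rewrite h0 => /eqP.
have lt := uu; move/andP: lt => [uT lt]; rewrite (tdist_vertex uh) in lt.
apply: (@connect_trans _ _ (vertex (opp u))).
  apply: connect1; apply/existsP; exists u; rewrite !inE uT uh !eqxx !andbT.
  by have := zh _ uu; rewrite (tdist_vertex uh) leqnn !inE => ->.
by apply: IH; [lia | move=> z zu le; apply: zh => //; lia].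
Qed.

(** The depth is the distance to the root-vertex in the tree. A tree edge between equal depths, or a
    second parent edge, would join both ends of a tree edge through the root-vertex without using
    it, against [tree_bridge]. *)
Lemma spanning_rooted : exists dep : hedge M -> nat, rooted dep.
Proof.
have sy x : connect_sym (vadj (tree M :\: edge x)).
  apply: (vadj_sym oi) => z; rewrite !in_setD => /andP[zx zT]; rewrite To // andbT.
  by have := edge_compl_opp (h := x) (x := z) oi; rewrite !in_setC => ->.
exists tdist; split=> //.
- by move=> x; apply: tdist_vertex; rewrite vertex_ccw.
- move=> x; apply/eqP/eqP => [x0|xr].
    by have := tdist_reach x; rewrite x0 => /eqP.
  by apply/eqP; rewrite -leqn0; apply: tdist_le; rewrite xr /=.
- move=> x xT; have := tdist_tree xT; have := tdist_tree (To xT); rewrite oi => h1 h2.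
  case: (ltngtP (tdist x) (tdist (opp x))) => h; [right; lia | left; lia |].
  case/negP: (tree_bridge xT); apply: (@connect_trans _ _ (root_vertex M)); last rewrite sy.
    apply: tdist_connect => z zu _; rewrite !inE; apply/norP; split.
      by apply: contraL zu => /eqP->; rewrite /isup h ltnn andbF.
    by apply: contraL zu => /eqP->; rewrite /isup oi h ltnn andbF.
  apply: tdist_connect => z zu _; rewrite !inE; apply/norP; split.
    by apply: contraL zu => /eqP->; rewrite /isup h ltnn andbF.
  by apply: contraL zu => /eqP->; rewrite /isup oi h ltnn andbF.
- move=> u u' uu uu' e; apply/eqP; apply: contraT => ne.
  have /andP[uT lt] := uu; have /andP[uT' lt'] := uu'.
  have eu := tdist_vertex e.
  (* Vertices of smaller depth reach the root-vertex without [u], so the second parent edge [u']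
     opens a detour around [u]. *)
  have low h : tdist h < tdist u -> connect (vadj (tree M :\: edge u)) (vertex h) (root_vertex M).
    move=> hu; apply: tdist_connect => z zu le; rewrite !inE; apply/norP; split.
      by apply/eqP => ez; move: le; rewrite ez; lia.
    by apply: contraL zu => /eqP->; rewrite /isup oi ltnNge ltnW ?andbF.
  case/negP: (tree_bridge uT); apply: connect_trans (low _ lt) _; rewrite sy.
  apply: (@connect_trans _ _ (vertex (opp u'))); last by apply: low; lia.
  apply: connect1; apply/existsP; exists u'.
  rewrite !inE e uT' !eqxx !andbT negb_or eq_sym ne /=.
  by apply: contraL lt' => /eqP ez; rewrite {1}ez oi; lia.
- exact: tdist_up.
Qed.

End Spanning.

(** * Bridges and covered tree edges *)

Section Bridgeless.
Variables (M : tree_map) (dep : hedge M -> nat).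
Hypothesis rM : rooted dep.
Hypothesis cM : ext_comparable M.
Implicit Types x y z u : hedge M.

(** The ancestors of [x] form a chain; the other end of the edge is one of them and is outside the
    subtree of [v], hence strictly above [v]. *)
Lemma ext_exit_covered v x : anc v x -> ~~ anc v (opp x) -> x \notin tree M ->
  anc (opp x) v /\ dep (opp x) < dep v.
Proof.
move=> vx vox xT; have /orP[h|ox] := cM xT; first by case/negP: vox; apply: (anc_trans rM vx h).
case: (anc_total rM ox vx) => [h|]; last by rewrite (negbTE vox).
split=> //; rewrite ltnNge; apply/negP => le.
by case/negP: vox; apply: (anc_eq rM); rewrite (anc_dep_eq rM h le).
Qed.

Lemma tree_exit_up u x : isup dep u -> anc u x -> ~~ anc u (opp x) -> x \in tree M -> x = u.
Proof.
move=> uu ux uox xT; case: (tree_isup rM xT) => xu.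
  move: ux; rewrite (anc_up rM _ xu) (negbTE uox) orbF => /eqP e.
  exact: up_uniq rM _ _ xu uu (esym e).
by move: uox; rewrite (anc_up rM _ xu) (oppK rM) ux orbT.
Qed.

(** A walk avoiding the parent edge [u] still has to leave the subtree on its way to the
    root-vertex. As [u] is the only tree edge that leaves the subtree, it does so by an external
    edge. *)
Lemma bridgeless_covered : bridgeless M -> forall x, 0 < dep x -> covered dep x.
Proof.
move=> bM x /(up_ex rM)[u uu ux].
have [y [ye yin yout]] : exists y, [/\ y \notin edge u, anc u y & ~~ anc u (opp y)].
  have : ~~ anc u (root_he M).
    apply/negP => /(anc_dep rM); rewrite (isup_dep rM uu).
    by have := dep_root rM (root_he M); rewrite eqxx => /eqP->.
  have : anc u u by apply: anc_refl rM _.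
  case/connectP: (bM u u (root_he M)) => p; rewrite -/(root_vertex M) /anc.
  elim: p {1 2 4}(vertex u) => [|v p IH] a /=; first by move=> _ <- ->.
  case/andP => /existsP[y /and3P[ye /eqP -> /eqP ->]] pth lst yu ru.
  case h : (ancestor (vertex u) (vertex (opp y))); first exact: IH pth lst h ru.
  by exists y; rewrite -in_setC h.
have yT : y \notin tree M.
  by apply: contra ye => yT; rewrite (tree_exit_up uu yin yout yT) !inE eqxx.
have [h1 h2] := ext_exit_covered yin yout yT.
by exists y; rewrite -(anc_vertexl _ ux) -(anc_vertexr _ ux) -(dep_vertex rM ux).
Qed.

(** Removing an external edge leaves the whole tree. For a tree edge, [tree_label_cut] applies with
    reachability from the root-vertex as the label. *)
Lemma covered_bridgeless : (forall x, 0 < dep x -> covered dep x) -> bridgeless M.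
Proof.
move=> cov; have oi := oppK rM.
have sy h := vadj_sym oi (edge_compl_opp (h := h) oi).
suff main u : isup dep u -> connected_by (~: edge u).
  move=> h; case hT: (h \in tree M); last first.
    apply: (connected_by_tree rM); last exact: edge_compl_opp.
    apply/subsetP => z zT; rewrite !inE; apply/norP; split.
      by apply: contraTneq zT => ->; rewrite hT.
    by apply: contraFneq hT => e; rewrite -(oi h) -e; apply: tree_opp rM _ zT.
  by case: (tree_isup rM hT) => /main //; rewrite edge_opp.
move=> uu; pose Q x := connect (vadj (~: edge u)) (root_vertex M) (vertex x).
have Qe z : z \in ~: edge u -> Q (opp z) = Q z.
  move=> zu; apply/idP/idP => h; apply: connect_trans h _; last rewrite sy.
    rewrite sy; apply: connect1; apply/existsP; exists z; by rewrite zu !eqxx.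
  rewrite sy; apply: connect1; apply/existsP; exists z; by rewrite zu !eqxx.
have [|y [yT uy yu du]] := cov u; first by rewrite (isup_dep rM uu).
have uT : u \in tree M by case/andP: uu.
have QT x : Q x.
  rewrite (@tree_label_cut _ _ rM _ Q u y) ?/Q ?connect0 //.
  - by move=> z; rewrite vertex_ccw //; apply: ccw_inj rM.
  - by move=> z zT zu zou; apply: Qe; rewrite !inE; apply/norP.
  apply: Qe; rewrite !inE; apply/norP; split; apply: contraNneq yT => ->//.
  exact: tree_opp rM _ uT.
by move=> x y'; apply: connect_trans (QT y'); rewrite sy; apply: QT.
Qed.

End Bridgeless.

(** * Gluing and cutting edges *)

Definition nonlegs (M : tree_map) := #|[set x : hedge M | opp x != x]|.

(* Euler's formula, cleared of the number of vertices, which is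
   [(#|hedge M| + 1) / 3] in a 2-near-cubic map. *)
Definition euler_count (M : tree_map) :=
  6 * norb (@face_next M) + 2 * #|hedge M|.+1 = 3 * nonlegs M + 12.

(** This makes sense for closed maps and for maps with legs: a leg is an external half-edge fixed by
    [opp], hence comparable with its opposite. *)
Record base (M : tree_map) (dep : hedge M -> nat) : Prop := Base {
  base_rooted : rooted dep;
  base_cubic : near_cubic2 M;
  base_root : root_he M \notin tree M;
  base_cmp : ext_comparable M;
  base_euler : euler_count M }.

(** [good_cov] is bridgelessness in the making: an uncovered tree edge lies on the branch to the
    head [h], and a leg waits at a proper ancestor of its lower end. *)
Record good (M : tree_map) (h : hedge M) (dep : hedge M -> nat) : Prop := Good {
  good_base : base dep;
  good_head : opp h = h;
  good_root : h != root_he M;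
  good_leg : exists2 l, opp l = l & l != h;
  good_anc : forall l, opp l = l -> anc l h;
  good_face : forall l, opp l = l -> fconnect (@face_next M) h l;
  good_cov : forall x, 0 < dep x -> covered dep x \/
    anc x h /\ exists l, [/\ opp l = l, anc l x & dep l < dep x] }.

(** Counting half-edges by vertices gives 2 + 3 (V - 1). *)
Lemma near_cubic_card (M : tree_map) : injective (@ccw M) -> near_cubic2 M ->
  3 * norb (@ccw M) = #|hedge M|.+1.
Proof.
move=> ci [r2 v3]; rewrite /norb; set P := [set _ | _ in _].
have PE : P = [set vertex h | h : hedge M] by [].
have /card_partition : partition P [set: hedge M].
  apply/and3P; split.
  - apply/eqP/setP => x; rewrite inE; apply/bigcupP; exists (vertex x); last exact: vertex_id.
    by rewrite PE imset_f.
  - apply/trivIsetP => _ _ /imsetP[x _ ->] /imsetP[y _ ->]; apply: contraR.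
    rewrite -setI_eq0 => /set0Pn[z]; rewrite inE -/(vertex x) -/(vertex y) !mem_vertex //.
    by case/andP => /eqP-> /eqP->.
  - by apply/imsetP => -[x _ /setP/(_ x)]; rewrite !inE connect0.
have rP : root_vertex M \in P by rewrite PE imset_f.
rewrite cardsT (bigD1 _ rP) /= r2 (eq_bigr (fun=> 3)) => [|_ /andP[/imsetP[x _ ->] /v3->]//].
rewrite sum_nat_const (cardsD1 (root_vertex M) P) rP => ->.
have -> : #|[pred i in P | i != root_vertex M]| = #|P :\ root_vertex M|.
  by apply: eq_card => v; rewrite !inE andbC.
by move: #|P :\ _|; lia.
Qed.

(** [euler_label] with a single component, multiplied by 3 in order to eliminate the number of
    vertices. *)
Lemma euler_cubic (T : finType) (x0 : T) (c o : T -> T) :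
  injective c -> involutive o -> 3 * norb c = #|T|.+1 ->
  (forall L : T -> {set T}, (forall x, L (c x) = L x) -> (forall x, L (o x) = L x) ->
     forall x, L x = L x0) ->
  6 * norb (c \o o) + 2 * #|T|.+1 <= 3 * #|[set x | o x != x]| + 12.
Proof.
move=> ci oi V conn; have [L [Lc Lo]] := euler_label ci oi.
have : #|[set L x | x : T]| <= 1.
  rewrite -(cards1 (L x0)); apply/subset_leq_card/subsetP => _ /imsetP[x _ ->].
  by rewrite inE (conn L Lc Lo).
by move: #|[set L x | x : T]| => n; lia.
Qed.

Lemma nonlegs_pair (T : finType) (o o' : T -> T) h s : h != s ->
  o h != h -> o s != s -> o' h = h -> o' s = s ->
  (forall x, x != h -> x != s -> o' x = o x) ->
  #|[set x | o x != x]| = #|[set x | o' x != x]| + 2.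
Proof.
move=> hs oh os o'h o's oE.
rewrite (cardsD1 h) (cardsD1 s) !inE oh os [s == h]eq_sym hs /= !add1n addn2.
congr (#|pred_of_set _|.+2); apply/setP => x; rewrite !inE.
have [->|xh] := eqVneq x h; first by rewrite o'h eqxx andbF.
by have [->|xs] := eqVneq x s; rewrite ?o's ?eqxx // oE.
Qed.

Section Reopp.
Variables (M : tree_map) (o' : hedge M -> hedge M).
Hypothesis oT : forall x, x \in tree M -> o' x = opp x.
Let M' := TreeMap (@ccw M) o' (root_he M) (tree M).

(** Gluing legs and cutting external edges change [opp] only outside the tree, so that ancestors and
    depths survive. *)
Lemma anc_reopp (x y : hedge M) : @anc M' x y = @anc M x y.
Proof.
rewrite /anc /ancestor; apply: eq_existsb => p; congr andb.
rewrite /tree_path; congr andb; apply: eq_path => u v.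
apply: eq_existsb => h; rewrite /= -[@vertex M']/(@vertex M).
by case hT: (h \in tree M) => //; rewrite oT.
Qed.

Hypothesis oi : involutive o'.

Lemma rooted_reopp dep : @rooted M dep -> @rooted M' dep.
Proof.
move=> rM; have upE u : @isup M' dep u = @isup M dep u.
  by rewrite /isup /=; case uT: (u \in tree M) => //; rewrite oT.
case: rM => h1 h2 h3 h4 h5 h6 h7 h8; split=> //=.
- by move=> x xT; rewrite (oT xT); apply: h5.
- by move=> x xT; rewrite (oT xT); apply: h6.
- by move=> u u'; rewrite !upE; apply: h7.
- by move=> x /h8[u uu ux]; exists u; rewrite ?upE.
Qed.
End Reopp.

Section Glue.
Variables (M : tree_map) (dep : hedge M -> nat) (h s : hedge M).
Hypotheses (bM : base dep) (oh : opp h = h) (os : opp s = s) (hs : h != s).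

Let rM := base_rooted bM.

Lemma leg_notin_tree x : opp x = x -> x \notin tree M.
Proof. by move=> ox; apply/negP => /(tree_noleg rM); rewrite ox eqxx. Qed.

Lemma glue_oppE x : glue_opp h s x = opp (tperm h s x).
Proof.
rewrite /glue_opp; case: tpermP => [->|->|/eqP/negbTE-> /eqP/negbTE->//].
  by rewrite eqxx os.
by rewrite eqxx oh; case: eqP => // <-.
Qed.

Lemma glue_opp_h : glue_opp h s h = s. Proof. by rewrite /glue_opp eqxx. Qed.
Lemma glue_opp_s : glue_opp h s s = h.
Proof. by rewrite /glue_opp eqxx; case: eqP => // <-. Qed.
Lemma glue_opp_out x : x != h -> x != s -> glue_opp h s x = opp x.
Proof. by rewrite /glue_opp => /negbTE-> /negbTE->. Qed.

Lemma glue_oppT x : x \in tree M -> glue_opp h s x = opp x.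
Proof.
move=> xT; rewrite glue_opp_out //; apply: contraTneq xT => ->; exact: leg_notin_tree.
Qed.

Lemma glue_oppK : involutive (glue_opp h s).
Proof.
move=> x; rewrite [glue_opp h s x]glue_oppE; case: tpermP => [->|->|/eqP xh /eqP xs].
- by rewrite os glue_opp_s.
- by rewrite oh glue_opp_h.
rewrite glue_opp_out ?(oppK rM) //.
  by apply: contraNneq xh => e; rewrite -[x](oppK rM) e oh.
by apply: contraNneq xs => e; rewrite -[x](oppK rM) e os.
Qed.

Lemma glue_anc (x y : hedge M) : @anc (glue h s) x y = anc x y.
Proof. exact: anc_reopp glue_oppT _ _. Qed.

(** Gluing two legs of one face splits it: one more face and two more non-legs add 6 to both sides
    of [euler_count]. *)
Lemma base_glue : anc h s || anc s h -> fconnect (@face_next M) s h ->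
  @base (glue h s) dep.
Proof.
move=> hsc fhs; split.
- exact: rooted_reopp glue_oppT glue_oppK _ rM.
- exact: base_cubic bM.
- exact: base_root bM.
- move=> x xT; rewrite !glue_anc /=.
  have [->|xh] := eqVneq x h; first by rewrite glue_opp_h.
  have [->|xs] := eqVneq x s; first by rewrite glue_opp_s orbC.
  by rewrite glue_opp_out ?(base_cmp bM).
have fE : norb (@face_next (glue h s)) = (norb (@face_next M)).+1.
  have := @norb_swap _ (@face_next M) (@face_next (glue h s)) h s.
  rewrite fhs hs addn0 addn1; apply; last by move=> z; rewrite /face_next /= glue_oppE.
  by apply: face_inj (oppK rM); apply: ccw_inj rM.
have nE : nonlegs (glue h s) = nonlegs M + 2.
  apply: (@nonlegs_pair _ (@opp (glue h s)) (@opp M) h s) => //=.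
  - by rewrite glue_opp_h eq_sym.
  - by rewrite glue_opp_s.
  - by move=> x xh xs; rewrite glue_opp_out.
by have := base_euler bM; rewrite /euler_count fE nE /=; lia.
Qed.
End Glue.

(** The inverse of [glue_opp]. It is also applied to a tree edge, in the Euler argument of
    [first_exit]. *)
Definition cut_opp (M : tree_map) (h x : hedge M) :=
  if (x == h) || (x == opp h) then x else opp x.
Definition cut (M : tree_map) (h : hedge M) : tree_map :=
  TreeMap (@ccw M) (cut_opp h) (root_he M) (tree M).

Section Cut.
Variables (M : tree_map) (dep : hedge M -> nat) (h : hedge M).
Hypotheses (bM : base dep) (oh : opp h != h).

Let rM := base_rooted bM.
Let s := opp h.
Let oi := oppK rM.

Lemma cut_opp_h : cut_opp h h = h. Proof. by rewrite /cut_opp eqxx. Qed.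
Lemma cut_opp_s : cut_opp h s = s. Proof. by rewrite /cut_opp eqxx orbT. Qed.
Lemma cut_opp_out x : x != h -> x != s -> cut_opp h x = opp x.
Proof. by rewrite /cut_opp => /negbTE-> /negbTE->. Qed.
Lemma cut_opp_leg x : cut_opp h x = x -> [\/ x = h, x = s | opp x = x].
Proof.
rewrite /cut_opp; case: (x =P h) => [|_]; first by constructor 1.
by case: (x =P s) => [|_]; [constructor 2 | constructor 3].
Qed.

Lemma cut_oppE x : opp x = cut_opp h (tperm h s x).
Proof.
case: tpermP => [->|->|/eqP xh /eqP xs]; rewrite ?cut_opp_h ?cut_opp_s //.
  by rewrite oi.
by rewrite cut_opp_out.
Qed.

Lemma cut_oppK : involutive (cut_opp h).
Proof.
move=> x; have [->|xh] := eqVneq x h; first by rewrite !cut_opp_h.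
have [->|xs] := eqVneq x s; first by rewrite !cut_opp_s.
rewrite (cut_opp_out xh xs) cut_opp_out ?oi //.
  by apply: contraNneq xs => e; rewrite /s -e oi.
by apply: contraNneq xh => /(can_inj oi)->.
Qed.

Lemma norb_cut : fconnect (@face_next M) s h ->
  norb (@face_next (cut h)) = (norb (@face_next M)).+1.
Proof.
move=> fhs; have := @norb_swap _ (@face_next M) (@face_next (cut h)) h s.
rewrite fhs eq_sym oh addn0 addn1; apply; first by apply: face_inj oi; apply: ccw_inj rM.
by move=> z; rewrite /face_next [in RHS]cut_oppE tpermK.
Qed.

Lemma nonlegs_cut : nonlegs M = nonlegs (cut h) + 2.
Proof.
rewrite /nonlegs (@nonlegs_pair _ (@opp M) (@opp (cut h)) h s) //=.
- by rewrite eq_sym.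
- by rewrite oi eq_sym.
- exact: cut_opp_h.
- exact: cut_opp_s.
by move=> x xh xs; rewrite cut_opp_out.
Qed.

(* If both sides of an edge were in the same face, cutting it would create a
   face without disconnecting the map, against Euler's inequality. *)
Lemma cut_faces : (forall L : hedge M -> {set hedge M},
    (forall x, L (ccw x) = L x) -> (forall x, L (cut_opp h x) = L x) ->
     forall x, L x = L (root_he M)) -> ~~ fconnect (@face_next M) s h.
Proof.
move=> conn; apply/negP => fhs.
have := euler_cubic (ccw_inj rM) cut_oppK (near_cubic_card (ccw_inj rM) (base_cubic bM)) conn.
rewrite -[norb _]/(norb (@face_next (cut h))) norb_cut //.
rewrite -[#|[set x | _]|]/(nonlegs (cut h)).
have := base_euler bM; rewrite /euler_count nonlegs_cut.
by move: (nonlegs _) (norb _) #|_|; lia.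
Qed.

Hypothesis hT : h \notin tree M.

Lemma cut_oppT x : x \in tree M -> cut_opp h x = opp x.
Proof.
move=> xT; rewrite cut_opp_out //; apply: contraTneq xT => -> //.
by apply: contra hT => /(tree_opp rM); rewrite oi.
Qed.

Lemma cut_anc (x y : hedge M) : @anc (cut h) x y = anc x y.
Proof. exact: anc_reopp cut_oppT _ _. Qed.

Lemma cut_ext_faces : ~~ fconnect (@face_next M) s h.
Proof.
apply: cut_faces => L Lc Lo; apply: (tree_label rM Lc) => z zT.
by rewrite -(cut_oppT zT).
Qed.

(** The tree keeps the map connected, so the edge separates two faces; cutting merges them and takes
    6 from both sides of [euler_count]. *)
Lemma base_cut : @base (cut h) dep.
Proof.
split.
- exact: rooted_reopp cut_oppT cut_oppK _ rM.
- exact: base_cubic bM.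
- exact: base_root bM.
- move=> x xT; rewrite !cut_anc /=.
  have [->|xh] := eqVneq x h; first by rewrite cut_opp_h (anc_refl rM).
  have [->|xs] := eqVneq x s; first by rewrite cut_opp_s (anc_refl rM).
  by rewrite cut_opp_out ?(base_cmp bM).
have := base_euler bM; rewrite /euler_count nonlegs_cut.
have : norb (@face_next (cut h)) + 2 = norb (@face_next M) + 1.
  have := @norb_swap _ (@face_next M) (@face_next (cut h)) h s.
  rewrite cut_ext_faces eq_sym oh; apply.
    by apply: face_inj oi; apply: ccw_inj rM.
  by move=> z; rewrite /face_next [in RHS]cut_oppE tpermK.
by rewrite /=; lia.
Qed.

Lemma cut_face_out x : x != h -> x != s -> @face_next (cut h) x = @face_next M x.
Proof. by move=> xh xs; rewrite /face_next /= cut_opp_out. Qed.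

(** From the leg [h] the tour continues with the former successors of [s], because [h] was the
    opposite of [s]; hence the face of [s] comes first. *)
Lemma orbit_cut X Y : orbit (@face_next M) h = h :: Y -> orbit (@face_next M) s = s :: X ->
  orbit (@face_next (cut h)) h = h :: X ++ s :: Y.
Proof.
move=> hY sX; have fi : injective (@face_next M) by apply: face_inj oi; apply: ccw_inj rM.
have un : uniq (h :: X ++ s :: Y).
  have := orbit_uniq (@face_next M) h; have := orbit_uniq (@face_next M) s.
  have dis : ~~ has [in (s :: X)] (h :: Y).
    rewrite -hY -sX; apply/hasPn => z; rewrite /= -!fconnect_orbit => hz.
    apply: contra cut_ext_faces => sz; apply: connect_trans sz _.
    by rewrite (fconnect_sym fi).
  have : uniq ((s :: X) ++ h :: Y) = uniq (h :: X ++ s :: Y).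
    apply: perm_uniq; rewrite -[h :: Y]cat1s -[h :: X ++ _]cat1s -[s :: Y]cat1s -[s :: X]cat1s.
    by apply/seq.permP => P; rewrite !count_cat; lia.
  by move=> <- u1 u2; rewrite cat_uniq -sX u1 -hY u2 sX hY dis.
apply: orbit_cycle => //.
rewrite (@fcycle_cat_split _ (@face_next (cut h)) (@face_next M)) //.
- by rewrite -hY -sX !cycle_orbit.
- by rewrite /face_next /= cut_opp_s.
- by rewrite /face_next /= cut_opp_h oi.
by move=> x xh xs; rewrite cut_face_out.
Qed.

Lemma good_cut : h != root_he M -> anc s h ->
  (forall l, opp l = l -> anc l h) ->
  (forall l, opp l = l -> fconnect (@face_next M) h l || fconnect (@face_next M) s l) ->
  (forall x, 0 < dep x -> covered dep x \/
    anc x h /\ exists l, [/\ opp l = l, anc l x & dep l < dep x]) ->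
  @good (cut h) h dep.
Proof.
move=> hr sh la lf cov; split=> //.
- exact: base_cut.
- exact: cut_opp_h.
- by exists s => //; apply: cut_opp_s.
- move=> l; rewrite cut_anc => /cut_opp_leg[->|->|]//; [exact: anc_refl rM _ | exact: la].
- move=> l ol; have [Y hY] := orbit_cons (@face_next M) h.
  have [X sX] := orbit_cons (@face_next M) s.
  rewrite fconnect_orbit (orbit_cut hY sX) inE mem_cat inE.
  case/cut_opp_leg: ol => [->|->|/lf]; rewrite ?eqxx ?orbT //.
  by rewrite !fconnect_orbit hY sX !inE => /orP[] /orP[] ->; rewrite ?orbT.
move=> x /cov[[y [yT xy yx dy]]|[xh [l [ol lx dl]]]]; last first.
  right; rewrite cut_anc; split=> //; exists l; rewrite cut_anc; split=> //=.
  by rewrite /cut_opp ol if_same.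
(* What the edge covered through [h] now waits for the head [h], with the new leg [s] above it.
   Through [s] it covered nothing, the end of [h] being the lower one. *)
have [yh|yh] := eqVneq y h.
  rewrite yh in xy yx dy; right; rewrite cut_anc; split=> //; exists s.
  by rewrite cut_anc; split=> //; apply: cut_opp_s.
have [ys|ys] := eqVneq y s.
  have := anc_dep rM xy; have := anc_dep rM sh; move: dy; rewrite ys oi; lia.
by left; exists y; rewrite /= cut_opp_out // !cut_anc.
Qed.

End Cut.

(** * Growing a vertex *)

(* [N] is obtained from [M], embedded by [j], by replacing the leg [h] with an edge
   whose other half [u] is attached to a new vertex carrying [u] and the legs [t]
   and [l]. *)
Record grows (M N : tree_map) (h : hedge M) (j : hedge M -> hedge N) (t l u : hedge N)
  : Prop := Grows {
  gr_ccwM : injective (@ccw M);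
  gr_ccwN : injective (@ccw N);
  gr_oppM : involutive (@opp M);
  gr_oppN : involutive (@opp N);
  gr_inj : injective j;
  gr_new : forall x, j x \notin [:: t; l; u];
  gr_cov : forall z, z \in [:: t; l; u] \/ exists x, z = j x;
  gr_uniq : uniq [:: t; l; u];
  gr_ccw : forall x, ccw (j x) = j (ccw x);
  gr_rot : [/\ ccw t = l, ccw l = u & ccw u = t] \/ [/\ ccw t = u, ccw u = l & ccw l = t];
  gr_opp : forall x, x != h -> opp (j x) = j (opp x);
  gr_u : opp u = j h;
  gr_t : opp t = t;
  gr_l : opp l = l;
  gr_leg : opp h = h;
  gr_root : root_he N = j (root_he M);
  gr_tree : forall x, (j x \in tree N) = (x \in tree M) || (x == h);
  gr_hT : h \notin tree M;
  gr_uT : u \in tree N;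
  gr_tT : t \notin tree N;
  gr_lT : l \notin tree N }.

Section Grows.
Variables (M N : tree_map) (h : hedge M) (j : hedge M -> hedge N) (t l u : hedge N).
Hypothesis gr : grows h j t l u.

Let oi := gr_oppN gr.

Lemma grows_ind (P : hedge N -> Prop) :
  P t -> P l -> P u -> (forall x, P (j x)) -> forall z, P z.
Proof.
move=> Pt Pl Pu Pj z; case: (gr_cov gr z) => [|[x ->]//].
by rewrite !inE => /or3P[] /eqP->.
Qed.

Lemma gr_h : opp (j h) = u. Proof. by rewrite -(gr_u gr) oi. Qed.

Lemma grows_neq x : [/\ j x != t, j x != l & j x != u].
Proof. by have := gr_new gr x; rewrite !inE => /norP[-> /norP[-> ->]]. Qed.

Lemma grows_new_neq : [/\ t != l, t != u & l != u].
Proof. by have := gr_uniq gr; rewrite /= !inE negb_or => /andP[/andP[-> ->] /andP[-> _]]. Qed.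

Lemma grows_vertex x : vertex (j x) = j @: vertex x.
Proof.
have it n : iter n (@ccw N) (j x) = j (iter n (@ccw M) x).
  by elim: n => //= n ->; rewrite (gr_ccw gr).
apply/setP => z; apply/idP/imsetP => [|[y]]; rewrite inE => /fconnectP[n].
  by rewrite it => ->; exists (iter n (@ccw M) x); rewrite // inE fconnect_iter.
by move=> -> ->; rewrite inE -it fconnect_iter.
Qed.

Lemma grows_vertex_eq x y : (vertex (j x) == vertex (j y)) = (vertex x == vertex y).
Proof.
rewrite !grows_vertex; apply/eqP/eqP => [|->//]; exact: (imset_inj (gr_inj gr)).
Qed.

Lemma grows_vertex_lu : vertex l = vertex t /\ vertex u = vertex t.
Proof.
have vc (x : hedge N) : vertex (ccw x) = vertex x := vertex_ccw (gr_ccwN gr) x.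
case: (gr_rot gr) => -[h1 h2 h3].
  by rewrite -(vc l) h2 -(vc u) h3.
by rewrite -(vc u) h2 -(vc l) h3.
Qed.

Lemma grows_vertex_t : vertex t = [set t; l; u].
Proof.
apply/setP => z; rewrite [RHS]inE in_set1 in_set2; apply/idP/idP; last first.
  have [el eu] := grows_vertex_lu.
  by rewrite (mem_vertex (gr_ccwN gr)) => /orP[/orP[]|] /eqP->; rewrite ?el ?eu.
rewrite inE => /fconnectP[n ->]; elim: n => [|n]; first by rewrite eqxx.
rewrite iterS; case: (gr_rot gr) => -[h1 h2 h3] /orP[/orP[]|] /eqP->;
by rewrite ?h1 ?h2 ?h3 eqxx ?orbT.
Qed.

Lemma grows_vertex_new x : vertex (j x) != vertex t.
Proof.
apply/eqP => e; have := vertex_id (j x); rewrite e grows_vertex_t.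
have [/negbTE h1 /negbTE h2 /negbTE h3] := grows_neq x.
by rewrite !inE h1 h2 h3.
Qed.

Lemma grows_card : #|hedge N| = #|hedge M| + 3.
Proof.
have [tl tu lu] := grows_new_neq.
rewrite -!cardsT; have -> : [set: hedge N] = t |: (l |: (u |: j @: [set: hedge M])).
  apply/esym/setP => z; rewrite !inE; elim/grows_ind: z => [|||x]; rewrite ?eqxx ?orbT //.
  by rewrite imset_f ?orbT.
have nj z : z \in [:: t; l; u] -> (z \in j @: [set: hedge M]) = false.
  by move=> zn; apply/imsetP => -[x _ zx]; move: (gr_new gr x); rewrite -zx zn.
rewrite !cardsU1 !inE !nj ?inE ?eqxx ?orbT // (negbTE tl) (negbTE tu) (negbTE lu) /=.
by rewrite card_imset; [lia | exact: gr_inj gr].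
Qed.

Lemma grows_opp_leg x : x != h -> (opp (j x) == j x) = (opp x == x).
Proof. by move=> xh; rewrite (gr_opp gr) // (inj_eq (gr_inj gr)). Qed.

Lemma grows_nonlegs : nonlegs N = nonlegs M + 2.
Proof.
rewrite /nonlegs.
have -> : [set z : hedge N | opp z != z] = u |: (j h |: j @: [set x : hedge M | opp x != x]).
  apply/setP => z; rewrite !inE; have [h1 h2 h3] := grows_neq h.
  have [tl tu lu] := grows_new_neq.
  have jn y : y \in [:: t; l; u] -> (y \in j @: [set x : hedge M | opp x != x]) = false.
    by move=> yn; apply/imsetP => -[x _ zx]; move: (gr_new gr x); rewrite -zx yn.
  elim/grows_ind: z => [|||x].
  - by rewrite (gr_t gr) eqxx (negbTE tu) [t == _]eq_sym (negbTE h1) jn // inE eqxx.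
  - by rewrite (gr_l gr) eqxx (negbTE lu) [l == _]eq_sym (negbTE h2) jn // !inE eqxx orbT.
  - by rewrite (gr_u gr) h3 eqxx.
  have [_ _ /negbTE->] := grows_neq x.
  rewrite (inj_eq (gr_inj gr)) mem_imset ?inE /=; last exact: gr_inj gr.
  have [->|xh] := eqVneq x h; last by rewrite grows_opp_leg.
  by rewrite gr_h eq_sym.
have [h1 h2 h3] := grows_neq h.
rewrite !cardsU1 !inE [u == _]eq_sym (negbTE h3) /= mem_imset ?inE ?(gr_leg gr) ?eqxx; last exact: gr_inj gr.
have -> : (u \in j @: [set x : hedge M | opp x != x]) = false.
  by apply/imsetP => -[x _ ux]; have [_ _ /eqP] := grows_neq x; rewrite ux.
by rewrite card_imset; [rewrite /=; lia | exact: gr_inj gr].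
Qed.

Let fN := @face_next N.
Let fM := @face_next M.

Lemma grows_face x : x != h -> fN (j x) = j (fM x).
Proof. by move=> xh; rewrite /fN /face_next (gr_opp gr) // (gr_ccw gr). Qed.
Lemma grows_face_h : fN (j h) = ccw u. Proof. by rewrite /fN /face_next gr_h. Qed.
Lemma grows_face_t : fN t = ccw t. Proof. by rewrite /fN /face_next (gr_t gr). Qed.
Lemma grows_face_l : fN l = ccw l. Proof. by rewrite /fN /face_next (gr_l gr). Qed.
Lemma grows_face_u : fN u = j (fM h).
Proof. by rewrite /fN /fM /face_next (gr_u gr) (gr_ccw gr) (gr_leg gr). Qed.

(** The three half-edges of the new vertex are inserted into one face, between [j h] and its former
    successor; [p] collapses them onto [h]. *)
Lemma grows_fconnect_norb :
  (forall x y, fconnect fN (j x) (j y) = fconnect fM x y) /\ norb fN = norb fM.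
Proof.
have fi : injective fN by apply: face_inj (gr_ccwN gr) oi.
pose p z := if [pick x | j x == z] is Some x then x else h.
have pj x : p (j x) = x.
  by rewrite /p; case: pickP => [y /eqP/(gr_inj gr)//|/(_ x)]; rewrite eqxx.
have pn z : z \in [:: t; l; u] -> p z = h.
  move=> zn; rewrite /p; case: pickP => // y /eqP yz.
  by move: (gr_new gr y); rewrite yz zn.
have [pt pl pu] : [/\ p t = h, p l = h & p u = h] by split; apply: pn; rewrite !inE eqxx ?orbT.
have [c1 c2 c3] : [/\ fconnect fN (j h) t, fconnect fN (j h) l & fconnect fN (j h) u].
  have := grows_face_h; have := grows_face_t; have := grows_face_l.
  case: (gr_rot gr) => -[-> -> ->] e1 e2 e3; split; apply/fconnectP.
  - by exists 1; rewrite /= e3.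
  - by exists 2; rewrite /= e3 e2.
  - by exists 3; rewrite /= e3 e2 e1.
  - by exists 2; rewrite /= e3 e1.
  - by exists 1; rewrite /= e3.
  - by exists 3; rewrite /= e3 e1 e2.
apply: (@norb_transfer _ _ fM fN j p) => //.
- exact: face_inj (gr_ccwM gr) (gr_oppM gr).
- move=> x; have [->|xh] := eqVneq x h; last by rewrite -grows_face // fconnect1.
  by apply: connect_trans c3 _; rewrite -grows_face_u fconnect1.
- elim/grows_ind => [|||x].
  + rewrite grows_face_t; case: (gr_rot gr) => -[-> _ _]; by rewrite ?pt ?pl ?pu connect0.
  + rewrite grows_face_l; case: (gr_rot gr) => -[e1 e2 e3];
    by rewrite ?e2 ?e3 ?pt ?pl ?pu connect0.
  + by rewrite grows_face_u pu pj fconnect1.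
  have [->|xh] := eqVneq x h; last by rewrite grows_face // !pj fconnect1.
  by rewrite grows_face_h pj; case: (gr_rot gr) => -[e1 e2 e3]; rewrite ?e2 ?e3 ?pt ?pl connect0.
by elim/grows_ind => [|||x]; rewrite ?pt ?pl ?pu ?pj.
Qed.

(** The number of faces is unchanged; three new half-edges weigh 6 on the left and two new non-legs
    weigh 6 on the right. *)
Lemma grows_euler : euler_count N <-> euler_count M.
Proof.
rewrite /euler_count grows_nonlegs grows_card; case: grows_fconnect_norb => _.
rewrite /fN /fM => ->; lia.
Qed.

Lemma grows_cubic : near_cubic2 N <-> near_cubic2 M.
Proof.
have rE : root_vertex N = j @: root_vertex M by rewrite /root_vertex (gr_root gr) grows_vertex.
have [tl tu lu] := grows_new_neq; have [vl vu] := grows_vertex_lu.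
have vt3 : #|vertex t| = 3.
  rewrite grows_vertex_t -setUA cardsU1 cards2 !inE (negbTE tl) (negbTE tu).
  by rewrite lu.
rewrite /near_cubic2 rE card_imset; last exact: gr_inj gr.
have ji := imset_inj (gr_inj gr).
split=> -[h1 h2]; split=> //.
  move=> x; have := h2 (j x); rewrite grows_vertex card_imset; last exact: gr_inj gr.
  by rewrite (inj_eq ji).
elim/grows_ind => [|||x]; rewrite ?vl ?vu ?vt3 //.
by rewrite grows_vertex (inj_eq ji) card_imset; [apply: h2 | exact: gr_inj gr].
Qed.

Section Dep.
Variables (dep : hedge M -> nat) (dep' : hedge N -> nat).
Hypothesis depj : forall x, dep' (j x) = dep x.
Hypothesis dept : dep' t = (dep h).+1.
Hypothesis depl : dep' l = (dep h).+1.
Hypothesis depu : dep' u = (dep h).+1.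

Lemma grows_isup x : isup dep' (j x) = isup dep x.
Proof.
rewrite /isup (gr_tree gr) depj; have [->|xh] := eqVneq x h.
  by rewrite gr_h depu (negbTE (gr_hT gr)) /= ltnNge ltnW.
by rewrite orbF (gr_opp gr) // depj.
Qed.

Lemma grows_isup_u : isup dep' u.
Proof. by rewrite /isup (gr_uT gr) (gr_u gr) depu depj /=. Qed.

Lemma grows_rooted : rooted dep -> rooted dep'.
Proof.
move=> rM; have [vl vu] := grows_vertex_lu; split.
- exact: gr_ccwN gr.
- exact: oi.
- elim/grows_ind => [|||x]; last by rewrite (gr_ccw gr) !depj (dep_ccw rM).
  + by case: (gr_rot gr) => -[-> _ _]; rewrite ?depl ?depu dept.
  + by case: (gr_rot gr) => -[e1 e2 e3]; rewrite ?e2 ?e3 ?depl ?depu ?dept.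
  + by case: (gr_rot gr) => -[e1 e2 e3]; rewrite ?e2 ?e3 ?depl ?depu ?dept.
- have rv : (vertex t == root_vertex N) = false.
    by rewrite /root_vertex (gr_root gr) eq_sym (negbTE (grows_vertex_new _)).
  elim/grows_ind => [|||x]; rewrite ?vl ?vu ?rv ?dept ?depl ?depu //.
  by rewrite depj (dep_root rM) /root_vertex (gr_root gr) grows_vertex_eq.
- elim/grows_ind => [|||x]; rewrite ?(negbTE (gr_tT gr)) ?(negbTE (gr_lT gr)) //.
    by rewrite (gr_u gr) (gr_tree gr) eqxx orbT.
  rewrite (gr_tree gr); have [->|xh] := eqVneq x h; first by rewrite gr_h (gr_uT gr).
  by rewrite orbF (gr_opp gr) // (gr_tree gr) => /(tree_opp rM)->.
- elim/grows_ind => [|||x]; rewrite ?(negbTE (gr_tT gr)) ?(negbTE (gr_lT gr)) //.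
    by rewrite (gr_u gr) depu depj; left.
  rewrite (gr_tree gr); have [->|xh] := eqVneq x h; first by rewrite gr_h depu depj; right.
  by rewrite orbF (gr_opp gr) // !depj; apply: tree_dep rM _.
- have nt : isup dep' t = false by rewrite /isup (negbTE (gr_tT gr)).
  have nl : isup dep' l = false by rewrite /isup (negbTE (gr_lT gr)).
  elim/grows_ind => [|||x]; elim/grows_ind => [|||y]; rewrite ?nt ?nl //.
  + by move=> _ _ /esym/eqP; rewrite vu (negbTE (grows_vertex_new _)).
  + by move=> _ _ /eqP; rewrite vu (negbTE (grows_vertex_new _)).
  rewrite !grows_isup => ux uy /eqP; rewrite grows_vertex_eq => /eqP e.
  by rewrite (up_uniq rM ux uy e).
elim/grows_ind => [|||x].
- by exists u => //; apply: grows_isup_u.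
- by exists u; [apply: grows_isup_u | rewrite vl].
- by exists u => //; apply: grows_isup_u.
rewrite depj => /(up_ex rM)[y yu yx]; exists (j y); first by rewrite grows_isup.
by apply/eqP; rewrite grows_vertex_eq yx.
Qed.

Lemma grows_rootedV : rooted dep' -> rooted dep.
Proof.
move=> rN; have [vl vu] := grows_vertex_lu.
have xh x : x \in tree M -> x != h by apply: contraTneq => ->; apply: gr_hT gr.
split.
- exact: gr_ccwM gr.
- exact: gr_oppM gr.
- by move=> x; rewrite -!depj -(gr_ccw gr) (dep_ccw rN).
- by move=> x; rewrite -depj (dep_root rN) /root_vertex (gr_root gr) grows_vertex_eq.
- move=> x xT; have : j x \in tree N by rewrite (gr_tree gr) xT.
  move/(tree_opp rN); rewrite (gr_opp gr) ?xh // (gr_tree gr) => /orP[//|/eqP e].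
  by case/negP: (xh _ xT); rewrite -(gr_oppM gr x) e (gr_leg gr).
- move=> x xT; have : j x \in tree N by rewrite (gr_tree gr) xT.
  by move/(tree_dep rN); rewrite (gr_opp gr) ?xh // !depj.
- move=> x y; rewrite -!grows_isup => ux uy /eqP; rewrite -grows_vertex_eq => /eqP e.
  exact: gr_inj gr _ _ (up_uniq rN ux uy e).
move=> x; rewrite -depj => /(up_ex rN)[z]; elim/grows_ind: z => [|||y].
- by rewrite /isup (negbTE (gr_tT gr)).
- by rewrite /isup (negbTE (gr_lT gr)).
- by move=> _ /esym/eqP; rewrite vu (negbTE (grows_vertex_new _)).
by rewrite grows_isup => yu /eqP; rewrite grows_vertex_eq => /eqP; exists y.
Qed.

Hypotheses (rM : rooted dep) (rN : rooted dep').

Lemma grows_anc x y : anc (j x) (j y) = anc x y.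
Proof.
elim/(dep_ind rM): y => [y yr|y z zu zy IH].
  rewrite (anc_rootv rM _ yr) (anc_rootv rN) ?grows_vertex_eq //.
  by apply/eqP; rewrite /root_vertex (gr_root gr) grows_vertex_eq yr.
rewrite -(anc_vertexr _ zy) (anc_up rM _ zu) -IH.
have zy' : vertex (j z) = vertex (j y) by apply/eqP; rewrite grows_vertex_eq zy.
rewrite -(anc_vertexr _ zy') (anc_up rN) ?grows_isup // grows_vertex_eq (gr_opp gr) //.
by apply: contraTneq zu => ->; rewrite /isup (negbTE (gr_hT gr)).
Qed.

Lemma grows_anc_new x : anc (j x) t = anc x h.
Proof.
have [_ vu] := grows_vertex_lu.
rewrite -(anc_vertexr _ vu) (anc_up rN _ grows_isup_u) vu (negbTE (grows_vertex_new _)).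
by rewrite (gr_u gr) grows_anc.
Qed.

Lemma grows_cmp : ext_comparable M <-> ext_comparable N.
Proof.
split=> cmp.
  elim/grows_ind => [|||x].
  - by rewrite (gr_t gr) (anc_refl rN).
  - by rewrite (gr_l gr) (anc_refl rN).
  - by rewrite (gr_uT gr).
  rewrite (gr_tree gr) => /norP[xT xh]; rewrite (gr_opp gr) // !grows_anc; exact: cmp.
move=> x xT; have [->|xh] := eqVneq x h; first by rewrite (gr_leg gr) (anc_refl rM).
by have := cmp (j x); rewrite (gr_tree gr) (negbTE xT) (negbTE xh) (gr_opp gr) // !grows_anc; apply.
Qed.

(** The new vertex is a leaf of the tree: its only tree half-edge is [u], which goes up. *)
Lemma grows_anc_tl z : anc t z -> vertex z = vertex t.
Proof.
have [vl vu] := grows_vertex_lu.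
move=> tz; apply/eqP; apply: contraT; rewrite eq_sym => ne.
have [w [wu wt _]] := anc_child rN tz ne.
have : opp w \in vertex t by rewrite (mem_vertex (gr_ccwN gr)) wt.
rewrite grows_vertex_t !inE => /orP[/orP[]|] /eqP e.
- by case/andP: wu => /(tree_opp rN); rewrite e (negbTE (gr_tT gr)).
- by case/andP: wu => /(tree_opp rN); rewrite e (negbTE (gr_lT gr)).
by move: wu; rewrite -(oi w) e (isup_opp rN grows_isup_u).
Qed.

End Dep.

Section Good.
Variables (dep : hedge M -> nat) (dep' : hedge N -> nat).
Hypothesis depj : forall x, dep' (j x) = dep x.
Hypothesis dept : dep' t = (dep h).+1.
Hypothesis depl : dep' l = (dep h).+1.
Hypothesis depu : dep' u = (dep h).+1.

Lemma grows_good : good h dep -> good t dep'.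
Proof.
move=> gM; have bM := good_base gM; have rM := base_rooted bM.
have rN : rooted dep' by apply: grows_rooted rM.
have [vl vu] := grows_vertex_lu.
have [tl tu lu] := grows_new_neq.
have ancE := grows_anc depj depu rM rN; have ancN := grows_anc_new depj depu rM rN.
have [fcE _] := grows_fconnect_norb.
have [c1 c2] : fconnect fN (j h) t /\ fconnect fN (j h) l.
  have := grows_face_h; have := grows_face_t; have := grows_face_l.
  case: (gr_rot gr) => -[-> -> ->] e1 e2 e3; split; apply/fconnectP.
  - by exists 1; rewrite /= e3.
  - by exists 2; rewrite /= e3 e2.
  - by exists 2; rewrite /= e3 e1.
  - by exists 1; rewrite /= e3.
have fi : injective fN by apply: face_inj (gr_ccwN gr) oi.
have c3 : fconnect fN t (j h) by rewrite (fconnect_sym fi).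
split.
- split=> //.
  + exact/grows_cubic/(base_cubic bM).
  + rewrite (gr_root gr) (gr_tree gr) negb_or (base_root bM) eq_sym; exact: good_root gM.
  + by apply/(grows_cmp depj depu rM rN); apply: base_cmp bM.
  exact/grows_euler/(base_euler bM).
- exact: gr_t gr.
- by rewrite (gr_root gr) eq_sym; case: (grows_neq (root_he M)).
- by exists l; [apply: gr_l gr | rewrite eq_sym].
- elim/grows_ind => [|||x].
  + by move=> _; apply: anc_refl rN _.
  + by move=> _; apply: (anc_eq rN).
  + by move=> _; apply: (anc_eq rN).
  have [->|xh] := eqVneq x h; first by rewrite ancN (anc_refl rM).
  by move/eqP; rewrite grows_opp_leg // ancN => /eqP/(good_anc gM).
- elim/grows_ind => [|||x].
  + by rewrite connect0.
  + by move=> _; apply: connect_trans c3 c2.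
  + by rewrite (gr_u gr) => /eqP; case: (grows_neq h) => _ _ /negbTE->.
  move=> jl; apply: connect_trans c3 _; rewrite fcE.
  have [->|xh] := eqVneq x h; first exact: connect0.
  by apply: (good_face gM); apply/eqP; rewrite -grows_opp_leg // jl.
have old x : 0 < dep x -> covered dep' (j x) \/
    anc (j x) t /\ exists l, [/\ opp l = l, anc l (j x) & dep' l < dep x].
  case/(good_cov gM) => [[y [yT xy yx dy]]|[xh [k [ok kx dk]]]].
    have yh : y != h.
      apply: contraTneq xy => e; apply/negP => /(anc_dep rM).
      by move: dy; rewrite e (gr_leg gr); lia.
    left; exists (j y); rewrite (gr_opp gr) // (gr_tree gr) !ancE !depj.
    by rewrite (negbTE yT) (negbTE yh).
  right; rewrite ancN; split=> //; exists (j k); rewrite ancE depj; split=> //.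
  rewrite (gr_opp gr) ?ok //; apply: contraTneq xh => e; apply/negP => /(anc_dep rM).
  by move: dk; rewrite e; lia.
(* The edge to the new vertex is not covered yet, but any leg of [M] other than [h] waits strictly
   above it. *)
have new : exists k, [/\ opp k = k, anc k t & dep' k < (dep h).+1].
  have [k ok kh] := good_leg gM; exists (j k).
  have ka := good_anc gM ok.
  by rewrite (gr_opp gr) // ok ancN ka depj ltnS (anc_dep rM ka).
elim/grows_ind => [|||x]; rewrite ?dept ?depl ?depu ?depj; last exact: old.
- by move=> _; right; split=> //; apply: anc_refl rN _.
- move=> _; right; split=> //; first exact: (anc_eq rN).
  by case: new => k [k1 k2 k3]; exists k; rewrite (anc_vertexr _ vl).
- move=> _; right; split=> //; first exact: (anc_eq rN).
  by case: new => k [k1 k2 k3]; exists k; rewrite (anc_vertexr _ vu).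
Qed.

Lemma grows_goodV : good t dep' -> good h dep.
Proof.
move=> gN; have bN := good_base gN; have rN := base_rooted bN.
have rM : rooted dep by apply: grows_rootedV rN.
have [vl vu] := grows_vertex_lu.
have ancE := grows_anc depj depu rM rN; have ancN := grows_anc_new depj depu rM rN.
have [fcE _] := grows_fconnect_norb.
have c1 : fconnect fN (j h) t.
  have := grows_face_h; have := grows_face_t; have := grows_face_l.
  case: (gr_rot gr) => -[-> -> ->] e1 e2 e3; apply/fconnectP.
  - by exists 1; rewrite /= e3.
  - by exists 2; rewrite /= e3 e1.
have new k : opp k = k -> dep' k < dep' t -> exists2 x, k = j x & opp x = x /\ x != h.
  elim/grows_ind: k => [|||x]; rewrite ?dept ?depl ?depu ?ltnn // => jx _.
  have xh : x != h.
    by apply/eqP => e; move: jx; rewrite e gr_h => /esym/eqP; case: (grows_neq h) => _ _ /negbTE->.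
  by exists x => //; split=> //; apply/eqP; rewrite -grows_opp_leg // jx.
split.
- split=> //.
  + exact/grows_cubic/(base_cubic bN).
  + by have := base_root bN; rewrite (gr_root gr) (gr_tree gr) negb_or => /andP[].
  + by apply/(grows_cmp depj depu rM rN); apply: base_cmp bN.
  exact/grows_euler/(base_euler bN).
- exact: gr_leg gr.
- by have := base_root bN; rewrite (gr_root gr) (gr_tree gr) negb_or eq_sym => /andP[].
(* The new vertex is a leaf and its half-edges besides [u] are legs, so nothing covers the edge
   above it; the leg that waits for this edge comes from [M]. *)
- have [|[y [yT ty yt dy]]|[_ [k [ok kt dk]]]] := good_cov gN (x := t); first by rewrite dept.
    have := grows_anc_tl depj depu rN ty; move/eqP; rewrite -(mem_vertex (gr_ccwN gr)) grows_vertex_t !inE.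
    move=> /orP[/orP[]|] /eqP e; move: dy yT; rewrite e ?(gr_t gr) ?(gr_l gr) ?dept ?depl ?ltnn //.
    by rewrite (gr_uT gr).
  by have [x _ [ox xh]] := new k ok dk; exists x.
- move=> x ox; have [->|xh] := eqVneq x h; first exact: anc_refl rM _.
  by rewrite -ancN; apply: (good_anc gN); apply/eqP; rewrite grows_opp_leg // ox.
- move=> x ox; have [->|xh] := eqVneq x h; first exact: connect0.
  rewrite -fcE; apply: connect_trans c1 _; apply: (good_face gN).
  by apply/eqP; rewrite grows_opp_leg // ox.
move=> x; rewrite -depj => /(good_cov gN)[[y [yT xy yx dy]]|[xh [k [ok kx dk]]]]; last first.
  right; rewrite -ancN; split=> //.
  have [|y ky [oy yh]] := new k ok; first by have := anc_dep rN xh; lia.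
  by exists y; rewrite oy -ancE -depj -ky.
left; have dxy := anc_dep rN xy.
elim/grows_ind: y yT xy yx dy dxy => [|||y].
- by rewrite (gr_t gr); lia.
- by rewrite (gr_l gr); lia.
- by rewrite (gr_uT gr).
rewrite (gr_tree gr) => /norP[yT yh]; rewrite (gr_opp gr) // !ancE !depj => xy yx dy _.
by exists y.
Qed.

End Good.

(** A new leg counterclockwise after the head is met first on the tour, otherwise it is met last:
    this is the difference between [phi_a] and [phi_b]. *)
Lemma grows_orbit Q : orbit fM h = h :: Q ->
  orbit fN t = (if ccw t == l then [:: t, l, u & map j Q ++ [:: j h]]
                else [:: t, u & map j Q ++ [:: j h; l]]).
Proof.
move=> hQ; have fi : injective fM by apply: face_inj (gr_ccwM gr) (gr_oppM gr).
have := orbit_uniq fM h; rewrite hQ /= => /andP[hnQ uQ].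
have cyc : fcycle fM (h :: Q) by rewrite -hQ cycle_orbit.
have pj a p : h \notin belast a p -> fpath fN (j a) (map j p) = fpath fM a p.
  elim: p a => //= b p IH a; rewrite inE negb_or eq_sym => /andP[ah hp].
  by rewrite grows_face // (inj_eq (gr_inj gr)) IH.
have fp : fpath fN u (map j Q ++ [:: j h]).
  have -> : map j Q ++ [:: j h] = map j (rcons Q h) by rewrite map_rcons cats1.
  move: cyc; rewrite /=; case: (Q) hnQ => [|b q] hb /=.
    by rewrite !andbT grows_face_u => /eqP->.
  case/andP => /eqP hb' pq; rewrite grows_face_u hb' eqxx /= pj // belast_rcons.
  by move: hb; rewrite inE.
have [n1 n2 n3] := grows_new_neq.
have nj z : z \in [:: t; l; u] -> z \notin map j Q ++ [:: j h].
  move=> zn; rewrite mem_cat mem_seq1 negb_or; apply/andP; split.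
    by apply/mapP => -[x _ zx]; move: (gr_new gr x); rewrite -zx zn.
  by apply/eqP => zx; move: (gr_new gr h); rewrite -zx zn.
have ujQ : uniq (map j Q ++ [:: j h]).
  have -> : map j Q ++ [:: j h] = map j (rcons Q h) by rewrite map_rcons cats1.
  by rewrite (map_inj_uniq (gr_inj gr)) rcons_uniq hnQ.
have [mt ml mu] : [/\ t \in [:: t; l; u], l \in [:: t; l; u] & u \in [:: t; l; u]].
  by rewrite !inE !eqxx !orbT.
case: (gr_rot gr) => -[e1 e2 e3].
  rewrite e1 eqxx; apply: orbit_cycle.
    rewrite /= grows_face_t grows_face_l e1 e2 !eqxx /= rcons_path fp /=.
    by rewrite last_cat /= grows_face_h e3.
  by rewrite /= !inE !negb_or n1 n2 n3 !nj // ujQ.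
have -> : (ccw t == l) = false by rewrite e1 eq_sym (negbTE n3).
have -> : map j Q ++ [:: j h; l] = rcons (map j Q ++ [:: j h]) l by rewrite -cats1 -catA.
apply: orbit_cycle.
  rewrite /= grows_face_t e1 eqxx /= !rcons_path fp /= last_rcons last_cat /=.
  by rewrite grows_face_h grows_face_l e2 e3 !eqxx.
rewrite /= !inE mem_rcons inE mem_rcons inE rcons_uniq !negb_or n1 n2 !nj //.
by rewrite eq_sym n3 ujQ.
Qed.

End Grows.

(** * The invariant of reachable maps *)

Lemma uniq_card (T : finType) (A : {set T}) s :
  uniq s -> all (fun x => x \in A) s -> size s <= #|A|.
Proof.
move=> us /allP sA; rewrite -(card_uniqP us); apply/subset_leq_card/subsetP => x; exact: sA.
Qed.

Lemma filter_cons_split (T : eqType) (p : pred T) Z l ls : filter p Z = l :: ls ->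
  exists X Y, [/\ Z = X ++ l :: Y, ~~ has p X & filter p Y = ls].
Proof.
elim: Z => //= z Z IH; case: ifP => pz; first by case=> <- <-; exists [::], Z.
by case/IH => X [Y [-> hX fY]]; exists (z :: X), Y; rewrite /= pz.
Qed.

Lemma filter_rcons_split (T : eqType) (p : pred T) Z l ls : filter p Z = rcons ls l ->
  exists X Y, [/\ Z = X ++ l :: Y, ~~ has p Y & filter p X = ls].
Proof.
move=> e; have := @filter_cons_split _ p (rev Z) l (rev ls).
rewrite filter_rev e rev_rcons => /(_ erefl)[X [Y [ZE hX fY]]].
exists (rev Y), (rev X); split; last by rewrite filter_rev fY revK.
  by rewrite -[Z]revK ZE rev_cat rev_cons cat_rcons.
by rewrite has_rev.
Qed.

Lemma fpath_next (T : eqType) (f : T -> T) a p b x :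
  fpath f a (rcons p b) -> x \in p -> f x \in rcons p b.
Proof.
elim: p a => //= c p IH a /andP[_ pc]; rewrite inE => /orP[/eqP->|xp].
  case: p pc {IH} => [|d p] /= /andP[/eqP-> _]; by rewrite !inE eqxx ?orbT.
by rewrite inE (IH _ pc xp) orbT.
Qed.

Lemma vertex_card (M : tree_map) (dep : hedge M -> nat) x : base dep ->
  #|vertex x| = if dep x == 0 then 2 else 3.
Proof.
move=> bM; have [r2 v3] := base_cubic bM; rewrite (dep_root (base_rooted bM)).
by case: eqP => [->//|/eqP /v3].
Qed.

(** The vertex of two such legs would also carry the head or a half-edge towards it and, away from
    the root-vertex, the half-edge towards its parent: too many for its degree. *)
Lemma good_leg_uniq (M : tree_map) (h : hedge M) (dep : hedge M -> nat) l l' :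
  good h dep -> opp l = l -> opp l' = l' -> l != h -> l' != h ->
  vertex l = vertex l' -> l = l'.
Proof.
move=> gM ol ol' lh l'h ll'; apply/eqP; apply: contraT => ne.
have bM := good_base gM; have rM := base_rooted bM; have ci := ccw_inj rM.
have nT (x : hedge M) : opp x = x -> x \notin tree M by exact: (leg_notin_tree bM).
have [w [wv wu wl wl']] : exists w, [/\ vertex w = vertex l, ~~ isup dep w, w != l & w != l'].
  have [e|lnh] := eqVneq (vertex l) (vertex h).
    by exists h; rewrite e /isup (negbTE (nT h (good_head gM))) ![h == _]eq_sym.
  have [z [zu zl _]] := anc_child rM (good_anc gM ol) lnh.
  have zT : opp z \in tree M by case/andP: zu => /(tree_opp rM).
  exists (opp z); rewrite zl (isup_opp rM zu); split=> //.
    by apply: contraTneq zT => ->; apply: nT.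
  by apply: contraTneq zT => ->; apply: nT.
have := vertex_card l bM; case: eqP => [_|/eqP].
  have := @uniq_card _ (vertex l) [:: l; l'; w]; rewrite /= !in_cons !in_nil !orbF !negb_or ne [l == w]eq_sym wl.
  by rewrite [l' == w]eq_sym wl' !(mem_vertex ci) wv ll' eqxx => /(_ isT isT); lia.
rewrite -lt0n => /(up_ex rM)[u uu ul].
have uT : u \in tree M by case/andP: uu.
have := @uniq_card _ (vertex l) [:: u; l; l'; w].
rewrite /= !in_cons !in_nil !orbF !negb_or ne [l == w]eq_sym wl [l' == w]eq_sym wl' !(mem_vertex ci) wv ul ll' eqxx.
have -> : u != l by apply: contraTneq uT => ->; apply: nT.
have -> : u != l' by apply: contraTneq uT => ->; apply: nT.
have -> : u != w by apply: contraTneq uu => ->.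
by move=> /(_ isT isT) /=; lia.
Qed.

(** One of the two sides of the tour, cut at the leg [l], stays in the subtree of [l]. Over all legs
    this excludes an inner maximum of the depth, in a form that survives insertions into the
    tour. *)
Definition pre (M : tree_map) (h l : hedge M) := exists P Q,
  orbit (@face_next M) h = P ++ l :: Q /\ (all (anc l) P \/ all (anc l) Q).

Definition valid (M : growing_map) (dep : hedge M -> nat) :=
  good (head_he M) dep /\
  forall l, opp l = l -> l != head_he M -> pre (head_he M) l.

Definition dep0 : hedge M0 -> nat := fun=> 0.

Lemma M0_connect (x y : bool) (f : bool -> bool) : (forall z, f z = ~~ z) -> fconnect f x y.
Proof.
move=> fE; case: (eqVneq x y) => [->|ne]; first exact: connect0.
apply: connect1; rewrite /= fE; by case: x y ne => -[].
Qed.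

Lemma M0_vertex (x y : hedge M0) : vertex x = vertex y.
Proof. by apply/setP => z; rewrite !inE !M0_connect. Qed.

Lemma M0_inv : valid dep0.
Proof.
have vT (x : hedge M0) : vertex x = setT by apply/setP => z; rewrite !inE M0_connect.
have aT (x y : hedge M0) : anc x y.
  apply/ancestorP; exists [::]; last by rewrite inE (M0_vertex x (root_he M0)).
  by rewrite /tree_path /= (M0_vertex y (root_he M0)) eqxx.
split; last first.
  move=> l _; case: l => // _; exists [:: true], [::]; split; last by left; rewrite /= aT.
  apply: orbit_cycle => //=.
split=> //; first split=> //.
- split=> //.
  + exact: negb_inj.
  + by move=> x; rewrite /root_vertex (M0_vertex x (root_he M0)) eqxx.
  + by move=> x; rewrite /= inE.
  by move=> u u'; rewrite /isup /= inE.
- split; first by rewrite /root_vertex vT cardsT card_bool.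
  by move=> x; rewrite /root_vertex (M0_vertex x (root_he M0)) eqxx.
- by rewrite /= inE.
- by move=> x _; rewrite aT.
- rewrite /euler_count /nonlegs card_bool.
  have -> : [set x : hedge M0 | opp x != x] = set0 by apply/setP => x; rewrite !inE eqxx.
  rewrite cards0; suff -> : norb (@face_next M0) = 1 by [].
  rewrite /norb -(cards1 [set: hedge M0]); congr #|pred_of_set _|.
  apply/setP => S; rewrite inE; apply/imsetP/eqP => [[x _ ->]|->].
    by apply/setP => z; rewrite !inE M0_connect.
  by exists true => //; apply/setP => z; rewrite !inE M0_connect.
- by exists false.
- by move=> l _; apply: M0_connect.
Qed.

Definition grow_dep (M : growing_map) (dep : hedge M -> nat) (z : hedge M + new_hedge) :=
  if z is inl x then dep x else (dep (head_he M)).+1.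

Lemma grow_grows (M : growing_map) (dep : hedge M -> nat) rho :
  rho = ccw_leg_left \/ rho = ccw_leg_right -> good (head_he M) dep ->
  @grows M (grow rho M) (head_he M) inl (inr NewHead) (inr NewLeg) (inr NewTail).
Proof.
move=> hrho gM; have bM := good_base gM; have rM := base_rooted bM.
have oh := good_head gM; have hT := leg_notin_tree bM oh.
have mt (x : hedge M) : (inl x \in grow_tree M) = (x \in tree M) || (x == head_he M).
  by rewrite !inE orbF mem_imset // => ? ? [].
split=> //=.
- exact: ccw_inj rM.
- move=> [x|x] [y|y] //= [].
    by move/(ccw_inj rM)->.
  by case: hrho => ->; case: x; case: y.
- exact: oppK rM.
- move=> [x|[||]] //=; rewrite ?eqxx //.
  case: eqP => [->//|/eqP xh] /=; case: eqP => [e|_]; last by rewrite (oppK rM).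
  by case/eqP: xh; rewrite -(oppK rM x) e oh.
- exact: inl_inj.
- move=> [x|[||]]; [by right; exists x | left..]; by rewrite !inE ?eqxx ?orbT.
- by rewrite !inE !negb_or; apply/and3P; split=> //; [apply/andP; split|]; apply/eqP.
- by case: hrho => ->; [left|right].
- by move=> x xh; rewrite (negbTE xh).
- by rewrite !inE eqxx !orbT.
- by apply/negP; rewrite !inE => /orP[/imsetP[]//|/orP[]/eqP].
- by apply/negP; rewrite !inE => /orP[/imsetP[]//|/orP[]/eqP].
Qed.

(** The new leg follows the head or ends the tour, so one of its sides is trivial. The half-edges
    inserted at the new vertex lie below the head, hence below every old leg, whichever side they
    join. *)
Lemma grow_inv (M : growing_map) (dep : hedge M -> nat) rho :
  rho = ccw_leg_left \/ rho = ccw_leg_right -> valid dep ->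
  valid (M := grow rho M) (grow_dep dep) /\
  size (tour_legs (grow rho M)) = (size (tour_legs M)).+1.
Proof.
move=> hrho [gM prM]; set N := grow rho M; set h := head_he M in gM prM *.
have gr := grow_grows hrho gM; have bM := good_base gM; have rM := base_rooted bM.
have gN : good (M := N) (inr NewHead) (grow_dep dep).
  by apply: (grows_good gr) gM.
have rN := base_rooted (good_base gN).
have ancE x y : anc (M := N) (inl x) (inl y) = anc x y.
  by apply: (grows_anc gr _ _ rM rN).
have ancN x : anc (M := N) (inl x) (inr NewHead) = anc x h.
  by apply: (grows_anc_new gr _ _ rM rN).
have [vl vu] := grows_vertex_lu gr.
have [Q hQ] := orbit_cons (@face_next M) h.
have oN := grows_orbit gr hQ.
have hnQ : h \notin Q by have := orbit_uniq (@face_next M) h; rewrite hQ => /andP[].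
have oh : opp (inl h : hedge N) = inr NewTail by rewrite /= eqxx.
pose pN := [pred z : hedge N | is_leg z && (z != inr NewHead)].
pose pM := [pred x : hedge M | is_leg x && (x != h)].
have fQ : filter pN (map inl Q) = map inl (filter pM Q).
  rewrite filter_map; congr map; apply: eq_in_filter => x xQ; rewrite /= /is_leg /=.
  have xh : x != h by apply: contraNneq hnQ => <-.
  by rewrite (negbTE xh) andbT.
split; [split=> // | ]; last first.
  have fc a s : filter pN (a :: s) = if pN a then a :: filter pN s else filter pN s by [].
  have -> : tour_legs N = filter pN (orbit (@face_next N) (inr NewHead)) by [].
  have -> : tour_legs M = filter pM Q.
    by rewrite /tour_legs -/h hQ /= eqxx andbF.
  have pt : pN (inr NewHead) = false by rewrite /= eqxx andbF.
  have pu : pN (inr NewTail) = false by [].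
  have pl : pN (inr NewLeg) by rewrite /= /is_leg /= eqxx; apply/eqP.
  have ph : pN (inl h) = false by rewrite /= /is_leg oh.
  rewrite oN; case: ifP => _; rewrite !fc pt pu filter_cat fQ !fc ph pl /=;
  by rewrite size_cat size_map ?addn0 ?addn1.
move=> z oz zt.
case: (gr_cov gr z) => [|[x zx]].
  rewrite !inE => /or3P[] /eqP zE; [by rewrite zE eqxx in zt | | by rewrite zE in oz].
  rewrite zE /pre oN; case: ifP => _.
    by eexists [:: inr NewHead], _; split; first reflexivity; left; rewrite /= (anc_eq rN).
  exists [:: inr NewHead, inr NewTail & map inl Q ++ [:: inl h]], [::].
  by split; [rewrite /= -catA | right].
have xh : x != h by apply: contraTneq zt => e; move: oz; rewrite zx e oh.
have ox : opp x = x by move: oz; rewrite zx /= (negbTE xh) => -[].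
have [P' [Q' [hPQ PQ]]] := prM x ox xh.
move: hPQ; rewrite hQ; case: P' PQ => [|h' P''] PQ [hx QE].
  by rewrite -hx eqxx in xh.
have axh : anc x h by apply: good_anc gM _ ox.
have new n : anc (M := N) (inl x) (inr n).
  have vn : vertex (M := N) (inr n) = vertex (M := N) (inr NewHead) by case: n.
  by rewrite (anc_vertexr _ vn) ancN.
have mapE (R : seq (hedge M)) : all (anc x) R -> all (anc (M := N) (inl x)) (map inl R).
  by move=> /allP al; apply/allP => _ /mapP[y yR ->]; rewrite ancE al.
rewrite zx /pre oN QE map_cat map_cons; case: ifP => _.
  exists [:: inr NewHead, inr NewLeg, inr NewTail & map inl P''], (map inl Q' ++ [:: inl h]).
  split; first by rewrite /= -catA.
  case: PQ => [/andP[_ /mapE aP]|/mapE aQ]; [left | right].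
    by rewrite /= !new aP.
  by rewrite all_cat aQ /= ancE axh.
exists [:: inr NewHead, inr NewTail & map inl P''], (map inl Q' ++ [:: inl h; inr NewLeg]).
split; first by rewrite /= -catA.
case: PQ => [/andP[_ /mapE aP]|/mapE aQ]; [left | right].
  by rewrite /= !new aP.
by rewrite all_cat aQ /= ancE axh new.
Qed.

(* How the half-edge [h] glued by [phi_c] is recovered from the new head [t]: it is
   the first exit from the descendants of [t] along the tour of the head-face,
   walked forwards or backwards. *)
Definition cback (N : tree_map) (t h : hedge N) : Prop :=
  [/\ h \notin tree N, anc (opp h) t, ~~ anc t (opp h)
   & (exists X Y, orbit (@face_next N) t = t :: X ++ h :: Y /\
         all (fun x => anc t (opp x)) X) \/
     (exists X Y, orbit (@face_next N) t = t :: Y ++ opp h :: X /\ all (anc t) X)].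

(** * The invariant under gluing *)

Section GoodGlue.
Variables (M : tree_map) (dep : hedge M -> nat) (h s t : hedge M).
Hypotheses (gM : good h dep) (os : opp s = s) (ot : opp t = t).
Hypotheses (sh : s != h) (th : t != h) (dst : dep s < dep t).
Hypothesis ast : anc s t.

Let N := @glue M h s.
Let bM := good_base gM.
Let rM := base_rooted bM.
Let oh := good_head gM.
Let fi : injective (@face_next M) := face_inj (ccw_inj rM) (oppK rM).

Let hs : h != s. Proof. by rewrite eq_sym. Qed.
Let ts : t != s. Proof. by apply: contraTneq dst => ->; rewrite ltnn. Qed.

Lemma glue_leg (l : hedge M) : @opp N l = l -> [/\ opp l = l, l != h & l != s].
Proof.
rewrite /N /=; have [->|lh] := eqVneq l h.
  by rewrite glue_opp_h => e; move: sh; rewrite e eqxx.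
have [->|ls] := eqVneq l s; first by rewrite glue_opp_s => // e; move: hs; rewrite e eqxx.
by rewrite glue_opp_out.
Qed.

Lemma glue_legV (l : hedge M) : opp l = l -> l != h -> l != s -> @opp N l = l.
Proof. by move=> ol lh ls; rewrite /= glue_opp_out. Qed.

(** The new edge covers the branch from [s] down to [h]. Vertices from the root-vertex down to [s]
    keep the leg they wait for: it is strictly above them, so it is neither [s] nor the head, and
    they remain ancestors of the new head [t]. *)
Lemma good_glue :
  (exists l, [/\ opp l = l, l != h, l != s & l != t]) ->
  (forall l, opp l = l -> l != h -> anc l t) ->
  (forall l, opp l = l -> l != h -> l != s -> fconnect (@face_next N) t l) ->
  @good N t dep.
Proof.
move=> [l0 [ol0 l0h l0s l0t]] la lf.
have aN := glue_anc bM oh os.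
have ash : anc s h by apply: good_anc gM _ os.
have bN : @base N dep.
  apply: base_glue => //; first by rewrite ash orbT.
  by rewrite (fconnect_sym fi); apply: good_face gM _ os.
split=> //.
- exact: glue_legV.
- apply: contraTneq dst => ->; rewrite -leqNgt; have := dep_root rM (root_he M).
  by rewrite eqxx => /eqP->.
- by exists l0 => //; apply: glue_legV.
- by move=> l /glue_leg[ol lh ls]; rewrite aN; apply: la.
- by move=> l /glue_leg[ol lh ls]; apply: lf.
move=> x /(good_cov gM)[[y [yT xy yx dy]]|[xh [l [ol lx dl]]]].
  left; exists y; rewrite !aN /=.
  have yl : opp y != y by apply: contraTneq dy => ->; rewrite -leqNgt (anc_dep rM).
  rewrite glue_opp_out //; apply: contraNneq yl => ->; by rewrite ?oh ?os.
have [dsx|dxs] := ltnP (dep s) (dep x).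
  left; exists h; rewrite !aN /= glue_opp_h; split=> //.
    exact: (leg_notin_tree bM oh).
  exact: (anc_total_dep rM ash xh (ltnW dsx)).
have xs : @anc M x s := anc_total_dep rM xh ash dxs.
right; rewrite aN (anc_trans rM xs ast); split=> //; exists l; rewrite aN; split=> //.
apply: (glue_legV ol).
  by apply: contraTneq dl => ->; rewrite -leqNgt (anc_dep rM).
by apply: contraTneq dl => ->; rewrite -leqNgt.
Qed.

(** Gluing splits the head-face; the new tour keeps the part that contains [t], and [X1] goes to the
    other face. *)
Lemma orbit_glue1 X1 X2 X3 : orbit (@face_next M) h = h :: X1 ++ s :: X2 ++ t :: X3 ->
  orbit (@face_next N) t = t :: X3 ++ h :: X2.
Proof.
move=> oE; have un := orbit_uniq (@face_next M) h; have cy := cycle_orbit fi h.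
rewrite oE in un cy; move: cy.
rewrite (@fcycle_cat_split _ (@face_next M) (@face_next N) h s) //.
- case/andP => cy _; have E : t :: X3 ++ h :: X2 = rot (size (h :: X2)) ((h :: X2) ++ t :: X3).
    by rewrite rot_size_cat.
  apply: orbit_cycle; rewrite E ?rot_cycle //= rot_uniq.
  apply: subseq_uniq un; rewrite /= eqxx; apply: subseq_trans (suffix_subseq _ _).
  exact: subseq_cons.
- by rewrite /face_next /= glue_opp_h os.
- by rewrite /face_next /= glue_opp_s // oh.
by move=> x xh xs; rewrite /face_next /= glue_opp_out.
Qed.

Lemma orbit_glue2 X1 X2 X3 : orbit (@face_next M) h = h :: X1 ++ t :: X2 ++ s :: X3 ->
  orbit (@face_next N) t = t :: X2 ++ s :: X1.
Proof.
rewrite -[t :: X2 ++ _]cat_cons catA => oE.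
have un := orbit_uniq (@face_next M) h; have cy := cycle_orbit fi h.
rewrite oE in un cy; move: cy.
rewrite (@fcycle_cat_split _ (@face_next M) (@face_next N) h s) //.
- case/andP => _ cy; have E : t :: X2 ++ s :: X1 = rot (size (s :: X1)) ((s :: X1) ++ t :: X2).
    by rewrite rot_size_cat.
  apply: orbit_cycle; rewrite E ?rot_cycle //= rot_uniq.
  move: un; rewrite /= cat_uniq /= => /andP[_ /and3P[-> /norP[-> _] _]] //.
- by rewrite /face_next /= glue_opp_h os.
- by rewrite /face_next /= glue_opp_s // oh.
by move=> x xh xs; rewrite /face_next /= glue_opp_out.
Qed.
End GoodGlue.

(** Three legs are asked for: the first, the last, and one that remains beside the new head. The
    last two clauses serve injectivity: no other leg shares the new head-vertex, and [cback] locates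
    the glued edge. *)
Lemma phi_c_inv (M : growing_map) (dep : hedge M -> nat) : valid dep ->
  2 < size (tour_legs M) -> exists s t : hedge M,
  let N := @GrowingMap (@glue M (head_he M) s) t in
  [/\ phi_c M = Some N, @valid N dep, size (tour_legs N) + 2 = size (tour_legs M),
      [/\ opp s = s, s != head_he M & forall l, @opp N l = l -> vertex l = vertex t -> l = t]
    & @cback N t (head_he M)].
Proof.
move=> [gM prM]; set h := head_he M in gM prM *.
have bM := good_base gM; have rM := base_rooted bM; have oh := good_head gM.
have fi : injective (@face_next M) := face_inj (ccw_inj rM) (oppK rM).
have [Z hZ] := orbit_cons (@face_next M) h.
pose p := [pred x : hedge M | is_leg x && (x != h)].
have tE : tour_legs M = filter p Z by rewrite /tour_legs -/h hZ /= eqxx andbF.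
case E: (tour_legs M) => [//|l ls]; case: (lastP ls) E => [//|ls' l' E] sz.
have {sz} ls'0 : 0 < size ls' by move: sz; rewrite /= size_rcons; lia.
have [X1 [Y [ZE nX1 fY]]] := filter_cons_split (etrans (esym tE) E).
have [X2 [X3 [YE nX3 fX2]]] := filter_rcons_split fY.
have pin x : x \in l :: rcons ls' l' -> opp x = x /\ x != h.
  by rewrite -E tE mem_filter => /andP[/andP[/eqP]].
have [ol lh] := pin l (mem_head _ _).
have [ol' l'h] : opp l' = l' /\ l' != h by apply: pin; rewrite inE mem_rcons mem_head orbT.
have oE : orbit (@face_next M) h = h :: X1 ++ l :: X2 ++ l' :: X3 by rewrite hZ ZE YE.
have un := orbit_uniq (@face_next M) h; rewrite oE in un.
have ll' : l != l'.
  move: un => /= /andP[_]; rewrite cat_uniq => /and3P[_ _] /= /andP[+ _].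
  by rewrite mem_cat inE !negb_or => /and3P[].
have vll' : vertex l != vertex l'.
  by apply: contraNneq ll' => /(good_leg_uniq gM ol ol' lh l'h)->.
have legs k : opp k = k -> k != h -> [\/ k = l, k = l' | k \in X2].
  move=> ok kh; have := good_face gM ok; rewrite fconnect_orbit oE inE (negbTE kh) /=.
  have pk : p k by rewrite /= /is_leg ok eqxx.
  rewrite mem_cat => /orP[kX|].
    by case/hasP: nX1; exists k.
  rewrite inE => /orP[/eqP->|]; first by constructor 1.
  rewrite mem_cat => /orP[?|]; first by constructor 3.
  rewrite inE => /orP[/eqP->|kX]; first by constructor 2.
  by case/hasP: nX3; exists k.
have [k0 [k0X k0p]] : exists k, k \in X2 /\ p k.
  case: (ls') ls'0 fX2 => // k ? _ fX2; exists k; apply/andP.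
  by rewrite andbC -mem_filter fX2 mem_head.
have [k0l k0l' ok0 k0h] : [/\ k0 != l, k0 != l', opp k0 = k0 & k0 != h].
  case/andP: k0p => /eqP ok0 k0h; split=> //.
    apply: contraTneq k0X => ->; move: un => /= /andP[_]; rewrite cat_uniq => /and3P[_ _].
    by rewrite /= mem_cat negb_or => /andP[/andP[]].
  apply: contraTneq k0X => ->; move: un => /= /andP[_]; rewrite cat_uniq => /and3P[_ _] /= /andP[_].
  by rewrite cat_uniq /= negb_or => /and3P[_ /andP[]].
have al := good_anc gM ol; have al' := good_anc gM ol'.
have uniq_leg (s t k : hedge M) : opp t = t -> t != h -> s != h ->
    @opp (glue h s) k = k -> vertex k = vertex t -> k = t.
  move=> ot th sh ok vk; have [ok' kh _] := glue_leg sh ok.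
  exact: good_leg_uniq gM ok' ot kh th vk.
have nk (k : hedge M) (R S P Q : seq (hedge M)) :
    orbit (@face_next M) h = R ++ k :: S -> orbit (@face_next M) h = P ++ k :: Q -> R = P /\ S = Q.
  move=> e1 e2; have u1 := orbit_uniq (@face_next M) h; have u2 := u1.
  rewrite e1 in u1; rewrite e2 in u2.
  have ix (R' S' : seq (hedge M)) : uniq (R' ++ k :: S') -> index k (R' ++ k :: S') = size R'.
    rewrite cat_uniq /= => /and3P[_ /norP[kR _] _].
    by rewrite index_cat (negbTE kR) /= eqxx addn0.
  have sE : size R = size P by rewrite -(ix R S) // -(ix P Q) // -e1 -e2.
  by move: e1; rewrite e2 => /eqP; rewrite eqseq_cat // => /andP[/eqP-> /eqP[->]].
have prel k : k \in X2 -> opp k = k -> k != h ->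
  exists A B, X2 = A ++ k :: B /\ (all (anc k) (h :: X1 ++ l :: A) \/ all (anc k) (B ++ l' :: X3)).
  move=> kX ok kh; have [P [Q [PQ aPQ]]] := prM k ok kh.
  have [A [B XE]] : exists A B, X2 = A ++ k :: B by case/splitPr: kX => A B; exists A, B.
  exists A, B; split=> //.
  have pos : orbit (@face_next M) h = (h :: X1 ++ l :: A) ++ k :: (B ++ l' :: X3).
    by rewrite oE XE /= -!catA.
  by have [<- <-] := nk _ _ _ _ _ PQ pos.
have tl_pos : orbit (@face_next M) h = (h :: X1) ++ l :: (X2 ++ l' :: X3) by rewrite oE.
have tl'_pos : orbit (@face_next M) h = (h :: X1 ++ l :: X2) ++ l' :: X3 by rewrite oE /= -catA.
have path_all : fpath (@face_next M) h (rcons (X1 ++ l :: X2 ++ l' :: X3) h).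
  by have := cycle_orbit fi h; rewrite oE.
have [all'|nall'] := boolP (anc l l').
  have dl : dep l < dep l'.
    by rewrite ltnNge; apply: contra vll' => /(anc_dep_eq rM all')->.
  (* [l] comes before [l'] on the tour and is not below it, so [pre] leaves only the other side:
     what follows [l'] is in its subtree. *)
  have aX3 : all (anc l') X3.
    have [P [Q [PQ aPQ]]] := prM l' ol' l'h; have [eP eQ] := nk _ _ _ _ _ PQ tl'_pos.
    rewrite -eQ; case: aPQ => // /allP/(_ l); rewrite eP inE mem_cat mem_head !orbT => /(_ isT).
    by move/(anc_dep rM); rewrite leqNgt dl.
  exists l, l'; cbv zeta; set N := (GrowingMap _).
  have oN : orbit (@face_next N) l' = l' :: X3 ++ h :: X2.
    exact: (orbit_glue1 gM ol oE).
  have aN := glue_anc bM oh ol.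
  have gN : @good N l' dep.
    apply: (good_glue gM ol ol' lh l'h dl all').
    - by exists k0.
    (* A leg [k] in between has [l] or [l'] in its subtree, according to the side given by [pre];
       both are ancestors of [l']. *)
    - move=> k ok kh; case: (legs k ok kh) => [->//|->|kX]; first exact: anc_refl rM _.
      have [A [B [_ [/allP aA|/allP aB]]]] := prel k kX ok kh.
        apply: (anc_trans rM (aA l _) all').
        by rewrite inE mem_cat mem_head !orbT.
      by apply: aB; rewrite mem_cat mem_head orbT.
    - move=> k ok kh kl; rewrite fconnect_orbit oN.
      case: (legs k ok kh) => [e|->|kX]; first by rewrite e eqxx in kl.
        exact: mem_head.
      by rewrite inE mem_cat inE kX !orbT.
  split.
  - by rewrite /phi_c E last_rcons (negbTE vll') -/(anc l l') all'.
  - split=> // k ok kl'; have [ok' kh kl] := glue_leg lh ok.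
    case: (legs k ok' kh) => [e|e|kX]; [by rewrite e eqxx in kl | by rewrite e eqxx in kl' |].
    have [A [B [XE aAB]]] := prel k kX ok' kh.
    have akl' : @anc M k l' by have := good_anc gN ok; rewrite aN.
    exists (l' :: X3 ++ h :: A), B; rewrite oN XE; split; first by rewrite /= -catA.
    case: aAB => [aA|aB]; [left | right].
      move: aA; rewrite /= all_cat /= => /and4P[kh' _ _ aA].
      rewrite /= all_cat /= !aN akl' kh' /=; apply/andP; split; last first.
        by apply/allP => z zA; rewrite aN; apply: (allP aA).
      by apply/allP => z /(allP aX3) lz; rewrite aN (anc_trans rM akl' lz).
    by move: aB; rewrite all_cat => /andP[/allP aB _]; apply/allP => z zB; rewrite aN aB.
  - rewrite /= size_rcons -fX2 /tour_legs /= oN /= eqxx andbF filter_cat.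
    have -> : [seq x <- X3 | is_leg (M := N) x & x != l'] = [::].
      apply/eqP; rewrite -[_ == _]negbK -has_filter; apply/negP => /hasP[x xX3 /andP[/eqP ox xl']].
      have [ox' xh _] := glue_leg lh ox.
      by case/hasP: nX3; exists x => //=; rewrite /is_leg ox' eqxx.
    rewrite /= {1}/is_leg /= glue_opp_h (negbTE lh) /= addn2; congr _.+2.
    rewrite size_filter size_filter; apply: eq_in_count => x xX2 /=.
    have [xl xl' xh] : [/\ x != l, x != l' & x != h].
      split.
      + apply: contraTneq xX2 => ->; move: un => /= /andP[_]; rewrite cat_uniq => /and3P[_ _].
        by rewrite /= mem_cat negb_or => /andP[/andP[]].
      + apply: contraTneq xX2 => ->; move: un => /= /andP[_]; rewrite cat_uniq => /and3P[_ _] /= /andP[_].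
        by rewrite cat_uniq /= negb_or => /and3P[_ /andP[]].
      apply: contraTneq xX2 => ->; move: un => /= /andP[+ _].
      by rewrite mem_cat inE mem_cat !negb_or => /and4P[].
    by rewrite /is_leg /= glue_opp_out // xl' xh !andbT.
  - by split=> // k; apply: uniq_leg.
  split=> /=.
  - exact: (leg_notin_tree bM oh).
  - by rewrite aN glue_opp_h.
  - by rewrite aN glue_opp_h; apply/negP => /(anc_dep rM); rewrite leqNgt dl.
  (* [opp x] is at the vertex of the next half-edge of the old tour, which is in [X3] or is [h]; all
     of these are below [l']. *)
  left; exists X3, X2; split=> //; apply/allP => x xX3; rewrite aN.
  have xl : x != l.
    apply: contraTneq xX3 => ->; move: un => /= /andP[_]; rewrite cat_uniq => /and3P[_ _] /= /andP[+ _].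
    by rewrite mem_cat inE !negb_or => /and3P[].
  have xh : x != h.
    apply: contraTneq xX3 => ->; move: un => /= /andP[+ _].
    by rewrite mem_cat inE mem_cat inE !negb_or => /and5P[].
  rewrite /= glue_opp_out //.
  have pth : fpath (@face_next M) l' (rcons X3 h).
    move: path_all; rewrite rcons_cat cat_path rcons_cons rcons_cat => /andP[_] /= /andP[_].
    by rewrite cat_path /= => /andP[_ /andP[]].
  have := fpath_next pth xX3; rewrite mem_rcons inE.
  have <- := anc_vertexr l' (vertex_face (ccw_inj rM) x).
  by case/orP => [/eqP->//|/(allP aX3)].
have al'l : anc l' l by case: (anc_total rM al al') => // h1; rewrite h1 in nall'.
have dl : dep l' < dep l.
  by rewrite ltnNge; apply: contra vll' => /(anc_dep_eq rM al'l)->.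
have aX1 : all (anc l) X1.
  have [P [Q [PQ aPQ]]] := prM l ol lh; have [eP eQ] := nk _ _ _ _ _ PQ tl_pos.
  case: aPQ => [|/allP/(_ l')]; first by rewrite eP => /andP[].
  rewrite eQ mem_cat mem_head !orbT => /(_ isT).
  by move/(anc_dep rM); rewrite leqNgt dl.
exists l', l; cbv zeta; set N := (GrowingMap _).
have oN : orbit (@face_next N) l = l :: X2 ++ l' :: X1.
  exact: (orbit_glue2 gM ol' oE).
have aN := glue_anc bM oh ol'.
have gN : @good N l dep.
  apply: (good_glue gM ol' ol l'h lh dl al'l).
  - by exists k0.
  - move=> k ok kh; case: (legs k ok kh) => [->|->//|kX]; first exact: anc_refl rM _.
    have [A [B [_ [/allP aA|/allP aB]]]] := prel k kX ok kh.
      by apply: aA; rewrite inE mem_cat mem_head !orbT.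
    apply: (anc_trans rM (aB l' _) al'l).
    by rewrite mem_cat mem_head orbT.
  - move=> k ok kh kl; rewrite fconnect_orbit oN.
    case: (legs k ok kh) => [->|e|kX]; [exact: mem_head | by rewrite e eqxx in kl |].
    by rewrite inE mem_cat kX !orbT.
split.
- by rewrite /phi_c E last_rcons (negbTE vll') -/(anc l l') (negbTE nall') -/(anc l' l) al'l.
- split=> // k ok kl; have [ok' kh kl'] := glue_leg l'h ok.
  case: (legs k ok' kh) => [e|e|kX]; [by rewrite e eqxx in kl | by rewrite e eqxx in kl' |].
  have [A [B [XE aAB]]] := prel k kX ok' kh.
  have akl : @anc M k l by have := good_anc gN ok; rewrite aN.
  exists (l :: A), (B ++ l' :: X1); rewrite oN XE; split; first by rewrite /= -catA.
  case: aAB => [aA|aB]; [left | right].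
    move: aA; rewrite /= all_cat /= => /and4P[_ _ kl0 /allP aA].
    by rewrite aN akl; apply/allP => z zA; rewrite aN aA.
  move: aB; rewrite !all_cat /= => /and3P[/allP aB kl'0 _].
  rewrite aN kl'0 /=; apply/andP; split; first by apply/allP => z zB; rewrite aN aB.
  by apply/allP => z /(allP aX1) lz; rewrite aN (anc_trans rM akl lz).
- rewrite /= size_rcons -fX2 /tour_legs /= oN /= eqxx andbF filter_cat.
  have nl : is_leg (M := N) l' = false by rewrite /is_leg /= glue_opp_s eq_sym (negbTE l'h).
  rewrite /= nl /=.
  have -> : [seq x <- X1 | is_leg (M := N) x & x != l] = [::].
    apply/eqP; rewrite -[_ == _]negbK -has_filter; apply/negP => /hasP[x xX1 /andP[/eqP ox xl']].
    have [ox' xh _] := glue_leg l'h ox.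
    by case/hasP: nX1; exists x => //=; rewrite /is_leg ox' eqxx.
  rewrite cats0 addn2; congr _.+2.
  rewrite size_filter size_filter; apply: eq_in_count => x xX2 /=.
  have [xl xl' xh] : [/\ x != l, x != l' & x != h].
    split.
    + apply: contraTneq xX2 => ->; move: un => /= /andP[_]; rewrite cat_uniq => /and3P[_ _].
      by rewrite /= mem_cat negb_or => /andP[/andP[]].
    + apply: contraTneq xX2 => ->; move: un => /= /andP[_]; rewrite cat_uniq => /and3P[_ _] /= /andP[_].
      by rewrite cat_uniq /= negb_or => /and3P[_ /andP[]].
    apply: contraTneq xX2 => ->; move: un => /= /andP[+ _].
    by rewrite mem_cat inE mem_cat !negb_or => /and4P[].
  by rewrite /is_leg /= glue_opp_out // xl xh !andbT.
- by split=> // k; apply: uniq_leg.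
split=> /=.
- exact: (leg_notin_tree bM oh).
- by rewrite aN glue_opp_h.
- by rewrite aN glue_opp_h; apply/negP => /(anc_dep rM); rewrite leqNgt dl.
(* Here the new tour ends with the other half of the glued edge followed by [X1], which is below the
   new head: the exit is found backwards. *)
right; exists X1, X2; split; first by rewrite glue_opp_h oN.
by apply/allP => z /(allP aX1) lz; rewrite aN.
Qed.

(** * Isomorphisms and injectivity *)

Definition nab (w : seq letter) := count_mem La w + count_mem Lb w.
Definition nc (w : seq letter) := count_mem Lc w.

(** [phi_word] reads from the right and meets suffixes; in a balanced word the condition on prefixes
    turns into this one. *)
Fixpoint suffix_ok (w : seq letter) :=
  if w is _ :: w' then (2 * nc w <= nab w) && suffix_ok w' else true.

Lemma nab_cat w w' : nab (w ++ w') = nab w + nab w'.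
Proof. by rewrite /nab !count_cat; lia. Qed.
Lemma nc_cat w w' : nc (w ++ w') = nc w + nc w'.
Proof. exact: count_cat. Qed.

Lemma excursionP w : excursion w <-> suffix_ok w /\ nab w = 2 * nc w.
Proof.
have sokP v : suffix_ok v <-> forall w1 w2, v = w1 ++ w2 -> 2 * nc w2 <= nab w2.
  split=> [|H].
    elim: v => [_|l v IH /andP[le /IH {}IH]] [|l1 w1] w2 //=; first by move=> <-.
      by move=> <-.
    by case=> _; apply: IH.
  elim: v H => // l v IH H; apply/andP; split; first exact: (H [::]).
  by apply: IH => w1 w2 vE; apply: (H (l :: w1)); rewrite vE.
split=> [[pr eq]|[/sokP ok eq]].
  split=> //; apply/sokP => w1 w2 wE; have := pr w1; rewrite wE prefix_prefix => /(_ isT).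
  by move: eq; rewrite -/(nab w) -/(nc w) wE nab_cat nc_cat -/(nab w1) -/(nc w1); lia.
split=> // w1 /prefixP[w2 wE]; have := ok _ _ wE.
by move: eq; rewrite wE nab_cat nc_cat -/(nab w1) -/(nc w1); lia.
Qed.

Lemma size_nab w : size w = nab w + nc w.
Proof.
rewrite /nab /nc; elim: w => //= l w ->.
have E x y : (x == y :> letter) = match x, y with La, La | Lb, Lb | Lc, Lc => true | _, _ => false end.
  by apply/eqP; case: x; case: y.
by case: l; rewrite !E /=; lia.
Qed.

Lemma letter_counts (l : letter) w :
  nab (l :: w) = (if l is Lc then 0 else 1) + nab w /\
  nc (l :: w) = (if l is Lc then 1 else 0) + nc w.
Proof.
have E x y : (x == y :> letter) = match x, y with La, La | Lb, Lb | Lc, Lc => true | _, _ => false end.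
  by apply/eqP; case: x; case: y.
by rewrite /nab /nc /=; case: l; rewrite !E /=; lia.
Qed.

Lemma card_new_hedge : #|{: new_hedge}| = 3.
Proof.
have -> : #|{: new_hedge}| = #|[set NewTail; NewHead; NewLeg]|.
  by rewrite -cardsT; apply: eq_card => x; rewrite !inE; case: x; rewrite eqxx ?orbT.
by rewrite -setUA cardsU1 cards2 !inE negb_or; do 3 (case: eqP => //).
Qed.

Lemma tour_M0 : tour_legs M0 = [:: false].
Proof.
rewrite /tour_legs; have -> : orbit (@face_next M0) (head_he M0) = [:: true; false].
  exact: orbit_cycle.
by [].
Qed.

(** Growing adds one leg and gluing uses up two, so there are 1 + nab w - 2 nc w legs besides the
    head. The condition on a suffix that starts with [Lc] thus says exactly that three legs were
    available. *)
Lemma phi_word_valid w : suffix_ok w -> exists (N : growing_map) (dep : hedge N -> nat),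
  [/\ phi_word w M0 = Some N, valid dep, size (tour_legs N) + 2 * nc w = (nab w).+1
    & #|hedge N| = 3 * nab w + 2].
Proof.
elim: w => [_|l w IH /andP[le /IH[N [dep [wN vN szN cN]]]]].
  by exists M0, dep0; split=> //; [apply: M0_inv | rewrite tour_M0 | rewrite card_bool].
have [ea ec] := letter_counts l w; rewrite ea ec in le *; rewrite /= wN /=.
case: l le {ea ec} => le.
- have [vG sG] := grow_inv (or_introl erefl) vN.
  exists (phi_a N), (grow_dep dep); split=> //; first by rewrite sG; lia.
  by rewrite card_sum card_new_hedge cN; lia.
- have [vG sG] := grow_inv (or_intror erefl) vN.
  exists (phi_b N), (grow_dep dep); split=> //; first by rewrite sG; lia.
  by rewrite card_sum card_new_hedge cN; lia.
have [|s [t [eN vG sG _ _]]] := phi_c_inv vN; first by lia.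
exists (@GrowingMap (@glue N (head_he N) s) t), dep; split.
- exact: eN.
- exact: vG.
- by lia.
- by rewrite /= cN; lia.
Qed.

Definition tiso (M N : tree_map) (f : hedge M -> hedge N) :=
  [/\ bijective f, forall h, f (ccw h) = ccw (f h), forall h, f (opp h) = opp (f h),
      f (root_he M) = root_he N & forall h, (f h \in tree N) = (h \in tree M)].

Definition giso (M N : growing_map) (f : hedge M -> hedge N) :=
  tiso f /\ f (head_he M) = head_he N.

Lemma tiso_comp (M N P : tree_map) (f : hedge M -> hedge N) (g : hedge N -> hedge P) :
  tiso f -> tiso g -> tiso (g \o f).
Proof.
move=> [bf fc fo fr ft] [bg gc go gr gt]; split=> //=.
- exact: bij_comp.
- by move=> h; rewrite fc gc.
- by move=> h; rewrite fo go.
- by rewrite fr gr.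
- by move=> h; rewrite gt ft.
Qed.

Lemma tiso_can (M N : tree_map) (f : hedge M -> hedge N) g :
  cancel f g -> cancel g f -> tiso f -> tiso g.
Proof.
move=> fK gK [bf fc fo fr ft]; split.
- by exists f.
- by move=> h; apply: (can_inj fK); rewrite fc !gK.
- by move=> h; apply: (can_inj fK); rewrite fo !gK.
- by rewrite -fr fK.
- by move=> h; rewrite -ft gK.
Qed.

Section Tiso.
Variables (M N : tree_map) (f : hedge M -> hedge N).
Hypothesis fM : tiso f.

Lemma tiso_bij : bijective f. Proof. by case: fM. Qed.
Lemma tiso_ccw h : f (ccw h) = ccw (f h). Proof. by case: fM. Qed.
Lemma tiso_opp h : f (opp h) = opp (f h). Proof. by case: fM. Qed.
Lemma tiso_root : f (root_he M) = root_he N. Proof. by case: fM. Qed.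
Lemma tiso_tree h : (f h \in tree N) = (h \in tree M). Proof. by case: fM. Qed.
Lemma tiso_inj : injective f. Proof. exact: bij_inj tiso_bij. Qed.
Lemma tiso_face h : f (face_next h) = face_next (f h).
Proof. by rewrite /face_next tiso_ccw tiso_opp. Qed.

Lemma tiso_vertex x : vertex (f x) = f @: vertex x.
Proof.
have it n : iter n (@ccw N) (f x) = f (iter n (@ccw M) x).
  by elim: n => //= n ->; rewrite tiso_ccw.
apply/setP => z; apply/idP/imsetP => [|[y]]; rewrite inE => /fconnectP[n].
  by rewrite it => ->; exists (iter n (@ccw M) x); rewrite // inE fconnect_iter.
by move=> -> ->; rewrite inE -it fconnect_iter.
Qed.

Lemma tiso_vertex_eq x y : (vertex (f x) == vertex (f y)) = (vertex x == vertex y).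
Proof. by rewrite !tiso_vertex (inj_eq (imset_inj tiso_inj)). Qed.

Lemma tiso_leg x : (opp (f x) == f x) = (opp x == x).
Proof. by rewrite -tiso_opp (inj_eq tiso_inj). Qed.

Lemma tiso_ancestor u v : ancestor u v -> ancestor (f @: u) (f @: v).
Proof.
have rE : root_vertex N = f @: root_vertex M by rewrite -tiso_vertex tiso_root.
case/ancestorP => p /and3P[pth lst un] up; apply/ancestorP.
exists (map (fun A : {set _} => f @: A) p); last first.
  by rewrite rE -map_cons map_f.
rewrite /tree_path rE last_map (eqP lst) eqxx -map_cons map_inj_uniq ?un; last exact: imset_inj tiso_inj.
rewrite !andbT; elim: p (root_vertex M) pth {up lst un rE} => //= b p IH a /andP[/existsP[h]].
case/and3P => hT /eqP-> /eqP-> pth; rewrite IH // andbT.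
by apply/existsP; exists (f h); rewrite tiso_tree hT !tiso_vertex -tiso_opp tiso_vertex !eqxx.
Qed.

Hypothesis ci : injective (@ccw M).
Hypothesis oi : involutive (@opp M).

Lemma tiso_orbit x : orbit (@face_next N) (f x) = map f (orbit (@face_next M) x).
Proof.
have fi := face_inj ci oi; have [p xp] := orbit_cons (@face_next M) x.
have := cycle_orbit fi x; have := orbit_uniq (@face_next M) x; rewrite xp => up cp.
apply: orbit_cycle; last by rewrite -map_cons (map_inj_uniq tiso_inj).
have pth a q : fpath (@face_next N) (f a) (map f q) = fpath (@face_next M) a q.
  by elim: q a => //= b q IH a; rewrite IH -tiso_face (inj_eq tiso_inj).
by rewrite /= -map_rcons pth.
Qed.
End Tiso.

Lemma tiso_anc (M N : tree_map) (f : hedge M -> hedge N) x y : tiso f ->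
  anc (f x) (f y) = anc x y.
Proof.
move=> fM; case: (tiso_bij fM) => g fK gK; have gN := tiso_can fK gK fM.
apply/idP/idP; last by move=> /(tiso_ancestor fM); rewrite /anc !(tiso_vertex fM).
by move=> /(tiso_ancestor gN); rewrite /anc -!(tiso_vertex gN) !fK.
Qed.

Section Giso.
Variables (M N : growing_map) (f : hedge M -> hedge N).
Hypothesis gf : giso f.
Hypothesis ci : injective (@ccw M).
Hypothesis oi : involutive (@opp M).
Let fM : tiso f. Proof. by case: gf. Qed.
Let fh : f (head_he M) = head_he N. Proof. by case: gf. Qed.
Let fi := tiso_inj fM.

Lemma giso_tour : tour_legs N = map f (tour_legs M).
Proof.
rewrite /tour_legs -fh (tiso_orbit fM ci oi) filter_map; congr map.
by apply: eq_filter => x /=; rewrite /is_leg (tiso_leg fM) (inj_eq fi).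
Qed.

Lemma glue_tiso s : tiso (f : hedge (glue (head_he M) s) -> hedge (glue (head_he N) (f s))).
Proof.
case: fM => b c o r t; split=> //= x; rewrite /glue_opp -fh !(inj_eq fi).
by case: ifP => // _; case: ifP.
Qed.

Lemma giso_phi l M' : phi_letter l M = Some M' ->
  exists (N' : growing_map) (g : hedge M' -> hedge N'), phi_letter l N = Some N' /\ giso g.
Proof.
have grow_iso rho : exists (N' : growing_map) (g : hedge (grow rho M) -> hedge N'),
    Some (grow rho N) = Some N' /\ giso g.
  exists (grow rho N), (fun z => match z with inl x => inl (f x) | inr n => inr n end).
  split=> //; split=> //.
  case: (tiso_bij fM) => g fK gK; split.
  - by exists (fun z => match z with inl x => inl (g x) | inr n => inr n end) => -[x|x] //; rewrite ?fK ?gK.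
  - by case=> //= x; rewrite (tiso_ccw fM).
  - case=> [x|[||]] //=; rewrite -?fh //.
    by rewrite (inj_eq fi); case: ifP => // _; rewrite (tiso_opp fM).
  - by rewrite /= (tiso_root fM).
  - have mt (P : growing_map) (x : hedge P) : (inl x \in grow_tree P) = (x \in tree P) || (x == head_he P).
      by rewrite !inE orbF mem_imset // => ? ? [].
    case=> [x|x]; first by rewrite /= !mt (tiso_tree fM) -fh (inj_eq fi).
    by rewrite /= !inE /=; congr orb; apply/imsetP/imsetP => -[].
case: l => /=; try by case=> <-; apply: grow_iso.
rewrite /phi_c giso_tour; case: (tour_legs M) => [//|k ks] /=.
rewrite last_map (tiso_vertex_eq fM) -![ancestor (vertex (f _)) _]/(anc _ _) !(tiso_anc _ _ fM).
rewrite -![ancestor (vertex _) _]/(anc _ _).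
case: ifP => // _; case: ifP => [_ [<-]|_].
  exists (@GrowingMap (glue (head_he N) (f k)) (f (last k ks))), f.
  by split=> //; split=> //; apply: glue_tiso.
case: ifP => // _ [<-].
exists (@GrowingMap (glue (head_he N) (f (last k ks))) (f k)), f.
by split=> //; split=> //; apply: glue_tiso.
Qed.
End Giso.

Lemma cback_tiso (M N : tree_map) (f : hedge M -> hedge N) t h : tiso f ->
  injective (@ccw M) -> involutive (@opp M) -> cback t h -> cback (f t) (f h).
Proof.
move=> fM ci oi [hT oht nth]; have aE := tiso_anc _ _ fM.
rewrite /cback (tiso_tree fM) -(tiso_opp fM) !aE (tiso_orbit fM ci oi).
case=> -[X [Y [E al]]]; split=> //; [left | right]; exists (map f X), (map f Y);
rewrite E map_cons map_cat; split=> //; rewrite all_map; apply: sub_all al => x /=;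
by rewrite -?(tiso_opp fM) aE.
Qed.

(** In a given direction the first exit is determined. The two directions cannot both give external
    edges: at a vertex of degree three the parent half-edge is next to the head on one side, and on
    that side the walk leaves through it at once. *)
Lemma cback_uniq (N : tree_map) (dep : hedge N -> nat) t h h' :
  good t dep -> cback t h -> cback t h' -> h = h'.
Proof.
move=> gN; have bN := good_base gN; have rN := base_rooted bN; have ot := good_head gN.
have ci := ccw_inj rN; have oi := oppK rN; have fi := face_inj ci oi.
have ftE : face_next t = ccw t by rewrite /face_next ot.
pose cf k := exists X Y, orbit (@face_next N) t = t :: X ++ k :: Y /\
         all (fun x => anc t (opp x)) X.
pose cb k := exists X Y, orbit (@face_next N) t = t :: Y ++ opp k :: X /\ all (anc t) X.
have cfE k k' : ~~ anc t (opp k) -> ~~ anc t (opp k') -> cf k -> cf k' -> k = k'.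
  move=> nk nk' [X [Y [E1 aX]]] [X' [Y' [E2 aX']]]; move: E1; rewrite E2 => -[E].
  have fE Z W z : ~~ anc t (opp z) -> all (fun x => anc t (opp x)) Z ->
      ohead (filter (fun x => ~~ anc t (opp x)) (Z ++ z :: W)) = Some z.
    by move=> nz; elim: Z => [|a Z IH] /=; [rewrite nz | case/andP => -> /IH].
  by have := fE _ Y _ nk aX; rewrite -E fE // => -[].
have cbE k k' : ~~ anc t (opp k) -> ~~ anc t (opp k') -> cb k -> cb k' -> k = k'.
  move=> nk nk' [X [Y [E1 aX]]] [X' [Y' [E2 aX']]]; move: E1; rewrite E2 => -[E].
  have fE Z W z : ~~ anc t z -> all (anc t) Z ->
      last t (filter (fun x => ~~ anc t x) (W ++ z :: Z)) = z.
    move=> nz aZ; rewrite filter_cat last_cat /= nz.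
    have -> // : [seq x <- Z | ~~ anc t x] = [::].
    by rewrite -(filter_pred0 Z); apply: eq_in_filter => x /(allP aZ) ->.
  by have := fE _ Y _ nk aX; rewrite -E fE // => /(can_inj oi).
have noboth k k' : k \notin tree N -> k' \notin tree N -> anc (opp k) t -> ~~ anc t (opp k) ->
    cf k -> cb k' -> False.
  move=> kT kT' akt nkt [X [Y [E aX]]] [X' [Y' [E' aX']]].
  have dt : 0 < dep t.
    apply: leq_ltn_trans (leq0n (dep (opp k))) _; rewrite ltnNge; apply: contra nkt => le.
    by apply: (anc_eq rN); rewrite (anc_dep_eq rN akt le).
  have [u uu ut] := up_ex rN dt; have uT : u \in tree N by case/andP: uu.
  have nup : ~~ anc t (opp u).
    apply/negP => /(anc_dep rN); rewrite -(dep_vertex rN ut) (isup_dep rN uu); lia.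
  have cy := cycle_orbit fi t.
  have tu : u != t by apply: contraTneq uT => ->; apply: (leg_notin_tree bN).
  have n1 : ccw t <> u.
    move=> e; move: cy; rewrite E; case: X aX {E} => [|x X] /=.
      by rewrite ftE e => _ /andP[/eqP uk]; rewrite -uk uT in kT.
    by case/andP => ax _; rewrite ftE e => /andP[/eqP ux _]; rewrite ux ax in nup.
  have n2 : ccw u <> t.
    move=> e; have fu : face_next (opp u) = t by rewrite /face_next oi.
    move: cy; rewrite E' /= rcons_path => /andP[_]; rewrite last_cat /= -fu (inj_eq fi).
    case/lastP: X' aX' {E'} => [|X' x] /=.
      by move=> _ /eqP/(can_inj oi) ke; rewrite ke uT in kT'.
    by rewrite all_rcons last_rcons => /andP[ax _] /eqP xu; rewrite -xu ax in nup.
  have o3 : fingraph.order (@ccw N) t = 3.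
    by rewrite /fingraph.order; have := vertex_card t bN; rewrite eqn0Ngt dt /= cardsE.
  have : u \in vertex t by rewrite (mem_vertex ci) ut.
  have i3 := iter_order ci t; rewrite o3 /= in i3.
  rewrite inE fconnect_orbit /orbit o3 /= !inE (negbTE tu) /= => /orP[] /eqP e.
    by case: n1.
  by case: n2; rewrite e.
move=> [hT aht nht [c|c]] [hT' aht' nht' [c'|c']].
- exact: cfE c c'.
- by case: (noboth _ _ hT hT' aht nht c c').
- by case: (noboth _ _ hT' hT aht' nht' c' c).
- exact: cbE c c'.
Qed.

(** Another leg at the head-vertex is the trace of a growing step, and its side tells [La] from
    [Lb]. *)
Definition last_letter (M : growing_map) : letter :=
  if [exists l : hedge M, [&& opp l == l, l != head_he M & vertex l == vertex (head_he M)]]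
  then (if opp (ccw (head_he M)) == ccw (head_he M) then La else Lb) else Lc.

Lemma last_letter_giso (M N : growing_map) (f : hedge M -> hedge N) :
  giso f -> last_letter M = last_letter N.
Proof.
move=> [fM fh]; rewrite /last_letter -fh -(tiso_ccw fM) (tiso_leg fM).
have -> // : [exists l : hedge M, [&& opp l == l, l != head_he M & vertex l == vertex (head_he M)]]
  = [exists l : hedge N, [&& opp l == l, l != f (head_he M) & vertex l == vertex (f (head_he M))]].
case: (tiso_bij fM) => g fK gK; apply/existsP/existsP => -[l].
  by move=> h; exists (f l); rewrite (tiso_leg fM) (inj_eq (tiso_inj fM)) (tiso_vertex_eq fM).
move=> h; exists (g l); move: h; rewrite -{1 2 3 4}(gK l).
by rewrite (tiso_leg fM) (inj_eq (tiso_inj fM)) (tiso_vertex_eq fM).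
Qed.

(** The second conclusion separates nonempty words from the empty one, whose head is at the
    root-vertex. *)
Lemma last_letter_phi l (P M : growing_map) (dep : hedge P -> nat) : valid dep ->
  (l = Lc -> 2 < size (tour_legs P)) -> phi_letter l P = Some M ->
  last_letter M = l /\ vertex (head_he M) != root_vertex M.
Proof.
move=> vP sz; have [gP _] := vP.
have grow_case rho : rho = ccw_leg_left \/ rho = ccw_leg_right ->
    [exists l : hedge (grow rho P), [&& opp l == l, l != head_he (grow rho P) & vertex l == vertex (head_he (grow rho P))]]
    /\ vertex (head_he (grow rho P)) != root_vertex (grow rho P).
  move=> hr; have gr := grow_grows hr gP; have [vl vu] := grows_vertex_lu gr; split.
    apply/existsP; exists (inr NewLeg); rewrite vl !eqxx andbT /=; apply/eqP => //.
  by rewrite eq_sym /root_vertex (gr_root gr) (grows_vertex_new gr).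
case: l sz => sz /=.
- case=> <-; have [|e ->] := @grow_case ccw_leg_left; first by left.
  by rewrite /last_letter e /= eqxx.
- case=> <-; have [|e ->] := @grow_case ccw_leg_right; first by right.
  by rewrite /last_letter e /=.
have [s [t [-> vN _ [os sh lu] [hT a1 a2 _]] [<-]]] := phi_c_inv vP (sz erefl).
have [gN _] := vN; have rN := base_rooted (good_base gN).
split; last first.
  rewrite -(dep_root rN) /=; apply: contra a2 => /eqP d0.
  by apply: (anc_eq rN); rewrite (anc_dep_eq rN a1) //= d0.
rewrite /last_letter; case: existsP => // -[k /and3P[/eqP ok kt /eqP vk]].
by case/eqP: kt; apply: lu.
Qed.

(** The new half-edges are reached from the head by rotation, so the isomorphism respects them and
    restricts to the old ones. *)
Lemma giso_grow rho (P P' : growing_map) (dep : hedge P -> nat) (dep' : hedge P' -> nat)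
    (f : hedge (grow rho P) -> hedge (grow rho P')) :
  rho = ccw_leg_left \/ rho = ccw_leg_right ->
  good (head_he P) dep -> good (head_he P') dep' -> giso f ->
  exists g : hedge P -> hedge P', giso g.
Proof.
move=> hr gP gP' [fM fh]; have fi := tiso_inj fM.
have fr n : f (inr n) = inr n.
  have fl : f (inr (rho NewHead)) = inr (rho NewHead).
    by rewrite -[inr (rho NewHead)]/(@ccw (grow rho P) (inr NewHead)) (tiso_ccw fM) fh.
  have fl' : f (inr (rho (rho NewHead))) = inr (rho (rho NewHead)).
    by rewrite -[inr (rho (rho NewHead))]/(@ccw (grow rho P) (inr (rho NewHead))) (tiso_ccw fM) fl.
  by case: hr fl fl' => -> /= h1 h2; case: n.
have fE x : {y | f (inl x) = inl y}.
  case E: (f (inl x)) => [y|n]; first by exists y.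
  by move: E; rewrite -(fr n) => /fi.
pose g x := sval (fE x); have gE x : f (inl x) = inl (g x) by rewrite /g; case: (fE x).
have gi : injective g.
  move=> x y e; suff: inl x = inl y :> hedge (grow rho P) by case.
  by apply: fi; rewrite !gE e.
have gh : g (head_he P) = head_he P'.
  by have := tiso_opp fM (inr NewTail); rewrite fr /= gE => -[].
have mt (Q : growing_map) (x : hedge Q) : (inl x \in grow_tree Q) = (x \in tree Q) || (x == head_he Q).
  by rewrite !inE orbF mem_imset // => ? ? [].
exists g; split=> //; split.
- apply: inj_card_bij => //; have := bij_eq_card (tiso_bij fM).
  by rewrite !card_sum => /addIn ->.
- move=> x; by have := tiso_ccw fM (inl x); rewrite /= !gE /= => -[].
- move=> x; have := tiso_opp fM (inl x); rewrite /= gE /= -gh (inj_eq gi).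
  by case: eqP => [-> _|_]; [rewrite gh !(good_head gP) (good_head gP') | rewrite gE => -[]].
- by have := tiso_root fM; rewrite /= gE => -[].
move=> x; have := tiso_tree fM (inl x); rewrite /= gE !mt -gh (inj_eq gi).
have [->|] := eqVneq x (head_he P); last by rewrite !orbF.
rewrite gh (negbTE (leg_notin_tree (good_base gP) (good_head gP))).
by rewrite (negbTE (leg_notin_tree (good_base gP') (good_head gP'))).
Qed.

(** [cback] is preserved by isomorphisms and determines its half-edge, so the old heads correspond,
    and with them the legs they were glued to. *)
Lemma giso_phi_c (P P' N N' : growing_map) (dep : hedge P -> nat) (dep' : hedge P' -> nat)
    (f : hedge N -> hedge N') :
  valid dep -> valid dep' -> 2 < size (tour_legs P) -> 2 < size (tour_legs P') ->
  phi_c P = Some N -> phi_c P' = Some N' -> giso f ->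
  exists g : hedge P -> hedge P', giso g.
Proof.
move=> vP vP' sz sz' eN eN'.
have [s [t [e vN _ [os sh _] cb]]] := phi_c_inv vP sz.
have [s' [t' [e' vN' _ [os' sh' _] cb']]] := phi_c_inv vP' sz'.
move: eN eN'; rewrite e e' => -[eN] [eN'].
move: f; rewrite -eN -eN' => f [fM /= ft].
have [gN _] := vN; have [gN' _] := vN'; have rN := base_rooted (good_base gN).
have [gP _] := vP; have [gP' _] := vP'.
have oh := good_head gP; have oh' := good_head gP'.
have cbf := cback_tiso fM (ccw_inj rN) (oppK rN) cb.
rewrite ft in cbf; have fh := cback_uniq gN' cbf cb'.
have fs : f s = s'.
  by have := tiso_opp fM (head_he P); rewrite /= glue_opp_h => ->; rewrite fh glue_opp_h.
have fi := tiso_inj fM.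
exists f; split=> //; case: fM => b c o r tr; split=> // x.
have [->|xh] := eqVneq x (head_he P); first by rewrite oh fh oh'.
have [->|xs] := eqVneq x s; first by rewrite os fs os'.
have := o x; rewrite /= !glue_opp_out //; first by rewrite -fh (inj_eq fi).
by rewrite -fs (inj_eq fi).
Qed.

Lemma phi_word_inj w w' (M M' : growing_map) (f : hedge M -> hedge M') :
  suffix_ok w -> suffix_ok w' -> phi_word w M0 = Some M -> phi_word w' M0 = Some M' ->
  giso f -> w = w'.
Proof.
have step l v N : suffix_ok (l :: v) -> phi_word (l :: v) M0 = Some N ->
  exists (P : growing_map) (dep : hedge P -> nat), [/\ phi_word v M0 = Some P, valid dep,
    phi_letter l P = Some N & l = Lc -> 2 < size (tour_legs P)].
  case/andP => le /phi_word_valid[P [dep [eP vP sz _]]]; rewrite /= -/(phi_word v M0) eP /= => eN.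
  exists P, dep; split=> // lc; have [ea ec] := letter_counts l v.
  by move: le; rewrite ea ec lc; lia.
have vroot : vertex (head_he M0) = root_vertex M0 by apply: M0_vertex.
have rt (A B : growing_map) (k : hedge A -> hedge B) : giso k ->
    (vertex (head_he B) == root_vertex B) = (vertex (head_he A) == root_vertex A).
  by move=> [kA kh]; rewrite /root_vertex -kh -(tiso_root kA) (tiso_vertex_eq kA).
elim: w w' M M' f => [|l w IH] [|l' w'] M M' f ok ok' eM eM' gf //.
- have [P [dep [eP vP /(last_letter_phi vP) h /h [_]]]] := step _ _ _ ok' eM'.
  by rewrite (rt _ _ _ gf); case: eM => <-; rewrite vroot eqxx.
- have [P [dep [eP vP /(last_letter_phi vP) h /h [_]]]] := step _ _ _ ok eM.
  by rewrite -(rt _ _ _ gf); case: eM' => <-; rewrite vroot eqxx.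
have [P [dep [eP vP pl sz]]] := step _ _ _ ok eM.
have [P' [dep' [eP' vP' pl' sz']]] := step _ _ _ ok' eM'.
have [ll _] := last_letter_phi vP sz pl; have [ll' _] := last_letter_phi vP' sz' pl'.
have E : l = l' by rewrite -ll -ll'; apply: last_letter_giso gf.
rewrite -E in pl' sz' *; congr cons.
suff [g gg] : exists g : hedge P -> hedge P', giso g.
  by case/andP: ok => _ ok; case/andP: ok' => _ ok'; apply: IH gg.
have [gP _] := vP; have [gP' _] := vP'.
case: l sz sz' pl pl' {IH ok eM ll E} => sz sz' /=.
- move=> [eN] [eN']; move: f gf; rewrite -eN -eN' => f gf.
  by apply: giso_grow gP gP' gf; left.
- move=> [eN] [eN']; move: f gf; rewrite -eN -eN' => f gf.
  by apply: giso_grow gP gP' gf; right.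
by move=> pl pl'; apply: giso_phi_c vP vP' (sz erefl) (sz' erefl) pl pl' gf.
Qed.

(** * Undoing a step and surjectivity *)

Section Exit.
Variables (M : tree_map) (dep : hedge M -> nat) (t : hedge M).
Hypothesis gM : good t dep.
Hypothesis alone : forall l, opp l = l -> vertex l = vertex t -> l = t.

Let bM := good_base gM.
Let rM := base_rooted bM.
Let ci := ccw_inj rM.
Let oi := oppK rM.
Let ot := good_head gM.

(** At the root-vertex, the other leg, being an ancestor of the head, would share its vertex. *)
Lemma alone_dep : 0 < dep t.
Proof.
rewrite lt0n; apply/negP; rewrite (dep_root rM) => /eqP tr.
have [l ol lt] := good_leg gM; have := good_anc gM ol.
by rewrite (anc_rootv rM _ tr) => /eqP /(alone ol) e; rewrite e eqxx in lt.
Qed.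

Lemma alone_third : exists u d, [/\ isup dep u, vertex t = [set t; u; d], opp d != d, uniq [:: t; u; d]
  & [/\ ccw t = d, ccw d = u & ccw u = t] \/ [/\ ccw t = u, ccw u = d & ccw d = t]].
Proof.
have [u uu ut] := up_ex rM alone_dep; have uT : u \in tree M by case/andP: uu.
have tu : u != t by apply: contraTneq uT => ->; apply: (leg_notin_tree bM).
have o3 : fingraph.order (@ccw M) t = 3.
  by rewrite /fingraph.order; have := vertex_card t bM; rewrite eqn0Ngt alone_dep /= cardsE.
have i3 := iter_order ci t; rewrite o3 /= in i3.
have vE : vertex t =i [:: t; ccw t; ccw (ccw t)].
  by move=> x; rewrite inE fconnect_orbit /orbit o3.
have un : uniq [:: t; ccw t; ccw (ccw t)] by have := orbit_uniq (@ccw M) t; rewrite /orbit o3.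
have leg d : d \in vertex t -> d != t -> opp d != d.
  by rewrite (mem_vertex ci) => /eqP dv; apply: contraNneq => /alone ->.
have tn : t != ccw t /\ t != ccw (ccw t) by move: un; rewrite /= !inE negb_or => /andP[/andP[]].
case: tn => tn1 tn2.
have : u \in vertex t by rewrite (mem_vertex ci) ut.
rewrite vE !inE (negbTE tu) /= => /orP[] /eqP uE.
  exists u, (ccw (ccw t)); rewrite uE; split=> //; first by rewrite -uE.
  - by apply/setP => x; rewrite vE !inE orbA.
  - by apply: leg; rewrite ?vE ?inE ?eqxx ?orbT // eq_sym.
  - by right.
exists u, (ccw t); rewrite uE; split=> //; first by rewrite -uE.
- by apply/setP => x; rewrite vE !inE -orbA; congr orb; rewrite orbC.
- by apply: leg; rewrite ?vE ?inE ?eqxx ?orbT // eq_sym.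
- by move: un; rewrite /= !inE !negb_or !andbT => /andP[/andP[-> ->]]; rewrite eq_sym.
- by left.
Qed.

(* The rotation [c'] is [ccw] or its inverse, so that the exit is sought forwards
   or backwards along the head-face. *)
Lemma first_exit (c' : hedge M -> hedge M) u d :
  injective c' -> (forall x, vertex (c' x) = vertex x) ->
  (forall L : hedge M -> {set hedge M}, (forall x, L (c' x) = L x) -> forall x, L (ccw x) = L x) ->
  norb c' = norb (@ccw M) -> norb (c' \o @opp M) = norb (@face_next M) ->
  isup dep u -> vertex t = [set t; u; d] -> opp d != d -> uniq [:: t; u; d] ->
  c' t = d -> c' d = u -> c' u = t ->
  exists h X Y, [/\ orbit (c' \o @opp M) t = t :: X ++ h :: Y, h \notin tree M,
    anc t h, ~~ anc t (opp h) & all (anc t) X].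
Proof.
move=> ci' cv cL Vc Fc uu vt od un ct cd cu; set f := c' \o @opp M.
have fi : injective f by move=> a b /= /ci' /(can_inj oi).
have [tu td ud] : [/\ t != u, t != d & u != d].
  by move: un; rewrite /= !inE !negb_or andbT => /andP[/andP[-> ->]].
have uT : u \in tree M by case/andP: uu.
have tT : t \notin tree M by apply: (leg_notin_tree bM).
have vin x : x \in [:: t; u; d] -> vertex x = vertex t.
  by move=> xin; apply/eqP; rewrite -(mem_vertex ci) vt !inE -orbA; move: xin; rewrite !inE.
have ut : vertex u = vertex t by apply: vin; rewrite !inE eqxx orbT.
have dt : vertex d = vertex t by apply: vin; rewrite !inE eqxx !orbT.
have ft : f t = d by rewrite /f /= ot ct.
have fou : f (opp u) = t by rewrite /f /= oi cu.
have fod : f (opp d) = u by rewrite /f /= oi cd.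
have vf x : vertex (f x) = vertex (opp x) by rewrite /f /= cv.
have nou : ~~ anc t (opp u).
  by apply/negP => /(anc_dep rM); rewrite -(dep_vertex rM ut) (isup_dep rM uu) ltnn.
have ouO : opp u \in orbit f t.
  by rewrite -fconnect_orbit (fconnect_sym fi); apply: connect1; rewrite /= fou.
(* The tour does leave the subtree of [t]: it contains [opp u], which is at the parent and has [t]
   as its successor. *)
have [z [P [W [OE hP nz]]]] : exists z P W,
    [/\ orbit f t = P ++ z :: W, all (anc t) P & ~~ anc t z].
  case E: (filter (fun x => ~~ anc t x) (orbit f t)) => [|z W].
    have : opp u \in filter (fun x => ~~ anc t x) (orbit f t) by rewrite mem_filter nou.
    by rewrite E.
  have [P [W' [OE hP _]]] := filter_cons_split E; exists z, P, W'; split=> //.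
    by apply/allP => x xP; apply: contraNT hP => nx; apply/hasP; exists x.
  have : z \in filter (fun x => ~~ anc t x) (orbit f t) by rewrite E mem_head.
  by rewrite mem_filter => /andP[].
have [O1 tO] := orbit_cons f t; have cy := cycle_orbit fi t.
case: P OE hP => [|t' P1] OE.
  by move: OE; rewrite tO => -[tz _] _; rewrite -tz (anc_refl rM) in nz.
move: (OE); rewrite {1}tO => -[tt' _]; rewrite -{}tt' in OE; move=> /= /andP[_ hP].
case/lastP: P1 OE hP => [|X h] OE hP.
  move: cy; rewrite OE /= => /andP[/eqP fz _].
  by rewrite -fz ft -(anc_vertexr _ (esym dt)) (anc_refl rM) in nz.
move: hP; rewrite all_rcons => /andP[ath aX].
have pth : fpath f t (rcons X h).
  by move: cy; rewrite OE /= rcons_cat cat_path => /andP[].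
have fh : f h = z.
  by move: cy; rewrite OE /= rcons_cat cat_path last_rcons => /andP[_ /= /andP[/eqP]].
have noh : ~~ anc t (opp h) by rewrite -(anc_vertexr _ (vf h)) fh.
exists h, X, (z :: W); split=> //; first by rewrite OE /= cat_rcons.
(* A tree edge that leaves the subtree can only be [u]. The tour then starts from [t] with [d] and
   comes back by [u], the successor of [opp d], which puts both sides of the edge of [d] in one
   face. *)
apply/negP => hT.
have hu : h = u.
  by apply: (tree_exit_up rM uu) => //; rewrite (anc_vertexl _ ut).
rewrite {h hT ath fh noh}hu in OE pth.
have dX : d \in X.
  case: X OE pth aX => [|x X] OE /= /andP[/eqP]; rewrite ft => dx _ _.
    by rewrite dx eqxx in ud.
  by rewrite dx mem_head.
have fdX := fpath_next pth dX.
have atf : anc t (f d).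
  move: fdX; rewrite mem_rcons inE => /orP[/eqP->|/(allP aX)//].
  by rewrite (anc_vertexr _ ut) (anc_refl rM).
have atod : anc t (opp d) by rewrite -(anc_vertexr _ (vf d)).
have dT : d \in tree M.
  have vod : vertex t != vertex (opp d).
    apply/eqP => e; have : opp d \in vertex t by rewrite (mem_vertex ci) e.
    rewrite vt !inE (negbTE od) orbF => /orP[] /eqP e'.
      by case/eqP: td; rewrite -ot -e' oi.
    move: nou; rewrite -e' oi; apply/negP; rewrite negbK.
    by rewrite (anc_vertexr _ dt) (anc_refl rM).
  have [k [ku kt _]] := anc_child rM atod vod.
  have kT : opp k \in tree M by case/andP: ku => /(tree_opp rM).
  have : opp k \in vertex t by rewrite (mem_vertex ci) kt.
  rewrite vt !inE => /orP[/orP[]|] /eqP e.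
  - by rewrite e (negbTE tT) in kT.
  - by move: (isup_opp rM ku); rewrite e uu.
  - by rewrite -e.
have odu : isup dep (opp d).
  case: (tree_isup rM dT) => // du.
  by have := up_uniq rM uu du; rewrite ut dt => /(_ erefl) e; rewrite e eqxx in ud.
have fcd : fconnect f (opp d) d.
  apply: (@connect_trans _ _ t); last by rewrite -ft fconnect1.
  rewrite (fconnect_sym fi) fconnect_orbit.
  have : u \in orbit f t by rewrite OE /= cat_rcons inE mem_cat mem_head !orbT.
  by rewrite -!fconnect_orbit => h1; apply: connect_trans h1 _; rewrite (fconnect_sym fi); apply: connect1; rewrite /= fod.
(* The edge above [opp d] is covered and not merely waiting, since [opp d] is strictly below the
   head [t]. *)
have [y [yT ody dy]] : exists y, [/\ y \notin tree M, anc (opp d) y & dep (opp y) < dep (opp d)].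
  have [|[y [yT h1 _ h3]]|[a _]] := good_cov gM (x := opp d); first by rewrite (isup_dep rM odu).
    by exists y.
  by have := anc_dep rM a; rewrite -(dep_vertex rM dt) (isup_dep rM odu) oi ltnn.
have conn (L : hedge M -> {set hedge M}) : (forall x, L (c' x) = L x) ->
    (forall x, L (cut_opp d x) = L x) -> forall x, L x = L t.
  move=> Lc Lo; have L1 := cL L Lc.
  suff H : forall x, L x = L (root_he M) by move=> x; rewrite H -(H t).
  apply: (tree_label_cut rM L1 odu (y := y)) => //.
    by move=> x xT xod xd; rewrite oi in xd; rewrite -[RHS]Lo cut_opp_out.
  rewrite -[RHS]Lo cut_opp_out //; apply: contraNneq yT => -> //.
  exact: (tree_opp rM).
have := euler_cubic ci' (@cut_oppK M dep d bM) (etrans (congr1 _ Vc) (near_cubic_card ci (base_cubic bM))) conn.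
have -> : norb (c' \o cut_opp d) = (norb (@face_next M)).+1.
  have := @norb_swap _ f (c' \o cut_opp d) d (opp d) fi.
  rewrite fcd eq_sym od addn0 addn1 -Fc; apply.
  by move=> x; rewrite /f /= [in RHS](@cut_oppE M dep d bM) tpermK.
have := nonlegs_cut bM od; rewrite {2}/nonlegs /= => nE.
have := base_euler bM; rewrite /euler_count nE.
by move: #|_| (norb _) #|_| {nE} => a b c; clear; lia.
Qed.

End Exit.

Section Uncut.
Variables (M : tree_map) (dep : hedge M -> nat) (t : hedge M).
Hypothesis gM : good t dep.
Hypothesis alone : forall l, opp l = l -> vertex l = vertex t -> l = t.

Let bM := good_base gM.
Let rM := base_rooted bM.
Let ci := ccw_inj rM.
Let oi := oppK rM.
Let ot := good_head gM.
Let fi : injective (@face_next M) := face_inj ci oi.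

(** The rotation at [t] decides the direction: the walk starts on the side of the half-edge that is
    not the parent one. Walking backwards is walking forwards for the inverse rotation. *)
Lemma exit_edge : exists h X Y,
  [/\ h \notin tree M, anc t h, ~~ anc t (opp h), forall x, x \in X -> opp x != x
   & orbit (@face_next M) t = t :: X ++ h :: Y \/
     orbit (@face_next M) t = t :: Y ++ opp h :: X].
Proof.
have noleg X h Y f : orbit f t = t :: X ++ h :: Y -> all (anc t) X ->
    forall x, x \in X -> opp x != x.
  move=> E /allP aX x xX; apply/eqP => ox.
  (* A leg of the walk would be both above and below [t], hence at its vertex, where [t] is the only
     leg. *)
  have vx : vertex x = vertex t.
    by apply: (anc_dep_eq rM (good_anc gM ox)); apply: (anc_dep rM (aX _ xX)).
  have := orbit_uniq f t; rewrite E /= mem_cat -(alone ox vx) xX //.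
have [u [d [uu vt od un [[e1 e2 e3]|[e1 e2 e3]]]]] := alone_third gM alone.
  have [h [X [Y [E hT ath noh aX]]]] := first_exit gM ci (vertex_ccw ci)
    (fun _ Lc => Lc) erefl erefl uu vt od un e1 e2 e3.
  by exists h, X, Y; split=> //; [apply: noleg E aX | left].
pose c' := finv (@ccw M); have ci' : injective c' := finv_inj ci.
have cv x : vertex (c' x) = vertex x by rewrite -{2}(f_finv ci x) (vertex_ccw ci).
have cL (L : hedge M -> {set hedge M}) : (forall x, L (c' x) = L x) -> forall x, L (ccw x) = L x.
  by move=> Lc x; rewrite -[LHS]Lc /c' finv_f.
have [c1 c2 c3] : [/\ c' t = d, c' d = u & c' u = t].
  by split; [rewrite -e3 | rewrite -e2 | rewrite -e1]; apply: finv_f.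
have [h [X [Y [E hT ath noh aX]]]] := first_exit gM ci' cv cL (norb_finv ci)
  (norb_finv_comp ci oi) uu vt od un c1 c2 c3.
exists h, (rev (map (@opp M) X)), (rev (map (@opp M) Y)); split=> //.
  move=> x; rewrite mem_rev => /mapP[y yX ->]; rewrite oi eq_sym; exact: noleg E aX _ yX.
(* Taking opposites and reversing turns a cycle of the inverse rotation composed with [opp] into a
   cycle of [face_next]. *)
right; set Z := t :: _; have ZE : Z = t :: rev (map (@opp M) (X ++ h :: Y)).
  by rewrite /Z map_cat map_cons rev_cat rev_cons cat_rcons.
have cy := cycle_orbit (inj_comp ci' (can_inj oi)) t; rewrite E in cy.
have un' := orbit_uniq (c' \o @opp M) t; rewrite E in un'.
have ZE' : rot 1 Z = rev (map (@opp M) (t :: X ++ h :: Y)).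
  by rewrite ZE rot1_cons /= rev_cons ot.
apply: orbit_cycle; rewrite -/Z.
  rewrite -(rot_cycle 1) ZE' rev_cycle cycle_map; apply: sub_cycle cy => x y /= /eqP <-.
  by rewrite /face_next oi /c' f_finv.
by rewrite -(rot_uniq 1) ZE' rev_uniq (map_inj_uniq (can_inj oi)).
Qed.

End Uncut.

(** Only one side of the exit edge is in the head-face, so the other face brings no legs, and none
    lie between the head and the exit. Hence [s] and [t] become the first and last legs, with [s]
    strictly above [t]; the leg that [good_leg] provides is the third one. *)
Lemma uncut (M : growing_map) (dep : hedge M -> nat) : good (head_he M) dep ->
  (forall l, opp l = l -> vertex l = vertex (head_he M) -> l = head_he M) ->
  exists h : hedge M, let P := @GrowingMap (@cut M h) h in
  [/\ opp h != h, @good P h dep, 2 < size (tour_legs P)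
    & phi_c P = Some (@GrowingMap (@glue (@cut M h) h (opp h)) (head_he M))].
Proof.
move=> gM alone; set t := head_he M in gM alone *.
have bM := good_base gM; have rM := base_rooted bM.
have ci := ccw_inj rM; have oi := oppK rM; have ot := good_head gM.
have fi : injective (@face_next M) := face_inj ci oi.
have fsym := fconnect_sym fi.
have [h [X [Y [hT ath noh nX cases]]]] := exit_edge gM alone.
have [ast dst] := ext_exit_covered rM (base_cmp bM) ath noh hT.
set s := opp h in noh ast dst cases *.
have oh : opp h != h by apply: contraNneq noh => e; rewrite /s e.
have diff : ~~ fconnect (@face_next M) s h := cut_ext_faces bM oh hT.
have ash : anc s h := anc_trans rM ast ath.
have dt : 0 < dep t := alone_dep gM alone.
have hr : h != root_he M.
  apply: contraTneq (anc_dep rM ath) => ->; rewrite -ltnNge; have := dep_root rM (root_he M).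
  by rewrite eqxx => /eqP->.
have ths : fconnect (@face_next M) h t || fconnect (@face_next M) s t.
  rewrite [fconnect _ h t]fsym [fconnect _ s t]fsym !fconnect_orbit.
  by case: cases => ->; rewrite !(inE, mem_cat) eqxx !orbT.
have gP : @good (cut h) h dep.
  apply: (good_cut bM oh hT) => //.
  - by move=> l ol; apply: (anc_trans rM (good_anc gM ol)).
  - move=> l ol; have tl := good_face gM ol.
    by case/orP: ths => ht; rewrite (connect_trans ht tl) ?orbT.
  move=> x /(good_cov gM)[c|[xt ex]]; [by left | right].
  by split=> //; apply: (anc_trans rM xt).
have th : t != h by apply: contraNneq oh => <-; rewrite ot.
have ts : t != s by apply: contraTneq dst => <-; rewrite ltnn.
pose p := [pred x : hedge M | is_leg (M := cut h) x && (x != h)].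
have pt : p t by rewrite /= /is_leg /= cut_opp_out // ot eqxx.
have ps : p s by rewrite /= /is_leg /= cut_opp_s eqxx.
have pE k : p k -> k != s -> opp k = k.
  case/andP => /eqP ok kh ks; case: (cut_opp_leg (ok : cut_opp h k = k)) => // e.
    by rewrite e eqxx in kh.
  by rewrite e eqxx in ks.
have pV k : opp k = k -> p k.
  move=> ok; have kh : k != h by apply: contraNneq oh => <-; rewrite ok.
  rewrite /= kh andbT /is_leg /= cut_opp_out ?ok //.
  by apply: contraNneq oh => e; rewrite -[X in _ == X]oi -e ok.
have nof Z : (forall k, k \in Z -> p k -> False) -> filter p Z = [::].
  move=> H; rewrite -(filter_pred0 Z); apply: eq_in_filter => k kZ.
  by apply/negP => /(H _ kZ).
have fc a Z : filter p (a :: Z) = if p a then a :: filter p Z else filter p Z by [].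
have tE Q : orbit (@face_next (cut h)) h = h :: Q ->
    tour_legs (@GrowingMap (cut h) h) = filter p Q.
  by move=> oQ; rewrite /tour_legs /= oQ /= eqxx andbF.
have [l0 ol0 l0t] := good_leg gM.
have l0h : l0 != h by apply: contraNneq oh => <-; rewrite ol0.
have l0s : l0 != s by apply: contraNneq oh => e; rewrite -[X in _ == X]oi -/s -e ol0.
have l0X : l0 \notin X by apply/negP => /nX; rewrite ol0 eqxx.
have vst : vertex s != vertex t by apply: contraTneq dst => /(dep_vertex rM)->; rewrite ltnn.
have nts : ~~ anc t s by [].
have caE := cut_anc bM hT.
exists h; cbv zeta; split=> //; rewrite -/s.
- case: cases => oE.
    have oh' : orbit (@face_next M) h = h :: Y ++ t :: X.
      have := cycle_orbit fi t; have := orbit_uniq (@face_next M) t; rewrite oE => un cy.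
      have E : h :: Y ++ t :: X = rot (size (t :: X)) ((t :: X) ++ h :: Y) by rewrite rot_size_cat.
      by apply: orbit_cycle; rewrite E ?rot_cycle ?rot_uniq.
    have [X1 os'] := orbit_cons (@face_next M) s.
    have l0Y : l0 \in Y.
      have := good_face gM ol0; rewrite fconnect_orbit oE inE (negbTE l0t) mem_cat (negbTE l0X) /=.
      by rewrite inE (negbTE l0h).
    rewrite (tE _ (orbit_cut bM oh hT oh' os')) -/s !(filter_cat, fc, ps, pt).
    rewrite size_cat /= size_cat /=.
    have : 0 < size (filter p Y) by rewrite size_filter -has_count; apply/hasP; exists l0 => //; apply: pV.
    by clear; lia.
  have os' : orbit (@face_next M) s = s :: X ++ t :: Y.
    have := cycle_orbit fi t; have := orbit_uniq (@face_next M) t; rewrite oE => un cy.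
    have E : s :: X ++ t :: Y = rot (size (t :: Y)) ((t :: Y) ++ s :: X) by rewrite rot_size_cat.
    by apply: orbit_cycle; rewrite E ?rot_cycle ?rot_uniq.
  have [X1 oh'] := orbit_cons (@face_next M) h.
  have l0Y : l0 \in Y.
    have := good_face gM ol0; rewrite fconnect_orbit oE inE (negbTE l0t) mem_cat /=.
    by rewrite in_cons (negbTE l0s) (negbTE l0X) !orbF.
  rewrite (tE _ (orbit_cut bM oh hT oh' os')) -/s !(filter_cat, fc, ps, pt).
  rewrite !size_cat /=.
  have : 0 < size (filter p Y) by rewrite size_filter -has_count; apply/hasP; exists l0 => //; apply: pV.
  by clear; lia.
rewrite /phi_c; case: cases => oE.
  have oh' : orbit (@face_next M) h = h :: Y ++ t :: X.
    have := cycle_orbit fi t; have := orbit_uniq (@face_next M) t; rewrite oE => un cy.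
    have E : h :: Y ++ t :: X = rot (size (t :: X)) ((t :: X) ++ h :: Y) by rewrite rot_size_cat.
    by apply: orbit_cycle; rewrite E ?rot_cycle ?rot_uniq.
  have [X1 os'] := orbit_cons (@face_next M) s.
  rewrite (tE _ (orbit_cut bM oh hT oh' os')) -/s !(filter_cat, fc, ps, pt).
  have hk k : k \in h :: Y ++ t :: X -> fconnect (@face_next M) h k by rewrite -oh' fconnect_orbit.
  have sk k : k \in s :: X1 -> fconnect (@face_next M) s k by rewrite -os' fconnect_orbit.
  have -> : filter p X1 = [::].
    apply: nof => k kX pk; have ks : k != s.
      by apply: contraTneq kX => ->; have := orbit_uniq (@face_next M) s; rewrite os' => /andP[].
    have tk := good_face gM (pE _ pk ks); case/negP: diff.
    apply: connect_trans (sk k _) _; first by rewrite inE kX orbT.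
    rewrite fsym; apply: connect_trans (hk t _) tk.
    by rewrite inE mem_cat mem_head !orbT.
  have -> : filter p X = [::].
    apply: nof => k kX pk; have ks : k != s.
      apply: contraNneq diff => <-; rewrite fsym; apply: hk.
      by rewrite inE mem_cat inE kX !orbT.
    by have := nX _ kX; rewrite (pE _ pk ks) eqxx.
  rewrite /= last_cat /= -[@vertex (cut h)]/(@vertex M) (negbTE vst).
  by rewrite -[ancestor _ _]/(@anc (cut h) s t) caE ast.
have os' : orbit (@face_next M) s = s :: X ++ t :: Y.
  have := cycle_orbit fi t; have := orbit_uniq (@face_next M) t; rewrite oE => un cy.
  have E : s :: X ++ t :: Y = rot (size (t :: Y)) ((t :: Y) ++ s :: X) by rewrite rot_size_cat.
  by apply: orbit_cycle; rewrite E ?rot_cycle ?rot_uniq.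
have [X1 oh'] := orbit_cons (@face_next M) h.
rewrite (tE _ (orbit_cut bM oh hT oh' os')) -/s !(filter_cat, fc, ps, pt).
have hk k : k \in h :: X1 -> fconnect (@face_next M) h k by rewrite -oh' fconnect_orbit.
have sk k : k \in s :: X ++ t :: Y -> fconnect (@face_next M) s k by rewrite -os' fconnect_orbit.
have -> : filter p X1 = [::].
  apply: nof => k kX pk; have hkk : fconnect (@face_next M) h k by apply: hk; rewrite inE kX orbT.
  have ks : k != s by apply: contraNneq diff => <-; rewrite fsym.
  have tk := good_face gM (pE _ pk ks); case/negP: diff.
  apply: connect_trans (sk t _) _; first by rewrite inE mem_cat mem_head !orbT.
  by apply: connect_trans tk _; rewrite fsym.
have -> : filter p X = [::].
  apply: nof => k kX pk; have ks : k != s.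
    apply: contraTneq kX => ->; have := orbit_uniq (@face_next M) s.
    by rewrite os' /= mem_cat negb_or => /andP[/andP[]].
  by have := nX _ kX; rewrite (pE _ pk ks) eqxx.
rewrite /= last_cat /= -[@vertex (cut h)]/(@vertex M) eq_sym (negbTE vst).
have -> : @ancestor (cut h) (vertex t) (vertex s) = false by rewrite -(negbTE nts) -caE.
by have -> : @ancestor (cut h) (vertex s) (vertex t) by rewrite -[ancestor _ _]/(@anc (cut h) s t) caE.
Qed.

(** [grows] determines the larger map up to isomorphism; the rotation at the head tells which of the
    two growing steps it is. *)
Lemma grows_giso (P M : growing_map) (j : hedge P -> hedge M) l u :
  grows (head_he P) j (head_he M) l u ->
  exists (rho : new_hedge -> new_hedge) (f : hedge (grow rho P) -> hedge M),
    (rho = ccw_leg_left \/ rho = ccw_leg_right) /\ giso f.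
Proof.
move=> gr; set t := head_he M in gr *.
exists (if ccw t == l then ccw_leg_left else ccw_leg_right).
exists (fun z => match z with inl x => j x | inr NewTail => u | inr NewHead => t | inr NewLeg => l end).
split; first by case: eqP; [left | right].
have [tl tu lu] := grows_new_neq gr.
split=> //; split.
- apply: inj_card_bij; last by rewrite (grows_card gr) card_sum card_new_hedge.
  move=> [x|n] [y|m].
  + by move/(gr_inj gr)->.
  + by have [/eqP h1 /eqP h2 /eqP h3] := grows_neq gr x; case: m.
  + by have [/eqP h1 /eqP h2 /eqP h3] := grows_neq gr y; case: n => // /esym.
  by case: n; case: m => // /eqP; rewrite ?(negbTE tl) ?(negbTE tu) ?(negbTE lu) // eq_sym ?(negbTE tl) ?(negbTE tu) ?(negbTE lu).
- case=> [x|n] /=; first by rewrite (gr_ccw gr).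
  case: (gr_rot gr) => -[e1 e2 e3]; rewrite {1}e1.
    by rewrite eqxx; case: n.
  have -> : (u == l) = false by rewrite eq_sym (negbTE lu).
  by case: n.
- case=> [x|[||]] /=; rewrite ?(gr_u gr) ?(gr_t gr) ?(gr_l gr) //.
  by have [->|xh] := eqVneq x (head_he P); rewrite ?(gr_h gr) ?(gr_opp gr).
- by rewrite /= (gr_root gr).
have mt (x : hedge P) : (inl x \in grow_tree P) = (x \in tree P) || (x == head_he P).
  by rewrite !inE orbF mem_imset // => ? ? [].
case=> [x|n] /=; first by rewrite mt (gr_tree gr).
have -> : (inr n \in grow_tree P) = (n == NewTail).
  rewrite !inE /=; have -> : (inr n \in [set inl x | x in tree P]) = false by apply/imsetP => -[].
  by [].
by case: n; rewrite ?(gr_uT gr) ?(negbTE (gr_tT gr)) ?(negbTE (gr_lT gr)) ?eqxx //; apply/esym/eqP.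
Qed.

(** * Removing the head-vertex *)

Section Ungrow.
Variables (M : tree_map) (dep : hedge M -> nat) (t l : hedge M).
Hypotheses (gM : good t dep) (ol : opp l = l) (lt : l != t) (vl : vertex l = vertex t).
Hypothesis dt : 0 < dep t.

Let bM := good_base gM.
Let rM := base_rooted bM.
Let ci := ccw_inj rM.
Let oi := oppK rM.
Let ot := good_head gM.

Variable u : hedge M.
Hypotheses (uu : isup dep u) (ut : vertex u = vertex t).

Let uT : u \in tree M. Proof. by case/andP: uu. Qed.
Let tT : t \notin tree M. Proof. exact: (leg_notin_tree bM). Qed.
Let lT : l \notin tree M. Proof. exact: (leg_notin_tree bM). Qed.

Lemma ungrow_uniq : uniq [:: t; l; u].
Proof.
rewrite /= !inE negb_or eq_sym lt /= andbT; apply/andP; split.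
  by apply: contraTneq uT => <-.
by apply: contraTneq uT => <-.
Qed.

Lemma ungrow_vertex : vertex t =i [:: t; l; u].
Proof.
have sub : {subset [:: t; l; u] <= enum (vertex t)}.
  move=> x; rewrite mem_enum (mem_vertex ci) !inE => /or3P[] /eqP->; by rewrite ?vl ?ut.
have [|_ E] := uniq_min_size ungrow_uniq sub.
  by rewrite -cardE (vertex_card t bM) eqn0Ngt dt.
by move=> x; rewrite E mem_enum.
Qed.

Definition ungrow_he := {x : hedge M | x \notin vertex t}.

Lemma ungrow_ccw_proof (x : ungrow_he) : ccw (val x) \notin vertex t.
Proof. by have := valP x; rewrite !(mem_vertex ci) (vertex_ccw ci). Qed.
Definition ungrow_ccw (x : ungrow_he) : ungrow_he := exist (fun y => is_true (y \notin vertex t)) _ (ungrow_ccw_proof x).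

(** The half-edge that faced the removed vertex becomes a leg. The default value of [insubd] is
    never reached, by [ungrow_oppE]. *)
Definition ungrow_opp (x : ungrow_he) : ungrow_he :=
  if val x == opp u then x else insubd x (opp (val x)).

Lemma ungrow_head_proof : opp u \notin vertex t.
Proof.
rewrite (mem_vertex ci); apply/eqP => /(dep_vertex rM).
by rewrite -(dep_vertex rM ut) (isup_dep rM uu); apply: n_Sn.
Qed.
Definition ungrow_head : ungrow_he := exist (fun y => is_true (y \notin vertex t)) _ ungrow_head_proof.

Lemma ungrow_root_proof : root_he M \notin vertex t.
Proof.
by rewrite (mem_vertex ci) eq_sym -/(root_vertex M) -(dep_root rM) -lt0n.
Qed.

Definition ungrow_map : tree_map :=
  @TreeMap ungrow_he ungrow_ccw ungrow_opp (exist (fun y => is_true (y \notin vertex t)) _ ungrow_root_proof)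
    [set x | (val x \in tree M) && (val x != opp u)].

Lemma ungrow_oppE (x : ungrow_he) : val x != opp u -> val (ungrow_opp x) = opp (val x).
Proof.
move=> xu; rewrite /ungrow_opp (negbTE xu) val_insubd.
case: ifP => // /negbFE; rewrite ungrow_vertex !inE => /or3P[] /eqP e.
- by have := valP x; rewrite -(oi (val x)) e ot vertex_id.
- by have := valP x; rewrite -(oi (val x)) e ol (mem_vertex ci) vl eqxx.
- by case/eqP: xu; rewrite -e oi.
Qed.

Lemma ungrow_grows : @grows ungrow_map M ungrow_head val t l u.
Proof.
have nv x : x \in [:: t; l; u] -> x \in vertex t by rewrite ungrow_vertex.
split=> //.
- by move=> x y /(congr1 val) /= /ci /val_inj.
- move=> x; apply: val_inj => /=; have [e|xu] := eqVneq (val x) (opp u).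
    by rewrite /ungrow_opp e eqxx e eqxx.
  rewrite ungrow_oppE ungrow_oppE ?oi //.
  have := valP x; apply: contraNneq => /(can_inj oi) ->.
  by rewrite (mem_vertex ci) ut.
- exact: val_inj.
- by move=> x; apply: contra (valP x) => /nv.
- move=> z; case zt : (z \in vertex t); first by left; rewrite -ungrow_vertex.
  by right; exists (exist (fun y => is_true (y \notin vertex t)) z (negbT zt)).
- exact: ungrow_uniq.
- have o3 : fingraph.order (@ccw M) t = 3.
    by rewrite /fingraph.order; have := vertex_card t bM; rewrite eqn0Ngt dt /= cardsE.
  have i3 := iter_order ci t; rewrite o3 /= in i3.
  have un : uniq [:: t; ccw t; ccw (ccw t)] by have := orbit_uniq (@ccw M) t; rewrite /orbit o3.
  have vE x : x \in [:: t; l; u] = (x \in [:: t; ccw t; ccw (ccw t)]).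
    by rewrite -ungrow_vertex inE fconnect_orbit /orbit o3.
  have := vE l; have := vE u; rewrite !inE !eqxx !orbT (negbTE lt).
  have := ungrow_uniq; rewrite /= !inE negb_or => /andP[/andP[_ tu] /andP[lu _]].
  rewrite [u == t]eq_sym (negbTE tu) /= => /esym/orP[] /eqP e1 /esym/orP[] /eqP e2.
  + by rewrite e1 e2 eqxx in lu.
  + by right; rewrite e1 e2.
  + by left; rewrite e1 e2.
  + by rewrite e1 e2 eqxx in lu.
- by move=> x xh; rewrite ungrow_oppE.
- by apply: val_inj; rewrite /= /ungrow_opp /= eqxx.
- move=> x; rewrite inE -(inj_eq val_inj) /=.
  have [->|] := eqVneq (val x) (opp u); last by rewrite andbT orbF.
  by rewrite (tree_opp rM uT) orbT.
- by rewrite inE /= eqxx andbF.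
Qed.

Lemma ungrow_good : @good ungrow_map ungrow_head (dep \o val).
Proof.
have du : dep u = (dep (opp u)).+1 := isup_dep rM uu.
apply: (grows_goodV ungrow_grows (dep' := dep)) => //=.
- by rewrite -du; apply: (dep_vertex rM).
- by rewrite -du; apply: (dep_vertex rM); rewrite vl.
Qed.

End Ungrow.

(** Two legs exhaust the root-vertex, which has degree 2, so no tree edge leaves it and there is no
    other vertex. *)
Lemma single_vertex_iso (M : growing_map) (dep : hedge M -> nat) l :
  good (head_he M) dep -> opp l = l -> l != head_he M -> vertex l = vertex (head_he M) ->
  dep (head_he M) = 0 -> exists f : hedge M0 -> hedge M, giso f.
Proof.
move=> gM ol lt vl dt0; set t := head_he M in gM lt vl dt0 *.
have bM := good_base gM; have rM := base_rooted bM; have ci := ccw_inj rM.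
have ot := good_head gM.
have tr : vertex t = root_vertex M by apply/eqP; rewrite -(dep_root rM) dt0.
have o2 : fingraph.order (@ccw M) t = 2.
  by rewrite /fingraph.order; have := vertex_card t bM; rewrite dt0 /= cardsE.
have i2 := iter_order ci t; rewrite o2 /= in i2.
have vE x : (x \in vertex t) = (x == t) || (x == ccw t).
  by rewrite inE fconnect_orbit /orbit o2 /= !inE.
have lc : l = ccw t.
  have : l \in vertex t by rewrite (mem_vertex ci) vl.
  by rewrite vE (negbTE lt) => /eqP.
have rl : root_he M = l.
  have : root_he M \in vertex t by rewrite (mem_vertex ci) tr.
  by rewrite vE [_ == t]eq_sym (negbTE (good_root gM)) lc => /eqP.
have leg x : vertex x = root_vertex M -> x = t \/ x = l.
  move=> xr; have : x \in vertex t by rewrite (mem_vertex ci) tr xr.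
  by rewrite vE lc => /orP[] /eqP; [left | right].
have nT x : vertex x = root_vertex M -> x \notin tree M.
  by case/leg => ->; apply: (leg_notin_tree bM).
have all_root x : vertex x = root_vertex M.
  elim/(dep_ind rM): x => // x u uu ux IH; case/andP: uu => uT _.
  by case/negP: (nT _ IH); apply: (tree_opp rM).
exists (fun b : bool => if b then t else l); split=> //; split.
- exists (fun x => x == t); first by case; rewrite ?eqxx // (negbTE lt).
  by move=> x; case: eqP => [->//|xt]; case: (leg x (all_root x)).
- by case; rewrite /= lc.
- by case.
- by rewrite rl.
by move=> x; rewrite inE (negbTE (nT _ _)).
Qed.

Lemma giso_inv (M N : growing_map) (f : hedge M -> hedge N) : giso f ->
  exists g : hedge N -> hedge M, giso g.
Proof.
move=> [fM fh]; case: (tiso_bij fM) => g fK gK; exists g; split; last by rewrite -fh fK.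
exact: tiso_can fK gK fM.
Qed.

Lemma giso_comp (M N P : growing_map) (f : hedge M -> hedge N) (g : hedge N -> hedge P) :
  giso f -> giso g -> giso (g \o f).
Proof. by move=> [fM fh] [gN gh]; split; [apply: tiso_comp | rewrite /= fh gh]. Qed.

(** Each undone step removes two non-legs, which bounds the induction. The order of the legs is not
    part of the hypothesis: the word found rebuilds the map, and counting legs yields its suffix
    condition. *)
Lemma good_word (M : growing_map) (dep : hedge M -> nat) : good (head_he M) dep ->
  exists (w : seq letter) (N : growing_map) (f : hedge N -> hedge M),
  [/\ suffix_ok w, phi_word w M0 = Some N & giso f].
Proof.
have [k] := ubnP (nonlegs M); elim: k M dep => // k IH M dep lek gM.
have bM := good_base gM; have rM := base_rooted bM.
have step (P : growing_map) (depP : hedge P -> nat) (a : letter) (M1 : growing_map) (g : hedge M1 -> hedge M) :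
    good (head_he P) depP -> nonlegs M = nonlegs P + 2 -> (a = Lc -> 2 < size (tour_legs P)) ->
    phi_letter a P = Some M1 -> giso g ->
    exists (w : seq letter) (N : growing_map) (f : hedge N -> hedge M),
      [/\ suffix_ok w, phi_word w M0 = Some N & giso f].
  move=> gP nl sz pl gg; have [|w [N [f [ok eN gf]]]] := IH P depP _ gP; first by move: lek; rewrite nl; lia.
  have rP := base_rooted (good_base gP).
  have [f' gf'] := giso_inv gf.
  have [N' [g' [eN' gg']]] := giso_phi gf' (ccw_inj rP) (oppK rP) pl.
  have [g'' gg''] := giso_inv gg'.
  exists (a :: w), N', (g \o g''); split; last exact: giso_comp gg.
  (* Isomorphic maps have equally many legs, so the three legs of [P] give the inequality when the
     letter is [Lc]. *)
  - apply/andP; split=> //; have [N1 [dep1 [eN1 v1 sz1 _]]] := phi_word_valid ok.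
    have NE : N1 = N by move: eN1; rewrite eN => -[].
    have [ea ec] := letter_counts a w; rewrite ea ec.
    move: sz1; rewrite NE (giso_tour gf' (ccw_inj rP) (oppK rP)) size_map.
    have le : 2 * nc w <= nab w by case: (w) ok => // b v /andP[].
    by case: a sz {pl eN' ea ec} => sz; [lia | lia | move: (sz erefl); lia].
  by rewrite /= -/(phi_word w M0) eN.
set t := head_he M in gM *.
have [l /and3P[/eqP ol lt /eqP vl]|no] := pickP (fun l => [&& opp l == l, l != t & vertex l == vertex t]); last first.
  have alone l : opp l = l -> vertex l = vertex t -> l = t.
    by move=> ol vl; apply/eqP; have := no l; rewrite ol vl !eqxx andbT => /negbFE.
  have [h [oh gP sz pc]] := uncut gM alone.
  (* Gluing what was cut restores [opp] only pointwise, so the identity serves as an isomorphism. *)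
  apply: (@step (@GrowingMap (cut h) h) dep Lc
    (@GrowingMap (@glue (cut h) h (opp h)) t) (fun x : hedge M => x) gP _ (fun=> sz) pc).
    exact: nonlegs_cut bM oh.
  split=> //; split=> //; first by exists id.
  move=> x /=; rewrite /glue_opp.
  have [->//|xh] := eqVneq x h; have [->|xs] := eqVneq x (opp h); first by rewrite (oppK rM).
  by rewrite /= cut_opp_out.
have [dt|] := posnP (dep t).
  have [f gf] := single_vertex_iso gM ol lt vl dt.
  by exists [::], M0, f.
move=> dt; have [u uu ut] := up_ex rM dt.
have gr := ungrow_grows gM ol lt vl dt uu ut.
have gP := ungrow_good gM ol lt vl dt uu ut.
pose P := @GrowingMap (ungrow_map gM dt u) (ungrow_head gM uu ut).
have nl := grows_nonlegs gr.
have [rho [f [hrho gf]]] := @grows_giso P M _ _ _ gr.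
case: hrho => e; subst rho.
  by apply: (step P _ La _ f gP nl _ _ gf).
by apply: (step P _ Lb _ f gP nl _ _ gf).
Qed.

(** * The bijection *)

Lemma edge_card (M : tree_map) : involutive (@opp M) -> (forall x : hedge M, opp x != x) ->
  #|hedge M| = #|[set edge x | x : hedge M]| * 2.
Proof.
move=> oi nl; rewrite -cardsT; apply: card_uniform_partition.
  by move=> _ /imsetP[x _ ->]; rewrite cards2 eq_sym nl.
apply/and3P; split.
- apply/eqP/setP => x; rewrite inE; apply/bigcupP; exists (edge x); first exact: imset_f.
  by rewrite !inE eqxx.
- apply/trivIsetP => _ _ /imsetP[x _ ->] /imsetP[y _ ->]; apply: contraR.
  rewrite -setI_eq0 => /set0Pn[z]; rewrite !inE => /andP[/orP[] /eqP zx /orP[] /eqP zy].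
  + by rewrite -zx -zy.
  + by rewrite -zx zy edge_opp.
  + by rewrite -zy zx edge_opp.
  + by rewrite -(edge_opp oi x) -zx zy edge_opp.
- by apply/imsetP => -[x _ /setP/(_ x)]; rewrite !inE eqxx.
Qed.

Lemma nonlegs_closed (M : tree_map) : (forall x : hedge M, opp x != x) ->
  nonlegs M = #|hedge M|.
Proof. by move=> nl; rewrite -cardsT; apply: eq_card => x; rewrite !inE nl. Qed.

(** With H half-edges, 3 V = H + 1 and H = 2 E turn [euler_count] into six times Euler's formula. *)
Lemma base_planar (M : tree_map) (dep : hedge M -> nat) : base dep ->
  (forall x : hedge M, opp x != x) -> planar_map M /\ depth_tree M.
Proof.
move=> bM nl; have rM := base_rooted bM; have ci := ccw_inj rM; have oi := oppK rM.
split; split=> //.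
- by move=> h h'; apply: (connected_by_tree rM); rewrite ?subsetT // => x; rewrite !inE.
- have V := near_cubic_card ci (base_cubic bM); have F := base_euler bM.
  have E := edge_card oi nl; rewrite /euler_count (nonlegs_closed nl) in F.
  rewrite -[X in X + _]/(norb (@ccw M)) -[X in _ + X = _]/(norb (@face_next M)).
  by move: V F E; move: (norb _) (norb _) #|hedge M| #|_|; clear; lia.
- exact: rooted_spanning rM.
- by move=> h /(base_cmp bM).
- exact: base_root bM.
Qed.

Lemma planar_base (M : tree_map) : planar_map M -> depth_tree M -> near_cubic2 M ->
  exists dep : hedge M -> nat, base dep.
Proof.
move=> [ci oi nl _ eu] [st cmp rT] nc; have [dep rM] := spanning_rooted ci oi st.
exists dep; split=> //.
have V := near_cubic_card ci nc; have E := edge_card oi nl.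
move: eu; rewrite /euler_count (nonlegs_closed nl).
rewrite -[X in X + _ = _]/(norb (@ccw M)) -[X in _ + X = _]/(norb (@face_next M)).
by move: V E; move: (norb _) (norb _) #|hedge M| #|_|; clear; lia.
Qed.

Lemma mem_tour (M : growing_map) (dep : hedge M -> nat) x : good (head_he M) dep ->
  (x \in tour_legs M) = (opp x == x) && (x != head_he M).
Proof.
move=> gM; rewrite mem_filter /is_leg; case: eqP => //= ox; case: eqP => //= _.
by rewrite -fconnect_orbit (good_face gM).
Qed.

Lemma tour_uniq (M : growing_map) : uniq (tour_legs M).
Proof. exact/filter_uniq/orbit_uniq. Qed.

Lemma excursion_sizeP n w : excursion_of_size n w <->
  [/\ suffix_ok w, nab w = 2 * n & nc w = n].
Proof.
rewrite /excursion_of_size size_nab; split=> [[/excursionP[ok eq] sz]|[ok ea ec]].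
  by split=> //; lia.
by split; [apply/excursionP; split=> //; lia | lia].
Qed.

Lemma phi_close n w : excursion_of_size n w -> exists (N : growing_map) (dep : hedge N -> nat) l,
  [/\ phi_word w M0 = Some N, valid dep, tour_legs N = [:: l], #|hedge N| = 6 * n + 2
    & Phi w = Some (@MarkedMap (glue (head_he N) l) [set head_he N; l])].
Proof.
case/excursion_sizeP => ok ea ec; have [N [dep [eN vN sz cN]]] := phi_word_valid ok.
have : size (tour_legs N) = 1 by lia.
case E: (tour_legs N) => [|l [|]] // _; exists N, dep, l; split=> //; first by rewrite cN; lia.
by rewrite /Phi eN /= /close_head E.
Qed.

Lemma close_bridgeless_mdm n (N : growing_map) (dep : hedge N -> nat) l :
  good (head_he N) dep -> tour_legs N = [:: l] -> #|hedge N| = 6 * n + 2 ->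
  bridgeless_near_cubic_mdm n (@MarkedMap (glue (head_he N) l) [set head_he N; l]).
Proof.
set h := head_he N => gN tE cN; have bN := good_base gN; have rN := base_rooted bN.
have oh := good_head gN.
have : l \in tour_legs N by rewrite tE mem_head.
rewrite (mem_tour l gN) => /andP[/eqP ol lh].
have fi : injective (@face_next N) := face_inj (ccw_inj rN) (oppK rN).
have hl : h != l by rewrite eq_sym.
have alh := good_anc gN ol.
have bG : @base (glue h l) dep.
  apply: base_glue => //; first by rewrite alh orbT.
  by rewrite (fconnect_sym fi); apply: (good_face gN).
have nl (x : hedge (glue h l)) : opp x != x.
  apply/eqP => /(glue_leg lh)[ox xh xl]; have := mem_tour x gN.
  by rewrite tE inE (negbTE xl) ox eqxx xh.
have aG := glue_anc bN oh ol.
have [pl dt] := base_planar bG nl; have rG := base_rooted bG.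
split.
- split=> //; exists h; first exact: (leg_notin_tree bN oh).
  by rewrite /edge /= glue_opp_h.
- apply: (covered_bridgeless rG) => x.
  case/(good_cov gN) => [[y [yT xy yx dy]]|[xh [k [ok kx dk]]]].
    exists y; rewrite !aG /=.
    have yl : opp y != y by apply: contraTneq dy => ->; rewrite -leqNgt (anc_dep rN).
    by rewrite glue_opp_out //; apply: contraNneq yl => ->; rewrite ?oh ?ol.
  (* Only one leg is left, so every edge that was waiting is covered by the marked edge. *)
  have kl : k = l.
    apply/eqP; have := mem_tour k gN; rewrite tE inE ok eqxx => ->.
    by apply: contraTneq dk => ->; rewrite -leqNgt (anc_dep rN).
  exists h; rewrite !aG /= glue_opp_h -kl; split=> //.
  exact: (leg_notin_tree bN oh).
- exact: base_cubic bG.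
have := edge_card (oppK rG) nl; rewrite -[#|hedge _|]/(#|hedge N|) cN.
by move: #|_|; clear; lia.
Qed.

(* Letters act from right to left, and the first letter of a nonempty excursion is
   [Lc], which leaves no other leg at the head-vertex. *)
Lemma close_leg_above n w (N : growing_map) (dep : hedge N -> nat) l : 0 < n ->
  excursion_of_size n w -> phi_word w M0 = Some N -> good (head_he N) dep ->
  opp l = l -> l != head_he N -> ~~ anc (head_he N) l.
Proof.
move=> n0 /excursion_sizeP[ok ea ec] eN gN ol lh; have rN := base_rooted (good_base gN).
case: w ok ea ec eN => [|a w] ok ea ec; first by move: ea; rewrite /nab /=; lia.
have [ea' ec'] := letter_counts a w.
case/andP: ok => le okw; have le' : 2 * nc w <= nab w by case: (w) okw => // b v /andP[].
have aE : a = Lc by case: a {le} ea' ec' ea ec => // -> ->; lia.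
have [P [depP [eP vP sz _]]] := phi_word_valid okw.
rewrite /= -/(phi_word w M0) eP /= => pl.
have szP : a = Lc -> 2 < size (tour_legs P).
  by move=> _; move: le sz; rewrite ea' ec' aE; lia.
have [ll _] := last_letter_phi vP szP pl.
apply/negP => ahl; have vlh : vertex l = vertex (head_he N).
  by apply: (anc_dep_eq rN (good_anc gN ol)); apply: (anc_dep rN ahl).
move: ll; rewrite aE /last_letter; case: existsP => [_|[]]; first by case: ifP.
by exists l; rewrite ol lh vlh !eqxx.
Qed.

Theorem mainTheorem9 (n : nat) :
  (forall w : seq letter, excursion_of_size n w ->
     exists2 M : marked_map, Phi w = Some M & bridgeless_near_cubic_mdm n M)
  /\ (forall (w w' : seq letter) (M M' : marked_map),
        excursion_of_size n w -> excursion_of_size n w' ->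
        Phi w = Some M -> Phi w' = Some M' -> marked_iso M M' -> w = w')
  /\ (forall M : marked_map, bridgeless_near_cubic_mdm n M ->
        exists (w : seq letter) (M' : marked_map),
          [/\ excursion_of_size n w, Phi w = Some M' & marked_iso M' M]).
Proof.
split; [|split].
- move=> w ex; have [N [dep [l [eN [gN _] tE cN ->]]]] := phi_close ex.
  by eexists; [reflexivity | apply: close_bridgeless_mdm gN tE cN].
- move=> w w' M M' ex ex'.
  (* Size zero is set apart because the marked edge is then a loop, whose halves the depth cannot
     tell apart. *)
  have [n0|n0] := posnP n.
    by case: ex ex' => _ + [_ +]; rewrite n0 => /size0nil-> /size0nil->.
  have [N [dep [l [eN [gN _] tE cN ->]]]] := phi_close ex.
  have [N' [dep' [l' [eN' [gN' _] tE' cN' ->]]]] := phi_close ex'.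
  move=> [<-] [<-] [f /= [fb fc fo fr [ft fm]]].
  have legs (A : growing_map) (dA : hedge A -> nat) k : good (head_he A) dA -> tour_legs A = [:: k] ->
      opp k = k /\ k != head_he A.
    by move=> gA tA; have := mem_tour k gA; rewrite tA mem_head => /esym/andP[/eqP].
  have [ol lh] := legs _ _ _ gN tE; have [ol' lh'] := legs _ _ _ gN' tE'.
  have oh := good_head gN; have oh' := good_head gN'.
  have fiso : @tiso (glue (head_he N) l) (glue (head_he N') l') f by split.
  have fi : injective f := bij_inj fb.
  have aE (x y : hedge N) : @anc N' (f x) (f y) = @anc N x y.
    have := @tiso_anc (glue (head_he N) l) (glue (head_he N') l') f x y fiso.
    by rewrite (glue_anc (good_base gN') oh' ol') (glue_anc (good_base gN) oh ol).
  have nhl' := close_leg_above n0 ex' eN' gN' ol' lh'.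
  have inm x : x \in [set head_he N; l] -> f x \in [set head_he N'; l'].
    by move=> xin; rewrite -fm imset_f.
  (* The isomorphism might swap the two halves of the marked edge; this is ruled out because the
     head is strictly below the other half. *)
  have fh : f (head_he N) = head_he N'.
    have := inm (head_he N); rewrite !inE eqxx => /(_ isT)/orP[/eqP//|/eqP fhl].
    have := inm l; rewrite !inE eqxx orbT => /(_ isT)/orP[] /eqP fl.
      by case/negP: nhl'; rewrite -fl -fhl aE (good_anc gN).
    by case/eqP: lh; apply: fi; rewrite fl fhl.
  have fl : f l = l' by have := fo (head_he N); rewrite glue_opp_h fh glue_opp_h.
  have [ok _ _] := (excursion_sizeP n w).1 ex; have [ok' _ _] := (excursion_sizeP n w').1 ex'.
  apply: (phi_word_inj ok ok' eN eN' (f := f)); split=> //; split=> // x.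
  have [->|xh] := eqVneq x (head_he N); first by rewrite oh fh oh'.
  have [->|xl] := eqVneq x l; first by rewrite ol fl ol'.
  have := fo x; rewrite !glue_opp_out //; first by rewrite -fh (inj_eq fi).
  by rewrite -fl (inj_eq fi).
move=> M [[pM dM [x xT mE]] brM ncM eM].
have [dep bM] := planar_base pM dM ncM; have rM := base_rooted bM; have oi := oppK rM.
have cov := bridgeless_covered rM (base_cmp bM) brM.
have nl (y : hedge M) : opp y != y by case: pM => _ _ /(_ y).
have oT y : y \notin tree M -> opp y \notin tree M.
  by apply: contra => /(tree_opp rM); rewrite oi.
(* The head must be the half with the deeper end, and not the root. If that half is the root, both
   ends are at the root-vertex and the other half serves. *)
have [h [hT hE hr ash]] : exists h : hedge M,
    [/\ h \notin tree M, edge h = edge x, h != root_he M & anc (opp h) h].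
  have pick_low : exists h : hedge M, [/\ h \notin tree M, edge h = edge x & anc (opp h) h].
    have /orP[a|a] := base_cmp bM xT; last by exists x.
    by exists (opp x); rewrite oT // edge_opp // oi.
  have [h [hT hE ash]] := pick_low; have [hr|hr] := eqVneq h (root_he M); last by exists h.
  have v : vertex (opp h) = vertex h by apply/eqP; rewrite -(anc_rootv rM) // hr.
  exists (opp h); rewrite oT // edge_opp // oi; split=> //; last exact: (anc_eq rM).
  by rewrite -hr nl.
have oh := nl h.
have gP : @good (cut h) h dep.
  apply: (good_cut bM oh hT) => //.
  - by move=> l /eqP; rewrite (negbTE (nl l)).
  - by move=> l /eqP; rewrite (negbTE (nl l)).
  - by move=> y /cov; left.
pose P := @GrowingMap (cut h) h.
have [w [N [f [ok eN gf]]]] := @good_word P dep gP.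
have [N1 [depN [eN1 [gN _] sz cN]]] := phi_word_valid ok.
have NE : N1 = N by move: eN1; rewrite eN => -[].
subst N1; have rN := base_rooted (good_base gN).
have [fM fh] := gf.
have tP : tour_legs P = [:: opp h].
  apply: perm_small_eq => //; apply: uniq_perm => //; first exact: tour_uniq.
  move=> y; rewrite (@mem_tour P dep y gP) inE /= /cut_opp.
  have [->|yh] /= := eqVneq y h; first by rewrite andbF eq_sym (negbTE oh).
  by have [->|ys] := eqVneq y (opp h); rewrite ?eqxx // (negbTE (nl y)).
have := giso_tour gf (ccw_inj rN) (oppK rN); rewrite tP.
case tN: (tour_legs N) => [|k [|]] // [fk].
have cM : #|hedge N| = #|hedge M| := bij_eq_card (tiso_bij fM).
(* A closed map of size [n] has 6 n + 2 half-edges, while the word produces 3 nab w + 2. *)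
have ea : nab w = 2 * n.
  have := edge_card oi nl; rewrite eM -cM cN; lia.
have ec : nc w = n by move: sz; rewrite tN /=; lia.
exists w, (@MarkedMap (glue (head_he N) k) [set head_he N; k]); split.
- exact/excursion_sizeP.
- by rewrite /Phi eN /= /close_head tN.
exists f; split.
- exact: tiso_bij fM.
- exact: tiso_ccw fM.
- move=> y /=; rewrite /glue_opp.
  have [->|yh] := eqVneq y (head_he N); first by rewrite -fk fh.
  have [->|yk] := eqVneq y k; first by rewrite -fk fh oi.
  rewrite (tiso_opp fM) /= cut_opp_out //; first by rewrite -[h]fh (inj_eq (tiso_inj fM)).
  by rewrite fk (inj_eq (tiso_inj fM)).
- exact: tiso_root fM.
split; first exact: tiso_tree fM.
by rewrite mE -hE /edge imsetU1 imset_set1 fh fk.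
Qed.
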